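(* Let $X_1,X_2,\dots$ be independent observations from a density $f_0$ on $[0,1]$ with cumulative distribution function $F_0$ and quantile function $Q_0=F_0^{-1}$, and let $F_n$ be the empirical distribution function of $X_1,\dots,X_n$. Fix $m\ge1$ and let $k=2^m$ be the (fixed) number of cells. Consider any quantile pyramid prior $\Pi_m(q)$ for the quantiles $q=(q_1,\dots,q_{k-1})$, $q_j=Q(j/k)$, and let the pseudo-posterior distribution of $q$ given $X_1,\dots,X_n$ be defined as being proportional to $\Pi_m(q)L_n(q)$, in terms of the multinomial likelihood $$L_n(q)=\frac{n!}{N_1(q)!\cdots N_k(q)!}\Bigl(\frac1k\Bigr)^n,\qquad N_j(q)=nF_n(q_{j-1},q_j],\quad q_0=0,\ q_k=1.$$ Let $q_j^*=F_n^{-1}(j/k)$ and $q_j^0=Q_0(j/k)$. Then with probability $1$ the pseudo-posterior distribution of $q$ is such that, as $n\to\infty$, the distribution of the vector with components $$C_{n,j}=\sqrt n\,(q_j-q_j^* )=\sqrt n\,\{Q(j/k)-F_n^{-1}(j/k)\},\qquad j=1,\dots,k-1,$$ converges to that of the vector with components $C_j=W^0(j/k)/f_0(q_j^0)$, $j=1,\dots,k-1$, where $W^0$ is a Brownian bridge.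
   Context: A quantile pyramid prior down to level $m$ is a joint density for $q=(q_1,\dots,q_{k-1})$, $q_j=Q(j/2^m)$, $k=2^m$, on $\{0<q_1<\cdots<q_{k-1}<1\}$ (with $Q(0)=0$, $Q(1)=1$) of the product form $$\Pi_m(q)=\prod_{l=1}^m\ \prod_{j=1,3,\dots,2^l-1}\pi_{l,j}\bigl(Q(j/2^l)\mid Q((j-1)/2^l),Q((j+1)/2^l)\bigr),$$ where each $\pi_{l,j}(\cdot\mid a,b)$ is a probability density concentrated on $[a,b]$; that is, first the median $Q(1/2)$ is drawn on $[0,1]$, then, conditionally independently given previous levels, the two quartiles in the intervals determined by the median, and so on down to level $m$. Here $F_n(a,b]$ denotes the empirical proportion of data points in $(a,b]$, and $F^{-1}(y)=\inf\{t:F(t)\ge y\}$. The Brownian bridge $W^0$ is the zero-mean Gaussian process on $[0,1]$ with covariance $\mathrm{Cov}(W^0(y_1),W^0(y_2))=y_1(1-y_2)$ for $y_1\le y_2$. ''With probability 1'' refers to the random sequence of observations, and convergence is convergence in distribution of the (random) pseudo-posterior laws.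
   Formalization: Added assumptions, without which the claim fails: f_0 is positive and continuous at each true quantile q_j^0, and the joint prior density Π_m is positive and continuous at the true quantile vector q^0 (a prior vanishing near q^0 is a counterexample). *)

(* Defs.v *)
From HB Require Import structures.
From mathcomp Require Import all_boot all_order all_algebra.
From mathcomp Require Import all_classical all_reals all_analysis.

Set Implicit Arguments.
Unset Strict Implicit.
Unset Printing Implicit Defensive.

Import Order.TTheory GRing.Theory Num.Theory.
Import numFieldNormedType.Exports.

Local Open Scope classical_set_scope.
Local Open Scope ring_scope.

(* Lebesgue measure on R^n, carried by n.-tuple R: the image under
   (x, v) |-> x :: v of the product of the Lebesgue measures on R and R^(n-1);
   see lebesgue_tuple_box for its value on boxes. *)
Section lebesgue_tupleS.
Context (R : realType) (n : nat).
Variable mu : {sigma_finite_measure set (n.-tuple R) -> \bar R}.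

Definition consp (xv : measurableTypeR R * n.-tuple R) : n.+1.-tuple R :=
  [tuple of (xv.1 : R) :: xv.2].

Lemma measurable_consp : measurable_fun setT consp.
Proof. exact: (measurable_cons measurable_fst measurable_snd). Qed.

Definition lebesgue_tupleS : set (n.+1.-tuple R) -> \bar R :=
  pushforward (lebesgue_measure \x mu)%E consp.

Let mconsp A : measurable A -> measurable (consp @^-1` A).
Proof. by move=> mA; rewrite -[X in measurable X]setTI; exact: measurable_consp. Qed.

Let lebesgue_tupleS0 : lebesgue_tupleS set0 = 0%E.
Proof. by rewrite /lebesgue_tupleS /pushforward preimage_set0 measure0. Qed.

Let lebesgue_tupleS_ge0 A : (0 <= lebesgue_tupleS A)%E.
Proof. by apply: integral_ge0 => x _; exact: measure_ge0. Qed.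

Let lebesgue_tupleS_sigma_additive : semi_sigma_additive lebesgue_tupleS.
Proof.
move=> F mF tF mUF; rewrite /lebesgue_tupleS /pushforward preimage_bigcup.
apply: measure_semi_sigma_additive.
- by move=> k; exact: mconsp.
- apply/trivIsetP => /= i j _ _ ij; rewrite -preimage_setI.
  by move/trivIsetP : tF => /(_ _ _ _ _ ij) ->//; rewrite preimage_set0.
- by rewrite -preimage_bigcup; exact: mconsp.
Qed.

HB.instance Definition _ := isMeasure.Build _ _ _ lebesgue_tupleS
  lebesgue_tupleS0 lebesgue_tupleS_ge0 lebesgue_tupleS_sigma_additive.

Lemma lebesgue_tupleS_cons (A : set R) (B : set (n.-tuple R)) :
  measurable A -> measurable B ->
  lebesgue_tupleS [set v | A (thead v) /\ B [tuple of behead v]] =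
  (lebesgue_measure A * mu B)%E.
Proof.
move=> mA mB; rewrite -product_measure1E//.
congr ((_ \x _)%E _); apply/seteqP; split=> -[x v] /=; rewrite theadE.
  by case=> Ax Bv; split => //; congr B: Bv; exact: val_inj.
by case=> Ax Bv; split => //; congr B: Bv; exact: val_inj.
Qed.

Let lebesgue_tupleS_sigma_finite : sigma_finite setT lebesgue_tupleS.
Proof.
have /sigma_finiteP[F [TF ndF Foo]] := sigma_finiteT (@lebesgue_measure R).
have /sigma_finiteP[G [TG ndG Goo]] := sigma_finiteT mu.
exists (fun i => [set v | F i (thead v) /\ G i [tuple of behead v]]).
  apply/esym; rewrite -subTset => v _.
  have : [set: measurableTypeR R] (thead v) by [].
  rewrite TF => -[i _ Fi].
  have : [set: n.-tuple R] [tuple of behead v] by [].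
  rewrite TG => -[j _ Gj]; exists (maxn i j) => //; split.
    by move: Fi; exact/subsetPset/ndF/leq_maxl.
  by move: Gj; exact/subsetPset/ndG/leq_maxr.
move=> i; have [mFi Fioo] := Foo i; have [mGi Gioo] := Goo i; split.
  apply: measurableI.
    by rewrite -[X in measurable X]setTI; exact: (@measurable_tnth _ R).
  by rewrite -[X in measurable X]setTI; exact: measurable_behead.
by rewrite lebesgue_tupleS_cons// lte_mul_pinfty// ge0_fin_numE.
Qed.

HB.instance Definition _ := Measure_isSigmaFinite.Build _ _ _ lebesgue_tupleS
  lebesgue_tupleS_sigma_finite.

End lebesgue_tupleS.

Fixpoint lebesgue_tuple (R : realType) (n : nat) :
    {sigma_finite_measure set (n.-tuple R) -> \bar R} :=
  if n is n'.+1 then lebesgue_tupleS (lebesgue_tuple R n')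
  else dirac [tuple].

Lemma lebesgue_tuple_box (R : realType) n (A : 'I_n -> set R) :
  (forall i, measurable (A i)) ->
  lebesgue_tuple R n [set v | forall i, A i (tnth v i)] =
  (\prod_(i < n) lebesgue_measure (A i))%E.
Proof.
elim: n A => [A mA|n IHn A mA].
  rewrite big_ord0 /= diracE (_ : _ \in _)//.
  by apply/mem_set => -[].
have mB : measurable [set v : n.-tuple R | forall i, A (lift ord0 i) (tnth v i)].
  rewrite (_ : [set v | _] = \bigcap_(i in [set: 'I_n])
      ((fun v => tnth v i) @^-1` A (lift ord0 i))); last first.
    by apply/seteqP; split => v /= Av i; [move=> _|]; exact: Av.
  apply: fin_bigcap_measurable; first exact: finite_finset.
  by move=> i _; rewrite -[X in measurable X]setTI; exact: (@measurable_tnth _ R).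
rewrite big_ord_recl -IHn// -lebesgue_tupleS_cons//=; congr lebesgue_tupleS.
apply/seteqP; split => v /=.
  by move=> Av; split=> [|i]; [exact: Av|rewrite -(tnthS (thead v)) -tuple_eta; exact: Av].
move=> [A0 AS] i; have [j ->|->//] := unliftP ord0 i.
by move: (AS j); rewrite -(tnthS (thead v)) -tuple_eta.
Qed.

Section quantile_pyramids.
Context (R : realType).

Definition is_density (a b : R) (f : R -> R) : Prop :=
  [/\ measurable_fun setT f,
      forall x, 0 <= f x,
      forall x, x \notin `[a, b] -> f x = 0
    & (\int[lebesgue_measure]_x (f x)%:E = 1)%E].

(* dens l j a b x stands for pi_{l,j}(x | a, b). *)
Definition quantile_pyramid (m : nat) (dens : nat -> nat -> R -> R -> R -> R) :=
  forall l j, (1 <= l <= m)%N -> (j < 2 ^ l)%N -> odd j ->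
    measurable_fun setT
      (fun z : R * R * R => dens l j z.1.1 z.1.2 z.2) /\
    forall a b, 0 <= a -> a < b -> b <= 1 -> is_density a b (dens l j a b).

(* For q = (q_1, ..., q_(k-1)), the value q_j for 0 <= j <= k, with q_0 = 0
   and q_k = 1. *)
Definition qtl k (q : k.-1.-tuple R) (j : nat) : R := nth 0 (0 :: rcons q 1) j.

(* Q(j / 2^l) = q_(j 2^(m-l)) for l <= m. *)
Definition pyramid_prior m (dens : nat -> nat -> R -> R -> R -> R)
    (q : (2 ^ m).-1.-tuple R) : R :=
  let Q l j := qtl q (j * 2 ^ (m - l))%N in
  if path <%R 0 (rcons q 1) then
    \prod_(1 <= l < m.+1) \prod_(1 <= j < (2 ^ l)%N | odd j)
      dens l j (Q l j.-1) (Q l j.+1) (Q l j)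
  else 0.

Definition ecdf (x : nat -> R) (n : nat) (t : R) : R :=
  (\sum_(i < n) (x i <= t)%R)%N%:R / n%:R.

Definition cdf_of_density (f : R -> R) (t : R) : R :=
  \int[lebesgue_measure]_(x in `]-oo, t]) f x.

Definition quantile_fun (F : R -> R) (y : R) : R := inf [set t | y <= F t].

(* n F_n(a, b] *)
Definition cell_count (x : nat -> R) (n : nat) (a b : R) : nat :=
  (\sum_(i < n) (a < x i <= b)%R)%N.

Definition multinomial_likelihood k (x : nat -> R) (n : nat)
    (q : k.-1.-tuple R) : R :=
  n`!%:R / \prod_(1 <= j < k.+1) (cell_count x n (qtl q j.-1) (qtl q j))`!%:R
  * k%:R^-1 ^+ n.

Definition pseudo_posterior m (dens : nat -> nat -> R -> R -> R -> R)
    (x : nat -> R) (n : nat) (A : set ((2 ^ m).-1.-tuple R)) : \bar R :=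
  let g q := (pyramid_prior dens q * multinomial_likelihood x n q)%:E in
  let mu := lebesgue_tuple R (2 ^ m).-1 in
  ((fine (\int[mu]_q g q))^-1%:E * \int[mu]_(q in A) g q)%E.

End quantile_pyramids.

Section weak_convergence.
Context (R : realType) (n : nat).

(* The topology of R^n is carried by row vectors, its Borel sets by tuples. *)
Definition tuple_of_row (v : 'rV[R]_n) : n.-tuple R := [tuple v ord0 i | i < n].
Definition row_of_tuple (t : n.-tuple R) : 'rV[R]_n := \row_i tnth t i.

Definition cvg_in_distribution (mu_ : nat -> set (n.-tuple R) -> \bar R)
    (mu : set (n.-tuple R) -> \bar R) : Prop :=
  forall g : n.-tuple R -> R,
    continuous (g \o tuple_of_row) ->
    (exists M : R, forall x, `|g x| <= M) ->
    (\int[mu_ i]_x (g x)%:E)%E @[i --> \oo] --> (\int[mu]_x (g x)%:E)%E.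

End weak_convergence.

Section random_variables.
Context d (T : measurableType d) (R : realType) (P : probability T R).

Definition mutually_independent (X : nat -> {RV P >-> R}) : Prop :=
  forall (s : seq nat) (B : nat -> set R), uniq s ->
    (forall i, measurable (B i)) ->
    P (\bigcap_(i in [set` s]) (X i @^-1` B i)) =
    (\prod_(i <- s) P (X i @^-1` B i))%E.

Definition has_density (Y : {RV P >-> R}) (f : R -> R) : Prop :=
  forall A : set R, measurable A ->
    distribution P Y A = (\int[lebesgue_measure]_(x in A) (f x)%:E)%E.

(* normal_prob mu 0 is not the Dirac mass at mu, hence the case s = 0. *)
Definition is_gaussian (Y : T -> R) : Prop :=
  exists mu s : R, forall A : set R, measurable A ->
    P (Y @^-1` A) = if s == 0 then \d_mu A else normal_prob mu s A.

Definition gaussian_process (D : set R) (W : R -> {RV P >-> R}) : Prop :=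
  forall (n : nat) (t c : 'I_n -> R), (forall i, D (t i)) ->
    is_gaussian (fun w => \sum_(i < n) c i * W (t i) w).

Definition brownian_bridge (W : R -> {RV P >-> R}) : Prop :=
  [/\ gaussian_process `[0, 1] W,
      forall y, 0 <= y <= 1 -> ('E_P[W y] = 0)%E
    & forall y1 y2, 0 <= y1 -> y1 <= y2 -> y2 <= 1 ->
        covariance P (W y1) (W y2) = (y1 * (1 - y2))%:E].

End random_variables.

(* Main.v *)
Require Import Defs.
From HB Require Import structures.
From mathcomp Require Import all_boot all_order all_algebra.
From mathcomp Require Import all_classical all_reals all_analysis.
From mathcomp Require Import measurable_realfun.
From mathcomp Require Import ring lra.

Set Implicit Arguments.
Unset Strict Implicit.
Unset Printing Implicit Defensive.

Import Order.TTheory GRing.Theory Num.Theory.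
Import numFieldNormedType.Exports.

Local Open Scope classical_set_scope.
Local Open Scope ring_scope.

(** With a = floor(n/k) and r_a(N) = a! a^(N-a) / N!, the likelihood is
    kappa_n * prod_j r_a(N_j), where r_a(N) <= exp(-((N-a)^2 - |N-a|)/(2n)) and
    r_a(N) -> exp(-k z^2/2) as soon as (N-a)/sqrt n -> z. By Chernoff bounds and
    Borel-Cantelli on a grid of mesh eps/sqrt n around q_j^0, almost surely
    n F_n(a,b] = n f_0(q_j^0)(b-a) + o(sqrt n + n(b-a)) locally uniformly. Hence,
    for q = q^* + t/sqrt n, prior times likelihood (divided by kappa_n) converges
    pointwise to
      Pi(q^0) exp(-(k/2) sum_j (f_j t_j - f_(j-1) t_(j-1))^2)
    and is dominated by a product of Gaussian functions as long as q is near q^0;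
    elsewhere the likelihood is exponentially small and the prior has mass at
    most 1. The limit is, up to normalisation, the density of W^0(j/k)/f_j,
    because the rescaled increments of j |-> W^0(j/k)/(k-j) are orthonormal. *)

(** * Lebesgue measure on tuples *)

(** Independent Poisson counts conditioned on their total are multinomial. Since the cell counts
    always sum to n, the likelihood is, up to a factor free of q, a product of one-cell Poisson
    weights; taking the mean to be the integer floor(n/k) costs at most 1 per cell, negligible
    against sqrt n. The counts are expanded around the sample quantiles because the law of large
    numbers only locates F_n at q_j^0 up to o(1), which is useless at scale 1/sqrt n. The mesh
    eps/sqrt n gives each cell a mean count of order sqrt n. A deviation of that order then has
    probability exp(-c sqrt n), which beats the number of cells and is summable. Randomness of the
    data ends there: the posterior limit is proved for one fixed sample with a few deterministic
    properties. A Gaussian process is known only through the laws of linear combinations of its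
    values, so the limit is identified by a uniqueness theorem of Cramer-Wold type, stated with
    cosines to stay within real integrals. No normalising constant is computed: the numerator and
    the normaliser share kappa_n and Pi(q^0). *)

Section affine_change.
Context {R : realType}.
Local Notation leb := (@lebesgue_measure R).

(** Lebesgue measure is determined by half-open intervals. For s < 0 the preimage is closed on the
    other side, which leaves its length unchanged. *)
Lemma lebesgue_measure_affine (b s : R) (A : set R) : s != 0 -> measurable A ->
  (`|s|%:E * pushforward leb (fun x => (b + s * x)%R : measurableTypeR R) A = leb A)%E.
Proof.
move=> s0 mA.
have mphi : @measurable_fun _ _ (measurableTypeR R) (measurableTypeR R) setT (fun x => b + s * x).
  by apply: measurable_funD => //; exact: measurable_funM.
pose push := measure_function_pushforward__canonical__measure_function_Measure leb mphi.
pose mu := mscale (NngNum (normr_ge0 s)) (push).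
rewrite (@lebesgue_measure_unique R mu)// => _ [[x y] /= xy <-].
rewrite /mu /mscale/= /pushforward/=.
have [s_gt0|s_lt0] := ltP 0 s.
  have -> : (fun z => b + s * z) @^-1` `]x, y]%classic =
     `](x - b) / s, (y - b) / s]%classic.
    apply/seteqP; split => z /=; rewrite !in_itv/= ltr_pdivrMr// ler_pdivlMr// ltrBlDl lerBrDl (mulrC z)//.
  rewrite !lebesgue_measure_itv/= !lte_fin ltr_pM2r ?invr_gt0// ltrD2r.
  case: ifPn => _; last by rewrite mule0.
  rewrite -!EFinD -EFinM gtr0_norm//; congr EFin; field.
  by rewrite gt_eqF.
have {}s_lt0 : s < 0 by rewrite lt_neqAle s0.
have -> : (fun z => b + s * z) @^-1` `]x, y]%classic =
     `[(y - b) / s, (x - b) / s[%classic.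
  apply/seteqP; split => z /=; rewrite !in_itv/= ler_ndivrMr// ltr_ndivlMr// ltrBlDl lerBrDl (mulrC z) andbC//.
rewrite !lebesgue_measure_itv/= !lte_fin ltr_nM2r ?invr_lt0// ltrD2r.
case: ifPn => _; last by rewrite mule0.
rewrite -!EFinD -EFinM ltr0_norm//; congr EFin; field.
by rewrite lt_eqF.
Qed.

Lemma ge0_integral_affine (F : R -> \bar R) (b s : R) : s != 0 ->
  measurable_fun setT F -> (forall x, 0 <= F x)%E ->
  (\int[leb]_x F x = `|s|%:E * \int[leb]_x F (b + s * x)%R)%E.
Proof.
move=> s0 mF F0.
have mphi : @measurable_fun _ _ (measurableTypeR R) (measurableTypeR R) setT (fun x => b + s * x).
  by apply: measurable_funD => //; exact: measurable_funM.
pose push := measure_function_pushforward__canonical__measure_function_Measure leb mphi.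
have := @ge0_integral_pushforward _ _ (measurableTypeR R) (measurableTypeR R) R _ mphi leb setT F measurableT mF (fun y _ => F0 y).
rewrite preimage_setT /= => <-.
transitivity (\int[mscale (NngNum (normr_ge0 s)) push]_x F x)%E.
  by apply: eq_measure_integral => A mA _; exact: esym (lebesgue_measure_affine b s0 mA).
by rewrite ge0_integral_mscale.
Qed.

End affine_change.

Section lebesgue_tuple_integral.
Context {R : realType}.
Local Notation leb := (@lebesgue_measure R).

Lemma ge0_integral_lebesgue_tupleS n (F : n.+1.-tuple R -> \bar R) :
  measurable_fun setT F -> (forall v, 0 <= F v)%E ->
  (\int[lebesgue_tuple R n.+1]_v F v =
   \int[leb]_x \int[lebesgue_tuple R n]_v F [tuple of x :: v])%E.
Proof.
move=> mF F0.
have mc := @measurable_consp R n.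
have := @ge0_integral_pushforward _ _ _ _ R _ mc (leb \x lebesgue_tuple R n)%E setT F measurableT mF (fun y _ => F0 y).
rewrite preimage_setT => H.
rewrite [LHS]H fubini_tonelli1//.
  exact: measurableT_comp.
by move=> z; exact: F0.
Qed.

Lemma ge0_integral_lebesgue_tuple0 (F : 0.-tuple R -> \bar R) :
  measurable_fun setT F ->
  (\int[lebesgue_tuple R 0]_v F v = F [tuple])%E.
Proof. by move=> mF; rewrite /= integral_dirac// diracT mul1e. Qed.

Lemma measurable_integral_tuple_cons n (F : n.+1.-tuple R -> \bar R) :
  measurable_fun setT F -> (forall v, 0 <= F v)%E ->
  measurable_fun setT (fun x : R => (\int[lebesgue_tuple R n]_v F [tuple of x :: v])%E).
Proof.
move=> mF F0.
apply: (@measurable_fun_fubini_tonelli_F _ _ (measurableTypeR R) _ _ (lebesgue_tuple R n) (F \o @consp R n)).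
  exact: measurableT_comp (@measurable_consp R n).
by move=> z; exact: F0.
Qed.

Lemma measurable_cons_l n (F : n.+1.-tuple R -> \bar R) (x : R) :
  measurable_fun setT F -> measurable_fun setT (fun v : n.-tuple R => F [tuple of x :: v]).
Proof.
move=> mF; apply: measurableT_comp => //.
exact: (measurable_cons (measurable_cst _) (@measurable_id _ _ _)).
Qed.

Lemma measurable_fun_tuple d (T : measurableType d) n (f : 'I_n -> T -> R) :
  (forall i, measurable_fun setT (f i)) ->
  measurable_fun setT (fun x => [tuple f i x | i < n]).
Proof.
move=> mf; apply/measurable_fun_tnthP => i.
by rewrite (_ : _ \o _ = f i)//; apply/funext => x /=; rewrite tnth_mktuple.
Qed.

Lemma measurable_nth_tuple n (i : nat) (x0 : R) :
  measurable_fun setT (fun v : n.-tuple R => nth x0 v i).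
Proof.
have [ni|ni] := leqP n i.
  rewrite (_ : (fun _ => _) = cst x0)//.
  by apply/funext => v; rewrite nth_default// size_tuple.
rewrite (_ : (fun _ => _) = (fun v => tnth v (Ordinal ni))).
  exact: measurable_tnth.
by apply/funext => v; rewrite (tnth_nth x0).
Qed.

(** Lower bidiagonal affine map: coordinate i involves t_i and t_(i-1), with [y] in the place of
    t_(-1). For [r = 0] it is a coordinatewise rescaling; with [r] it also covers passing to
    increments of a path. *)
Definition chain_map (n : nat) (b s r : nat -> R) (y : R) (t : n.-tuple R) : n.-tuple R :=
  [tuple b i + s i * tnth t i + r i * nth 0 (y :: t) i | i < n].

Lemma measurable_chain_map n b s r y : measurable_fun setT (@chain_map n b s r y).
Proof.
apply: measurable_fun_tuple => i.
apply: measurable_funD; last first.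
  apply: measurable_funM => //.
  case: i => -[|i] Hi /=; first exact: measurable_cst.
  exact: measurable_nth_tuple.
apply: measurable_funD => //; apply: measurable_funM => //.
exact: measurable_tnth.
Qed.

(** Tonelli isolates the first coordinate, whose offset [r 0 * y] is constant and absorbed by a
    one-dimensional affine change. That coordinate then plays the role of [y] for the tail, so the
    Jacobian is the product of the diagonal and no determinant occurs. *)
Lemma ge0_integral_chain_map n (b s r : nat -> R) (y : R) (F : n.-tuple R -> \bar R) :
  (forall i, s i != 0) -> measurable_fun setT F -> (forall v, 0 <= F v)%E ->
  (\int[lebesgue_tuple R n]_v F v =
   (\prod_(i < n) `|s i|)%:E * \int[lebesgue_tuple R n]_t F (chain_map b s r y t))%E.
Proof.
elim: n b s r y F => [|n IHn] b s r y F s0 mF F0.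
  rewrite !ge0_integral_lebesgue_tuple0// ?big_ord0 ?mul1e.
    by congr F; apply: eq_from_tnth => -[].
  exact: measurableT_comp (measurable_chain_map _ _ _ _).
have mG := measurable_chain_map b s r y (n := n.+1).
rewrite !ge0_integral_lebesgue_tupleS//; last exact: measurableT_comp mG.
have mI : measurable_fun setT (fun x : R => \int[lebesgue_tuple R n]_v F [tuple of x :: v])%E.
  exact: measurable_integral_tuple_cons.
have I0 (x : R) : (0 <= \int[lebesgue_tuple R n]_v F [tuple of x :: v])%E.
  exact: integral_ge0.
have -> := @ge0_integral_affine _ _ (b 0%N + r 0%N * y) (s 0%N) (s0 0%N) mI I0.
rewrite big_ord_recl EFinM -muleA; congr (_ * _)%E.
rewrite -ge0_integralZl//; last 3 first.
  apply: (@measurable_integral_tuple_cons _ (F \o chain_map b s r y)) => //.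
    exact: measurableT_comp mG.
  by move=> v; exact: F0.
  by move=> x _; apply: integral_ge0 => v _; exact: F0.
  by rewrite lee_fin; apply: prodr_ge0.
apply: eq_integral => x _.
rewrite (IHn (fun i => b i.+1) (fun i => s i.+1) (fun i => r i.+1) x)//; last first.
  exact: measurable_cons_l.
congr (_ * _)%E; apply: eq_integral => v _; congr F.
apply: eq_from_tnth => i.
rewrite tnth_mktuple; have [j ->|->] := unliftP ord0 i; last first.
  by rewrite !tnth0/= addrAC.
by rewrite !tnthS tnth_mktuple.
Qed.

Lemma ge0_integral_prod n (h : 'I_n -> R -> R) :
  (forall i, measurable_fun setT (h i)) -> (forall i x, 0 <= h i x) ->
  (\int[lebesgue_tuple R n]_v (\prod_(i < n) h i (tnth v i))%:E =
   \prod_(i < n) \int[leb]_x (h i x)%:E)%E.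
Proof.
elim: n h => [|n IHn] h mh h0.
  rewrite ge0_integral_lebesgue_tuple0 ?big_ord0//.
  apply/measurable_EFinP; rewrite (_ : (fun _ => _) = cst 1)//.
  by apply/funext => v; rewrite big_ord0.
have mP m (g : 'I_m -> R -> R) : (forall i, measurable_fun setT (g i)) ->
   measurable_fun setT (fun v : m.-tuple R => \prod_(i < m) g i (tnth v i)).
  move=> mg; apply: measurable_prod => i _.
  exact: (measurableT_comp (mg i) (measurable_tnth i)).
rewrite ge0_integral_lebesgue_tupleS; last 2 first.
  by apply/measurable_EFinP; exact: mP.
  by move=> v; rewrite lee_fin; apply: prodr_ge0.
rewrite big_ord_recl -IHn//.
rewrite -ge0_integralZr//; last 3 first.
  exact: (measurableT_comp (@EFin_measurable R setT) (mh ord0)).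
  by move=> x _; rewrite lee_fin.
  by apply: integral_ge0 => v _; rewrite lee_fin; apply: prodr_ge0.
apply: eq_integral => x _.
rewrite -ge0_integralZl//; last 3 first.
  apply/measurable_EFinP; exact: (mP n (fun i => h (lift ord0 i))).
  by move=> v _; rewrite lee_fin; apply: prodr_ge0.
  by rewrite lee_fin.
apply: eq_integral => v _.
rewrite -EFinM big_ord_recl tnth0; congr (_ * _)%:E.
by apply: eq_bigr => i _; rewrite tnthS.
Qed.

(** A neighbourhood of a matrix contains a family of neighbourhoods of its entries, and there are
    finitely many entries. *)
Lemma row_of_tuple_cvg (T : Type) (F : set_system T) (FF : Filter F) n
    (L : T -> n.-tuple R) (v : n.-tuple R) :
  (forall i, tnth (L x) i @[x --> F] --> tnth v i) ->
  row_of_tuple (L x) @[x --> F] --> row_of_tuple v.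
Proof.
move=> Lv A [P vP PA].
have : \forall x \near F, forall i : 'I_n, P ord0 i (tnth (L x) i).
  apply: filter_forall => i.
  by apply: Lv; have := vP ord0 i; rewrite mxE.
apply: filterS => x Px; apply: PA => i j.
by rewrite mxE (ord1 i).
Qed.

Lemma row_of_tupleK n : cancel (@row_of_tuple R n) (@tuple_of_row R n).
Proof. by move=> v; apply: eq_from_tnth => i; rewrite tnth_mktuple mxE. Qed.

Lemma continuous_tuple_cvg (T : Type) (F : set_system T) (FF : Filter F) n
    (g : n.-tuple R -> R) (L : T -> n.-tuple R) (v : n.-tuple R) :
  {for row_of_tuple v, continuous (g \o @tuple_of_row R n)} ->
  (forall i, tnth (L x) i @[x --> F] --> tnth v i) ->
  g (L x) @[x --> F] --> g v.
Proof.
move=> cg /(row_of_tuple_cvg FF) Lv.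
rewrite -[X in _ --> g X]row_of_tupleK.
rewrite (_ : (fun x => g (L x)) = (g \o @tuple_of_row R n) \o (@row_of_tuple R n \o L)).
  exact: cvg_comp Lv cg.
by apply/funext => x /=; rewrite row_of_tupleK.
Qed.

Lemma continuous_tuple_ball n (g : n.-tuple R -> R) (v : n.-tuple R) (e : R) :
  {for row_of_tuple v, continuous (g \o @tuple_of_row R n)} -> 0 < e ->
  exists2 d, 0 < d & forall u : n.-tuple R,
    (forall i, `|tnth u i - tnth v i| < d) -> `|g u - g v| < e.
Proof.
move=> cg e0.
have /cvgrPdist_lt/(_ e e0) := cg.
rewrite /= row_of_tupleK => -[P vP PA].
have : \forall d \near 0^'+, forall i : 'I_n, ball (tnth v i) d `<=` P ord0 i.
  apply: filter_forall => i.
  have /nbhs_ballP[d d0 dP] := vP ord0 i.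
  rewrite mxE in dP.
  near=> d1 => x xd1; apply: dP; apply: le_ball xd1.
  by near: d1; exact: nbhs_right_le.
move=> H.
have [d [dH d0]] : exists d, (forall i : 'I_n, ball (tnth v i) d `<=` P ord0 i) /\ 0 < d.
  apply: (@filter_ex _ (0 : R)^'+); near=> d; split; near: d => //.
  exact: nbhs_right_gt.
exists d => // u ud.
have := PA (row_of_tuple u); rewrite row_of_tupleK distrC; apply => i j.
by rewrite mxE (ord1 i); apply: dH; rewrite /ball/= distrC.
Unshelve. all: by end_near. Qed.

(* Rounding every coordinate to a multiple of 1/(j+1) exhibits a continuous
   function as a pointwise limit of functions of a countable-valued map. *)
Lemma measurable_continuous_tuple n (g : n.-tuple R -> R) :
  continuous (g \o @tuple_of_row R n) -> measurable_fun setT g.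
Proof.
move=> cg.
pose D (j : nat) (v : n.-tuple R) : n.-tuple int := [tuple Num.floor (j.+1%:R * tnth v i) | i < n].
pose e (j : nat) (z : n.-tuple int) : n.-tuple R := [tuple (tnth z i)%:~R / j.+1%:R | i < n].
apply: (@measurable_fun_cvg _ _ _ _ (fun j v => g (e j (D j v)))).
  move=> j _ B mB; rewrite setTI.
  rewrite (_ : _ @^-1` _ = \bigcup_(z in [set z | B (g (e j z))]) (D j @^-1` [set z])); last first.
    apply/seteqP; split => v /=; first by move=> Bv; exists (D j v).
    by case=> z /= Bz Dz; rewrite Dz.
  rewrite bigcup_mkcond.
  apply: countable_bigcupT_measurable => // z; case: ifPn => // _.
  rewrite (_ : _ @^-1` _ = \bigcap_(i in [set: 'I_n])
      ((fun v : n.-tuple R => j.+1%:R * tnth v i) @^-1` `[(tnth z i)%:~R, (tnth z i + 1)%:~R[%classic)).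
    apply: fin_bigcap_measurable; first exact: finite_finset.
    move=> i _; rewrite -[X in measurable X]setTI.
    have mi : measurable_fun setT (fun v : n.-tuple R => j.+1%:R * tnth v i).
      by apply: measurable_funM => //; exact: measurable_tnth.
    by apply: mi => //.
  apply/seteqP; split => v /=.
    by move=> Dz i _ /=; rewrite -Dz in_itv/= tnth_mktuple floor_itv.
  move=> vz; apply: eq_from_tnth => i; rewrite tnth_mktuple.
  by apply: floor_def; have := vz i Logic.I; rewrite /= in_itv/=.
move=> v _; apply: continuous_tuple_cvg => [|i]; first exact: cg.
apply/cvgrPdist_le => /= eps eps0; near=> j.
rewrite !tnth_mktuple.
have j0 : 0 < j.+1%:R :> R by [].
have := floor_itv (j.+1%:R * tnth v i) => /andP[].
set f := (Num.floor _)%:~R; rewrite intrD /= -/f => f1 f2.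
have -> : tnth v i - f / j.+1%:R = (j.+1%:R * tnth v i - f) / j.+1%:R by field; rewrite gt_eqF.
rewrite ger0_norm; last by rewrite divr_ge0 ?subr_ge0// ltW.
rewrite ler_pdivrMr// (@le_trans _ _ 1)//; first by rewrite lerBlDl ltW// addrC.
rewrite -ler_pdivrMl// mulr1 (@le_trans _ _ j%:R) ?ler_nat// ltW//.
near: j; exact: nbhs_infty_gtr.
Unshelve. all: by end_near. Qed.

End lebesgue_tuple_integral.

(** * Uniqueness of laws on tuples from their cosine transforms *)

Section finite_total_mass.
Context d (T : measurableType d) (R : realType) (mu : {measure set T -> \bar R}).
Hypothesis muoo : (mu setT < +oo)%E.

(** An alias of [mu] that carries the finiteness proof, so that the finite measure structure,
    required by Tonelli's theorem, can be inferred. *)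
Definition finite_mass of (mu setT < +oo)%E : set T -> \bar R := mu.
Local Notation m := (finite_mass muoo).

HB.instance Definition _ := Measure.copy m mu.

Let fin_num_finite_mass : fin_num_fun m.
Proof.
move=> A mA; rewrite ge0_fin_numE; last exact: measure_ge0.
by apply: le_lt_trans muoo; apply: le_measure => //; rewrite inE.
Qed.

HB.instance Definition _ := Measure_isFinite.Build _ _ _ m fin_num_finite_mass.

End finite_total_mass.

Section cos_uniqueness.
Context {R : realType}.

Lemma integrable_bounded d (T : measurableType d) (mu : {measure set T -> \bar R})
    (f : T -> R) (M : R) :
  (mu setT < +oo)%E -> measurable_fun setT f -> (forall x, `|f x| <= M) ->
  mu.-integrable setT (fun x => (f x)%:E).
Proof.
move=> muoo mf fM; apply: measurable_bounded_integrable => //.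
exists M; split; first exact: num_real.
by move=> r Mr x _ /=; rewrite (le_trans (fM x))// ltW.
Qed.

Definition dotp n (c : 'I_n -> R) (z : n.-tuple R) : R := \sum_(i < n) c i * tnth z i.

Lemma measurable_dotp n (c : 'I_n -> R) : measurable_fun setT (dotp c).
Proof.
apply: measurable_sum => i; apply: measurable_funM => //.
exact: measurable_tnth.
Qed.

Lemma measurable_cos : measurable_fun setT (@cos R).
Proof. by apply: continuous_measurable_fun; exact: continuous_cos. Qed.

Lemma measurable_cos_dotp n (a : R) (c : 'I_n -> R) :
  measurable_fun setT (fun z => cos (a + dotp c z)).
Proof.
apply: (measurableT_comp measurable_cos).
by apply: measurable_funD => //; exact: measurable_dotp.
Qed.

Section cos_class.
Variables (n : nat) (mu nu : {measure set (n.-tuple R) -> \bar R}).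
Hypotheses (muoo : (mu setT < +oo)%E) (nuoo : (nu setT < +oo)%E).

(** The densities u for which u mu and u nu have the same cosine transforms. The free phase [a]
    makes sines available as well. *)
Definition same_cos_integrals (u : n.-tuple R -> R) : Prop :=
  [/\ measurable_fun setT u, exists M, forall z, `|u z| <= M &
  forall a c, (\int[mu]_z (u z * cos (a + dotp c z))%:E =
               \int[nu]_z (u z * cos (a + dotp c z))%:E)%E].

(** Product to sum: cos(B)^2 cos(A) = cos(A)/2 + cos(2B + A)/4 + cos(2B - A)/4, and 2B + A, 2B - A
    are again phases plus linear forms. *)
Lemma same_cos_integralsM (u : n.-tuple R -> R) (b : R) (e : 'I_n -> R) :
  same_cos_integrals u ->
  same_cos_integrals (fun z => u z * cos (b + dotp e z) ^+ 2).
Proof.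
move=> [mu_ [M uM] uE]; split.
- by apply: measurable_funM => //; apply: measurable_funX; exact: measurable_cos_dotp.
- exists M => z; rewrite normrM -[leRHS]mulr1 ler_pM// normrX.
  by rewrite exprn_ile1// cos_max.
move=> a c.
have H z : u z * cos (b + dotp e z) ^+ 2 * cos (a + dotp c z) =
  2^-1 * (u z * cos (a + dotp c z)) +
  (4^-1 * (u z * cos ((b *+ 2 + a) + dotp (fun i => e i *+ 2 + c i) z)) +
   4^-1 * (u z * cos ((b *+ 2 - a) + dotp (fun i => e i *+ 2 - c i) z))).
  have -> : b *+ 2 + a + dotp (fun i => e i *+ 2 + c i) z =
    (b + dotp e z) *+ 2 + (a + dotp c z).
    rewrite (_ : dotp _ z = dotp e z *+ 2 + dotp c z); first by ring.
    rewrite /dotp -sumrMnl -big_split/=; apply: eq_bigr => i _.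
    by rewrite mulrDl mulrnAl.
  have -> : b *+ 2 - a + dotp (fun i => e i *+ 2 - c i) z =
    (b + dotp e z) *+ 2 - (a + dotp c z).
    rewrite (_ : dotp _ z = dotp e z *+ 2 - dotp c z); first by ring.
    rewrite /dotp -sumrMnl -sumrB/=; apply: eq_bigr => i _.
    by rewrite mulrBl mulrnAl.
  set A := a + dotp c z; set B := b + dotp e z.
  by rewrite (cosD _ A) (cosB _ A) cos_mulr2n; field.
have int (m : {measure set (n.-tuple R) -> \bar R}) a' c' : (m setT < +oo)%E ->
    m.-integrable setT (fun z => (u z * cos (a' + dotp c' z))%:E).
  move=> moo; apply: (@integrable_bounded _ _ _ (fun z => u z * cos (a' + dotp c' z)) M) => //.
    by apply: measurable_funM => //; exact: measurable_cos_dotp.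
  by move=> z; rewrite normrM -[leRHS]mulr1 ler_pM// cos_max.
have L (m : {measure set (n.-tuple R) -> \bar R}) : (m setT < +oo)%E ->
  (\int[m]_z (u z * cos (b + dotp e z) ^+ 2 * cos (a + dotp c z))%:E =
   2^-1%:E * \int[m]_z (u z * cos (a + dotp c z))%:E +
   (4^-1%:E * \int[m]_z (u z * cos ((b *+ 2 + a) + dotp (fun i => e i *+ 2 + c i) z))%:E +
    4^-1%:E * \int[m]_z (u z * cos ((b *+ 2 - a) + dotp (fun i => e i *+ 2 - c i) z))%:E))%E.
  move=> moo; under eq_integral do rewrite H EFinD EFinM (EFinD (4^-1 * _)) !(EFinM 4^-1).
  rewrite integralD//=; [|exact/integrableZl/int|
    by apply: integrableD => //; exact/integrableZl/int].
  rewrite integralD//=; [|exact/integrableZl/int|exact/integrableZl/int].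
  by rewrite !integralZl//; exact/int.
by rewrite !L// !uE.
Qed.

Lemma same_cos_integralsX (u : n.-tuple R -> R) (b : R) (e : 'I_n -> R) N :
  same_cos_integrals u ->
  same_cos_integrals (fun z => u z * (cos (b + dotp e z) ^+ 2) ^+ N).
Proof.
elim: N => [|N IHN] uE.
  by rewrite (_ : (fun _ => _) = u)//; apply/funext => z; rewrite expr0 mulr1.
rewrite (_ : (fun _ => _) = (fun z => u z * (cos (b + dotp e z) ^+ 2) ^+ N * cos (b + dotp e z) ^+ 2)).
  exact/same_cos_integralsM/IHN.
by apply/funext => z; rewrite exprSr mulrA.
Qed.

Lemma same_cos_integrals_prod (I : Type) (s : seq I) (b : I -> R) (e : I -> 'I_n -> R) N :
  same_cos_integrals (cst 1) ->
  same_cos_integrals (fun z => \prod_(i <- s) (cos (b i + dotp (e i) z) ^+ 2) ^+ N).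
Proof.
move=> u1; elim: s => [|i s IHs].
  by rewrite (_ : (fun _ => _) = cst 1)//; apply/funext => z; rewrite big_nil.
rewrite (_ : (fun _ => _) = (fun z => \prod_(i <- s) (cos (b i + dotp (e i) z) ^+ 2) ^+ N *
    (cos (b i + dotp (e i) z) ^+ 2) ^+ N)).
  exact: same_cos_integralsX.
by apply/funext => z; rewrite big_cons mulrC.
Qed.

End cos_class.

(** The derivative of sin at 0 is 1, read along the sequence x / sqrt(j+1). *)
Lemma cvg_sin_scaled (x : R) :
  Num.sqrt j.+1%:R * sin (x / Num.sqrt j.+1%:R) @[j --> \oo] --> x.
Proof.
pose s j : R := Num.sqrt j.+1%:R.
have s_gt0 j : 0 < s j by rewrite sqrtr_gt0.
have [->|x0] := eqVneq x 0.
  by under eq_fun do rewrite mul0r sin0 mulr0; exact: cvg_cst.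
have sV : (s j)^-1 @[j --> \oo] --> (0 : R).
  apply/cvgrPdist_lt => /= e e0; near=> j.
  rewrite sub0r normrN gtr0_norm ?invr_gt0// invf_plt ?posrE//.
  rewrite -(@ltr_pXn2r _ 2)// ?nnegrE ?invr_ge0 ?(ltW e0) ?ltW//.
  rewrite sqr_sqrtr// (@lt_le_trans _ _ j%:R) ?ler_nat//.
  by near: j; exact: nbhs_infty_gtr.
have u0 : (x / s j) @[j --> \oo] --> (0 : R).
  by rewrite -[X in _ --> X](mulr0 x); apply: cvgM => //; exact: cvg_cst.
have u0' : (x / s j) @[j --> \oo] --> (0 : R)^'.
  move=> A A0; have {}A0 := u0 _ A0.
  apply: (@filterS _ \oo _ (fun j => x / s j != 0 -> A (x / s j))) A0 => j; apply.
  by apply: mulf_neq0 => //; rewrite invr_neq0// gt_eqF.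
have H : (fun h : R => h^-1 *: ((@sin R \o shift 0) (h *: 1) - sin 0)) @ 0^' --> (1 : R).
  rewrite -[X in _ --> X]cos0 -[X in _ --> X](derive_val (is_derive := is_derive_sin 0)).
  exact: (@derivable_sin R 0).
have {}H := cvg_comp _ _ u0' H.
rewrite -[X in _ --> X](mulr1 x).
rewrite (_ : (fun _ => _) = (fun j => x * ((x / s j)^-1 *: (sin ((x / s j) *: 1 + 0) - sin 0)))).
  by apply: cvgM => //; exact: cvg_cst.
apply/funext => j; rewrite sin0 subr0 addr0 /GRing.scale/= mulr1 invf_div -/(s j).
by set S := sin _; field.
Unshelve. all: by end_near. Qed.

(** Squeeze between powers of exp(-t/(1-t)) <= 1 - t <= exp(-t); both sides come from 1 + u <= exp
    u. *)
Lemma cvg_pow_exp (t : R ^nat) (c : R) :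
  (forall j, 0 <= t j) -> j.+1%:R * t j @[j --> \oo] --> c ->
  (1 - t j) ^+ j.+1 @[j --> \oo] --> expR (- c).
Proof.
move=> t0 tc.
have t_to0 : t j @[j --> \oo] --> (0 : R).
  rewrite (_ : t = (fun j => (j.+1%:R * t j) * harmonic j)).
    by rewrite -[X in _ --> X](mulr0 c); apply: cvgM tc cvg_harmonic.
  by apply/funext => j; rewrite mulrAC /harmonic divff ?mul1r.
have lt1 : \forall j \near \oo, t j < 1 by exact: (cvgr_lt _ t_to0).
have cE : expR (- (j.+1%:R * t j)) @[j --> \oo] --> expR (- c).
  by apply: continuous_cvg; [exact: continuous_expR|exact: cvgN].
have cE' : expR (- ((j.+1%:R * t j) * (1 - t j)^-1)) @[j --> \oo] --> expR (- c).
  apply: continuous_cvg; [exact: continuous_expR|apply: cvgN].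
  rewrite -[X in _ --> X]mulr1; apply: cvgM => //.
  rewrite -[X in _ --> X]invr1; apply: cvgV => //.
  by rewrite -[X in _ --> X]subr0; apply: cvgB => //; exact: cvg_cst.
apply: squeeze_cvgr cE' cE; near=> j.
have tj1 : t j < 1 by near: j.
have t1_gt0 : 0 < 1 - t j by rewrite subr_gt0.
apply/andP; split; last first.
  rewrite -mulrN expRM_natl; apply: lerXn2r; rewrite ?nnegrE ?expR_ge0 ?(ltW t1_gt0)//.
  exact: expR_ge1Dx.
rewrite -mulrA -mulrN expRM_natl; apply: lerXn2r; rewrite ?nnegrE ?expR_ge0 ?(ltW t1_gt0)//.
rewrite expRN -[leRHS]invrK lef_pV2 ?posrE ?expR_gt0 ?invr_gt0//.
apply: le_trans (expR_ge1Dx _).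
by rewrite le_eqVlt; apply/orP; left; apply/eqP; field; rewrite gt_eqF.
Unshelve. all: by end_near. Qed.

(** Write cos^2 as 1 - sin^2, where (j+1) sin(x / sqrt(j+1))^2 tends to x^2. This is how Gaussian
    kernels are reached from cosines. *)
Lemma cvg_cos_gauss (x : R) :
  (cos (x / Num.sqrt j.+1%:R) ^+ 2) ^+ j.+1 @[j --> \oo] --> gauss_fun x.
Proof.
under eq_fun do rewrite cos2sin2.
apply: cvg_pow_exp => [j|]; first exact: sqr_ge0.
rewrite (_ : (fun _ => _) = (fun j => (Num.sqrt j.+1%:R * sin (x / Num.sqrt j.+1%:R)) ^+ 2)).
  by rewrite expr2; under eq_fun do rewrite expr2; apply: cvgM; exact: cvg_sin_scaled.
by apply/funext => j; rewrite exprMn sqr_sqrtr.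
Qed.

Lemma measurable_gauss_prod n (s : R) (a : n.-tuple R) :
  measurable_fun setT (fun z : n.-tuple R => \prod_(i < n) gauss_fun ((tnth z i - tnth a i) / s)).
Proof.
apply: measurable_prod => i _; apply: (measurableT_comp measurable_gauss_fun).
apply: measurable_funM => //; apply: measurable_funB => //.
exact: measurable_tnth.
Qed.

Lemma gauss_prod_ge0 n (v : 'I_n -> R) : 0 <= \prod_(i < n) gauss_fun (v i).
Proof. by apply: prodr_ge0 => i _; exact: gauss_fun_ge0. Qed.

Lemma dotp_delta n (i : 'I_n) (c : R) (z : n.-tuple R) :
  dotp (fun j => if j == i then c else 0) z = c * tnth z i.
Proof.
rewrite /dotp (bigD1 i)//= eqxx big1 ?addr0// => j ji.
by rewrite (negbTE ji) mul0r.
Qed.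

Section uniqueness.
Variables (n : nat) (mu nu : {measure set (n.-tuple R) -> \bar R}).
Hypotheses (muoo : (mu setT < +oo)%E) (nuoo : (nu setT < +oo)%E).
Hypothesis cosE : forall a c, (\int[mu]_z (cos (a + dotp c z))%:E =
  \int[nu]_z (cos (a + dotp c z))%:E)%E.

Lemma same_cos_integrals1 : same_cos_integrals mu nu (cst 1).
Proof.
split; [exact: measurable_cst|by exists 1 => z; rewrite normr1|].
by move=> a c; under eq_integral do rewrite mul1r; under [RHS]eq_integral do rewrite mul1r.
Qed.

(** The kernel is a pointwise limit of products of powers of squared cosines. They are bounded by 1
    and both measures are finite, so dominated convergence applies. *)
Lemma integral_gauss_prodE (s : R) (a : n.-tuple R) : s != 0 ->
  (\int[mu]_z (\prod_(i < n) gauss_fun ((tnth z i - tnth a i) / s))%:E =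
   \int[nu]_z (\prod_(i < n) gauss_fun ((tnth z i - tnth a i) / s))%:E)%E.
Proof.
move=> s0.
pose b (N : nat) (i : 'I_n) : R := - tnth a i / s / Num.sqrt N.+1%:R.
pose e (N : nat) (i : 'I_n) (j : 'I_n) : R := if j == i then s^-1 / Num.sqrt N.+1%:R else 0.
pose w N (z : n.-tuple R) := \prod_(i < n) (cos (b N i + dotp (e N i) z) ^+ 2) ^+ N.+1.
have wE N : same_cos_integrals mu nu (w N).
  exact/same_cos_integrals_prod/same_cos_integrals1.
have cvgw (m : {measure set (n.-tuple R) -> \bar R}) : (m setT < +oo)%E ->
    (\int[m]_z (w N z)%:E @[N --> \oo] -->
     \int[m]_z (\prod_(i < n) gauss_fun ((tnth z i - tnth a i) / s))%:E)%E.
  move=> moo; apply: (@dominated_cvg _ _ _ m setT measurableT _ _ (cst 1%E)) => //.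
  - move=> N; apply/measurable_EFinP; exact: (let: And3 mw _ _ := wE N in mw).
  - move=> z _; apply: cvg_EFin; first exact: nearW.
    apply: cvg_big => [|i _]; first exact: mul_continuous.
    rewrite (_ : (fun _ => _) = (fun N => (cos ((tnth z i - tnth a i) / s / Num.sqrt N.+1%:R) ^+ 2) ^+ N.+1)).
      exact: cvg_cos_gauss.
    apply/funext => N /=; rewrite /b /e dotp_delta; congr ((cos _ ^+ 2) ^+ _).
    by rewrite mulrBl mulrBl [_ * tnth z i]mulrC mulrA addrC !mulNr.
  - by apply: (@integrable_bounded _ _ m (cst 1) 1) => // z; rewrite normr1.
  - move=> N z _ /=; rewrite lee_fin ger0_norm.
      by apply: prodr_ile1 => i; rewrite exprn_ge0 ?sqr_ge0//= exprn_ile1 ?sqr_ge0//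
        -real_normK ?num_real// exprn_ile1// cos_max.
    by apply: prodr_ge0 => i _; rewrite exprn_ge0 ?sqr_ge0.
have := cvgw _ muoo; rewrite (_ : (fun _ => _) = (fun N => \int[nu]_z (w N z)%:E)%E).
  by move=> H; apply: (cvg_unique _ H) => //; exact: cvgw.
(* Zero phase and zero linear form: the extra cosine is 1 and only the integral of [w N] remains. *)
apply/funext => N; have [_ _ /(_ 0 (fun=> 0))] := wE N.
have c1 z : cos (0 + dotp (fun=> 0) z) = 1 :> R.
  by rewrite add0r /dotp big1 ?cos0// => i _; rewrite mul0r.
by under eq_integral do rewrite c1 mulr1; under [RHS]eq_integral do rewrite c1 mulr1.
Qed.

Lemma integral_gauss_prod : (\int[lebesgue_tuple R n]_u (\prod_(i < n) gauss_fun (tnth u i))%:E =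
  (Num.sqrt pi ^+ n)%:E)%E.
Proof.
rewrite (ge0_integral_prod (h := fun _ : 'I_n => @gauss_fun R)).
- under eq_bigr do rewrite integralT_gauss.
  by rewrite prodEFin prodr_const card_ord.
- by move=> i; exact: measurable_gauss_fun.
- by move=> i x; exact: gauss_fun_ge0.
Qed.

End uniqueness.

Section smoothing.
Variables (n : nat) (g : n.-tuple R -> R) (M : R).
Hypotheses (cg : continuous (g \o @tuple_of_row R n))
  (g0 : forall v, 0 <= g v) (gM : forall v, g v <= M).

Let G (u : n.-tuple R) := \prod_(i < n) gauss_fun (tnth u i).
(** The translate z + s u, written as a diagonal chain map so that the change of variables applies
    as it stands. *)
Let T (s : R) (z u : n.-tuple R) : n.-tuple R := chain_map (nth 0 z) (fun=> s) (fun=> 0) 0 u.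

Let TE s z u i : tnth (T s z u) i = tnth z i + s * tnth u i.
Proof. by rewrite tnth_mktuple /= mul0r addr0 (tnth_nth 0 z). Qed.

Let mg : measurable_fun setT g. Proof. exact: measurable_continuous_tuple. Qed.

Let mG : measurable_fun setT G.
Proof.
apply: measurable_prod => i _.
exact: (measurableT_comp measurable_gauss_fun (measurable_tnth i)).
Qed.

Let G0 u : 0 <= G u. Proof. exact: gauss_prod_ge0. Qed.

Let M0 : 0 <= M.
Proof. exact: (le_trans (g0 [tuple 0 | i < n]) (gM _)). Qed.

Let mT s : measurable_fun setT (fun x : n.-tuple R * n.-tuple R => T s x.1 x.2).
Proof.
apply/measurable_fun_tnthP => i.
rewrite (_ : _ \o _ = fun x : n.-tuple R * n.-tuple R => tnth x.1 i + s * tnth x.2 i).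
  apply: measurable_funD; first exact: (measurableT_comp (measurable_tnth i) measurable_fst).
  apply: measurable_funM => //.
  exact: (measurableT_comp (measurable_tnth i) measurable_snd).
by apply/funext => x; rewrite /= TE.
Qed.

(** Gaussian smoothing of [g] at scale [s]. The kernel exp(-|u|^2) is left unnormalised, whence the
    factors sqrt(pi)^n below. *)
Let H s z := (\int[lebesgue_tuple R n]_u (g (T s z u) * G u)%:E)%E.

Let mgTG s : measurable_fun setT
  (fun x : n.-tuple R * n.-tuple R => (g (T s x.1 x.2) * G x.2)%:E).
Proof.
apply/measurable_EFinP; apply: measurable_funM.
  exact: (measurableT_comp mg (mT s)).
exact: (measurableT_comp mG measurable_snd).
Qed.

Let mH s : measurable_fun setT (H s).
Proof.
apply: (@measurable_fun_fubini_tonelli_F _ _ _ _ _ _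
  (fun x : n.-tuple R * n.-tuple R => (g (T s x.1 x.2) * G x.2)%:E)) => //.
by move=> x; rewrite lee_fin mulr_ge0.
Qed.

Let int_cG c : 0 <= c ->
  (\int[lebesgue_tuple R n]_u (c * G u)%:E = (c * Num.sqrt pi ^+ n)%:E)%E.
Proof.
move=> c0; under eq_integral do rewrite EFinM.
rewrite ge0_integralZl ?integral_gauss_prod//.
- exact/measurable_EFinP.
- by move=> u _; rewrite lee_fin.
Qed.

Let iG : (lebesgue_tuple R n).-integrable setT (fun u => (M * G u)%:E).
Proof.
rewrite (_ : (fun _ => _) = (fun u => M%:E * (G u)%:E)%E)//.
apply: integrableZl => //; apply/integrableP; split; first exact/measurable_EFinP.
under eq_integral do rewrite /= ger0_norm//.
by rewrite integral_gauss_prod ltry.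
Qed.

Let H_le s z : (H s z <= (M * Num.sqrt pi ^+ n)%:E)%E.
Proof.
rewrite -int_cG//.
apply: ge0_le_integral => //.
- by move=> u _; rewrite lee_fin mulr_ge0.
- exact: (measurableT_comp (mgTG s) (measurable_fun_pair (measurable_cst z) (@measurable_id _ _ _))).
- by apply/measurable_EFinP; exact: measurable_funM.
- by move=> u _; rewrite lee_fin ler_wpM2r.
Qed.

Let cvgH z : (H (j.+1%:R^-1) z @[j --> \oo] --> (g z * Num.sqrt pi ^+ n)%:E)%E.
Proof.
rewrite -int_cG//.
apply: (@dominated_cvg _ _ _ (lebesgue_tuple R n) setT measurableT _ _ (fun u => (M * G u)%:E)) => //.
- move=> j; exact: (measurableT_comp (mgTG _) (measurable_fun_pair (measurable_cst z) (@measurable_id _ _ _))).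
- move=> u _; apply: cvg_EFin; first exact: nearW.
  apply: cvgM; last exact: cvg_cst.
  apply: continuous_tuple_cvg => [|i]; first exact: cg.
  rewrite (_ : (fun _ => _) = fun j => tnth z i + j.+1%:R^-1 * tnth u i); last first.
    by apply/funext => j; rewrite TE.
  rewrite -[X in _ --> X]addr0; apply: cvgD; first exact: cvg_cst.
  by rewrite -[X in _ --> X](mul0r (tnth u i)); apply: cvgMl; exact: cvg_harmonic.
- by move=> j u _; rewrite /= lee_fin ger0_norm ?mulr_ge0// ler_wpM2r.
Qed.

Let cvg_int_H (m : {measure set (n.-tuple R) -> \bar R}) : (m setT < +oo)%E ->
  (\int[m]_z H (j.+1%:R^-1) z @[j --> \oo] -->
   \int[m]_z (g z)%:E * (Num.sqrt pi ^+ n)%:E)%E.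
Proof.
move=> moo.
have -> : (\int[m]_z (g z)%:E * (Num.sqrt pi ^+ n)%:E = \int[m]_z (g z * Num.sqrt pi ^+ n)%:E)%E.
  under [RHS]eq_integral do rewrite EFinM.
  rewrite ge0_integralZr//; [exact/measurable_EFinP|].
  - by move=> z _; rewrite lee_fin.
apply: (@dominated_cvg _ _ _ m setT measurableT _ _ (cst (M * Num.sqrt pi ^+ n)%:E)) => //.
- apply: (@integrable_bounded _ _ m (cst (M * Num.sqrt pi ^+ n)) (M * Num.sqrt pi ^+ n)) => // z.
  by rewrite ger0_norm// mulr_ge0// exprn_ge0// sqrtr_ge0.
- move=> j z _; rewrite /= gee0_abs//; apply: integral_ge0 => u _.
  by rewrite lee_fin mulr_ge0.
Qed.

(** Substitute a = z + s u and exchange the integrals: the smoothed [g] depends on [m] only through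
    its integrals of Gaussian kernels centred at a. *)
Let int_H (m : {measure set (n.-tuple R) -> \bar R}) s : (m setT < +oo)%E -> 0 < s ->
  ((s ^+ n)%:E * \int[m]_z H s z =
   \int[lebesgue_tuple R n]_a ((g a)%:E *
     \int[m]_z (\prod_(i < n) gauss_fun ((tnth z i - tnth a i) / s))%:E))%E.
Proof.
move=> moo s0; pose m' : {finite_measure set (n.-tuple R) -> \bar R} := finite_mass moo.
pose K (a z : n.-tuple R) := \prod_(i < n) gauss_fun ((tnth z i - tnth a i) / s).
have mgK : measurable_fun setT (fun x : n.-tuple R * n.-tuple R => (g x.2 * K x.2 x.1)%:E).
  apply/measurable_EFinP; apply: measurable_funM; first exact: measurableT_comp mg measurable_snd.
  apply: measurable_prod => i _; apply: (measurableT_comp measurable_gauss_fun).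
  apply: measurable_funM => //; apply: measurable_funB.
    exact: (measurableT_comp (measurable_tnth i) measurable_fst).
  exact: (measurableT_comp (measurable_tnth i) measurable_snd).
have gK0 x : (0 <= (g x.2 * K x.2 x.1)%:E)%E.
  by rewrite lee_fin mulr_ge0//; exact: gauss_prod_ge0.
transitivity (\int[m']_z \int[lebesgue_tuple R n]_a (g a * K a z)%:E)%E; last first.
  rewrite (@fubini_tonelli _ _ _ _ _ m' (lebesgue_tuple R n) _ mgK gK0); apply: eq_integral => a _.
  transitivity (\int[m']_z ((g a)%:E * (K a z)%:E))%E.
    by apply: eq_integral => z _; rewrite -EFinM.
  rewrite ge0_integralZl ?lee_fin//.
  - by apply/measurable_EFinP; exact: measurable_gauss_prod.
  - by move=> z _; rewrite lee_fin; exact: gauss_prod_ge0.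
rewrite -ge0_integralZl//; last 2 first.
  by move=> z _; apply: integral_ge0 => u _; rewrite lee_fin mulr_ge0.
  by rewrite lee_fin exprn_ge0// ltW.
apply: eq_integral => z _.
have ps : \prod_(i < n) `|s| = s ^+ n by rewrite prodr_const card_ord gtr0_norm.
have sn (i : nat) : s != 0 by rewrite gt_eqF.
have mKz : measurable_fun setT (fun a => (g a * K a z)%:E).
  exact: (measurableT_comp mgK (measurable_fun_pair (measurable_cst z) (@measurable_id _ _ _))).
have Kz0 a : (0 <= (g a * K a z)%:E)%E by exact: (gK0 (z, a)).
have -> := @ge0_integral_chain_map R n (nth 0 z) (fun=> s) (fun=> 0) 0 _ sn mKz Kz0.
rewrite ps; congr (_ * _)%E; apply: eq_integral => u _; congr (_ * _)%:E.
apply: eq_bigr => i _; rewrite TE opprD addNKr.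
by rewrite /gauss_fun mulNr mulrAC divff ?gt_eqF// mul1r sqrrN.
Qed.

(** At each scale s > 0 the two measures give the same integral to the smoothed function, since
    Gaussian kernels do not distinguish them. Then s = 1/(j+1) tends to 0 by dominated
    convergence. *)
Lemma ge0_integral_eq_of_cos (mu nu : {measure set (n.-tuple R) -> \bar R}) :
  (mu setT < +oo)%E -> (nu setT < +oo)%E ->
  (forall a c, (\int[mu]_z (cos (a + dotp c z))%:E =
     \int[nu]_z (cos (a + dotp c z))%:E)%E) ->
  (\int[mu]_z (g z)%:E = \int[nu]_z (g z)%:E)%E.
Proof.
move=> muoo nuoo cosE.
have HE s : 0 < s -> (\int[mu]_z H s z = \int[nu]_z H s z)%E.
  move=> s0; have sn0 : s ^+ n != 0 by rewrite expf_neq0// gt_eqF.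
  have := int_H muoo s0.
  under [X in _ = X -> _]eq_integral do rewrite (integral_gauss_prodE muoo nuoo cosE) ?gt_eqF//.
  rewrite -(int_H nuoo s0) => E.
  by rewrite -[LHS]mul1e -[RHS]mul1e -(mulVf sn0) EFinM -!muleA E.
have := cvg_int_H muoo; under eq_fun do rewrite HE ?invr_gt0//.
move=> /cvg_unique/(_ (cvg_int_H nuoo)) E.
have pin0 : Num.sqrt (pi : R) ^+ n != 0 by rewrite expf_neq0// gt_eqF// sqrtr_gt0 pi_gt0.
by rewrite -[LHS]mule1 -[RHS]mule1 -(divff pin0) EFinM !muleA E.
Qed.

End smoothing.

(** Reduction to g + M >= 0; the added constants agree because the cosine of 0 compares the total
    masses. *)
Theorem integral_eq_of_cos n (g : n.-tuple R -> R) (M : R)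
    (mu nu : {measure set (n.-tuple R) -> \bar R}) :
  continuous (g \o @tuple_of_row R n) -> (forall v, `|g v| <= M) ->
  (mu setT < +oo)%E -> (nu setT < +oo)%E ->
  (forall a c, (\int[mu]_z (cos (a + dotp c z))%:E =
     \int[nu]_z (cos (a + dotp c z))%:E)%E) ->
  (\int[mu]_z (g z)%:E = \int[nu]_z (g z)%:E)%E.
Proof.
move=> cg gM muoo nuoo cosE.
have mg : measurable_fun setT g by exact: measurable_continuous_tuple.
have shift (m : {measure set (n.-tuple R) -> \bar R}) : (m setT < +oo)%E ->
    (\int[m]_z (g z)%:E = \int[m]_z (g z + M)%:E - \int[m]_z M%:E)%E.
  move=> moo; rewrite -integralB//=.
  - by apply: eq_integral => z _; rewrite -EFinB addrK.
  - apply: (@integrable_bounded _ _ m (fun z => g z + M) (M + `|M|)) => //.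
      exact: measurable_funD.
    by move=> z; rewrite (le_trans (ler_normD _ _))// lerD.
  - exact: (@integrable_bounded _ _ m (cst M) `|M|).
rewrite !shift//; congr (_ - _)%E; last first.
  have /(_ 0 (fun=> 0)) := cosE.
  have c1 z : cos (0 + dotp (n := n) (fun=> 0) z) = 1 :> R.
    by rewrite add0r /dotp big1 ?cos0// => i _; rewrite mul0r.
  under eq_integral do rewrite c1; under [RHS]eq_integral do rewrite c1.
  by rewrite !integral_cst// !mul1e => ->.
apply: (@ge0_integral_eq_of_cos _ _ (M *+ 2)) => //.
- by move=> v; apply: continuousD; [exact: cg|exact: cst_continuous].
- by move=> v; have := gM v; rewrite ler_norml => /andP[+ _]; lra.
- by move=> v; have := gM v; rewrite ler_norml => /andP[_ +]; lra.
Qed.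

End cos_uniqueness.

(** * Measures defined by a density, and integration against them *)

Section density_measure.
Context d (T : measurableType d) (R : realType).
Variables (mu : {measure set T -> \bar R}) (f : T -> R).
Hypotheses (mf : measurable_fun setT f) (f0 : forall x, 0 <= f x).

Definition density_measure of measurable_fun setT f & (forall x, 0 <= f x) :
  set T -> \bar R := fun A => (\int[mu]_(x in A) (f x)%:E)%E.
Local Notation m := (density_measure mf f0).

Let m0 : m set0 = 0%E. Proof. exact: integral_set0. Qed.

Let m_ge0 A : (0 <= m A)%E.
Proof. by apply: integral_ge0 => x _; rewrite lee_fin. Qed.

Let m_sigma_additive : semi_sigma_additive m.
Proof.
move=> F mF tF mUF; rewrite /density_measure.
apply: semi_sigma_additive_nng_induced => //.
exact/measurable_EFinP.
Qed.

HB.instance Definition _ := isMeasure.Build _ _ _ m m0 m_ge0 m_sigma_additive.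

Import HBNNSimple.

Let integral_density_nnsfun (h : {nnsfun T >-> R}) :
  (\int[m]_x (h x)%:E = \int[mu]_x ((h x)%:E * (f x)%:E))%E.
Proof.
have mfE : measurable_fun setT (EFin \o f) by exact/measurable_EFinP.
have hrE r x : (0 <= (r * \1_(h @^-1` [set r]) x)%:E)%E.
  by rewrite EFinM nnfun_muleindic_ge0.
have mhr r : measurable_fun setT (fun x => (r * \1_(h @^-1` [set r]) x)%:E).
  by apply/measurable_EFinP/measurable_funM => //; exact: measurable_indic.
under [LHS]eq_integral do rewrite fimfunE -fsumEFin//.
rewrite [LHS]ge0_integral_fsum//.
under [RHS]eq_integral.
  move=> x _; rewrite fimfunE -fsumEFin// muleC ge0_mule_fsumr//.
  over.
rewrite [RHS]ge0_integral_fsum//; last 2 first.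
- by move=> r; exact: emeasurable_funM.
- by move=> r x _; rewrite mule_ge0// lee_fin.
apply: eq_fsbigr => r rh.
rewrite integralZl_indic_nnsfun//= integral_indic// setIT.
transitivity (\int[mu]_x (r%:E * ((f x)%:E * (\1_(h @^-1` [set r]) x)%:E)))%E; last first.
  by apply: eq_integral => x _; rewrite [in RHS]EFinM muleCA.
have r0 : 0 <= r by move: rh; rewrite inE => -[x _ <-].
have mfi : measurable_fun setT (fun x => (f x)%:E * (\1_(h @^-1` [set r]) x)%:E)%E.
  by apply: emeasurable_funM => //; exact/measurable_EFinP/measurable_indic.
have fi0 x : setT x -> (0 <= (f x)%:E * (\1_(h @^-1` [set r]) x)%:E)%E.
  by move=> _; rewrite mule_ge0 ?lee_fin.
rewrite ge0_integralZl ?lee_fin//; congr (_ * _)%E; rewrite [LHS]integral_mkcond.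
by apply: eq_integral => x _; rewrite epatch_indic.
Qed.

Lemma ge0_integral_density_measure (u : T -> \bar R) :
  measurable_fun setT u -> (forall x, 0 <= u x)%E ->
  (\int[m]_x u x = \int[mu]_x (u x * (f x)%:E))%E.
Proof.
move=> mu_ u0; have mfE : measurable_fun setT (EFin \o f) by exact/measurable_EFinP.
pose u_ := nnsfun_approx measurableT mu_.
transitivity (lim (\int[m]_x (u_ n x)%:E @[n --> \oo]))%E.
  rewrite -monotone_convergence//=.
  - by apply: eq_integral => ? /[!inE] xD; apply/esym/cvg_lim => //=; exact: cvg_nnsfun_approx.
  - by move=> n; exact/measurable_EFinP/measurable_funTS.
  - by move=> n ? _; rewrite lee_fin.
  - by move=> ? _ ? ? mn; rewrite lee_fin; exact/lefP/nd_nnsfun_approx.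
transitivity (lim (\int[mu]_x ((u_ n x)%:E * (f x)%:E) @[n --> \oo]))%E.
  by apply: congr_lim; apply/funext => n /=; exact: integral_density_nnsfun.
rewrite -monotone_convergence//=.
- apply: eq_integral => x _; apply/cvg_lim => //.
  by apply: cvgeZr => //; exact: cvg_nnsfun_approx.
- by move=> n; apply: emeasurable_funM => //; exact/measurable_EFinP.
- by move=> n x _; rewrite mule_ge0 ?lee_fin.
- move=> x _ a b ab; rewrite lee_wpmul2r ?lee_fin//; exact/lefP/nd_nnsfun_approx.
Qed.

End density_measure.

(** * Gaussian laws and the Brownian bridge at finitely many points *)

Section standard_normal.
Context {R : realType}.
Local Notation leb := (@lebesgue_measure R).
Local Notation p := (@normal_pdf R 0 1).

Lemma normal_peakE (s : R) : normal_peak s = `|s|^-1 * normal_peak 1.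
Proof.
rewrite /normal_peak expr1n mul1r -mulrnAr sqrtrM ?sqr_ge0// sqrtr_sqr.
by rewrite invfM.
Qed.

Lemma std_pdfE (x : R) : p x = normal_peak 1 * expR (- (x ^+ 2 / 2)).
Proof. by rewrite normal_pdfE ?oner_neq0// /normal_fun subr0 expr1n mulNr. Qed.

Lemma normal_pdf_affine (m s x : R) : s != 0 ->
  `|s| * normal_pdf m s (m + s * x) = p x.
Proof.
move=> s0; rewrite std_pdfE normal_pdfE// normal_peakE !mulrA divff ?normr_eq0// mul1r.
congr (_ * expR _); rewrite addrC addKr exprMn mulNr; congr (- _); field.
by rewrite s0.
Qed.

Lemma integral_normal_pdfE (u : R -> \bar R) (m s : R) : s != 0 ->
  measurable_fun setT u -> (forall x, 0 <= u x)%E ->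
  (\int[leb]_x (u x * (normal_pdf m s x)%:E) = \int[leb]_x (u (m + s * x)%R * (p x)%:E))%E.
Proof.
move=> s0 mu_ u0.
have mN : measurable_fun setT (fun x => (normal_pdf m s x)%:E).
  by apply/measurable_EFinP; exact: measurable_normal_pdf.
have N0 x : (0 <= (normal_pdf m s x)%:E)%E by rewrite lee_fin normal_pdf_ge0.
rewrite (@ge0_integral_affine _ _ m s)//; last 2 first.
- exact: emeasurable_funM.
- by move=> x; rewrite mule_ge0.
have ma : measurable_fun setT (fun x : R => m + s * x).
  by apply: measurable_funD => //; exact: measurable_funM.
rewrite -ge0_integralZl ?lee_fin//; last 2 first.
- apply: emeasurable_funM; first exact: measurableT_comp mu_ ma.
  exact: (measurableT_comp mN ma).
- by move=> x _; rewrite mule_ge0.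
by apply: eq_integral => x _; rewrite muleCA -EFinM normal_pdf_affine.
Qed.

Lemma integral_std_pdf : (\int[leb]_x (p x)%:E = 1)%E.
Proof. exact: integral_normal_pdf. Qed.

Lemma measurable_std_pdf : measurable_fun setT (fun x => (p x)%:E).
Proof. by apply/measurable_EFinP; exact: measurable_normal_pdf. Qed.

Lemma std_pdf_ge0 x : (0 <= (p x)%:E)%E. Proof. by rewrite lee_fin normal_pdf_ge0. Qed.

Lemma integral_std_pdf_sym (u : R -> \bar R) (x0 s : R) :
  measurable_fun setT u -> (forall x, 0 <= u x)%E ->
  (\int[leb]_x (u (x0 + `|s| * x)%R * (p x)%:E) = \int[leb]_x (u (x0 + s * x)%R * (p x)%:E))%E.
Proof.
move=> mu_ u0; have [s0|s0] := leP 0 s; first by rewrite ger0_norm.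
rewrite ltr0_norm//.
have -> : (\int[leb]_x (u (x0 + s * x)%R * (p x)%:E) = \int[leb]_x (u (x0 + s * (0 + -1 * x))%R * (p (0 + -1 * x))%:E))%E.
  have n10 : -1 != 0 :> R by rewrite oppr_eq0 oner_eq0.
  have mF : measurable_fun setT (fun x => u (x0 + s * x)%R * (p x)%:E)%E.
    apply: emeasurable_funM measurable_std_pdf.
    by apply: (measurableT_comp mu_); apply: measurable_funD => //; exact: measurable_funM.
  have F0 x : (0 <= u (x0 + s * x)%R * (p x)%:E)%E by rewrite mule_ge0 ?std_pdf_ge0.
  by rewrite [LHS](ge0_integral_affine 0 n10 mF F0) normrN1 mul1e.
apply: eq_integral => x _; rewrite add0r mulN1r mulrN mulNr !std_pdfE sqrrN//.
Qed.

Let conv0 (u : R -> \bar R) (x0 b : R) : measurable_fun setT u -> (forall x, 0 <= u x)%E ->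
  (\int[leb]_x ((\int[leb]_y (u (x0 + b * y)%R * (p y)%:E)) * (p x)%:E) =
  \int[leb]_z (u (x0 + `|b| * z)%R * (p z)%:E))%E.
Proof.
move=> mu_ u0; rewrite integral_std_pdf_sym// ge0_integralZl ?integral_std_pdf ?mule1//.
- exact: measurable_std_pdf.
- by move=> x _; exact: std_pdf_ge0.
- by apply: integral_ge0 => x _; rewrite mule_ge0 ?std_pdf_ge0.
Qed.

(** Bayes' formula for a normal prior: if x is standard and w given x is N(a x, b^2), then w is N(0,
    c^2) and x given w is N(a w / c^2, (b/c)^2). The proof completes the square. *)
Lemma normal_pdf_bayes (a b w x : R) : a != 0 -> b != 0 ->
  let c := Num.sqrt (a ^+ 2 + b ^+ 2) in
  p x * normal_pdf (a * x) b w = normal_pdf 0 c w * normal_pdf (a * w / c ^+ 2) (b / c) x.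
Proof.
move=> a0 b0 c.
have c2_gt0 : 0 < a ^+ 2 + b ^+ 2 by rewrite ltr_pwDl ?sqr_ge0// exprn_even_gt0.
have c_gt0 : 0 < c by rewrite sqrtr_gt0.
have c0 : c != 0 by rewrite gt_eqF.
have bc0 : b / c != 0 by rewrite mulf_neq0// invr_neq0.
rewrite std_pdfE !normal_pdfE// !(normal_peakE b, normal_peakE c, normal_peakE (b / c)).
rewrite /normal_fun normrM normfV (gtr0_norm c_gt0) invfM invrK.
set K := normal_peak 1; set B := `|b|^-1.
rewrite [LHS](_ : _ = (K * K * B) * (expR (- (x ^+ 2 / 2)) * expR (- (w - a * x) ^+ 2 / (b ^+ 2 *+ 2)))); last by ring.
rewrite [RHS](_ : _ = (K * K * B * (c^-1 * c)) * (expR (- (w - 0) ^+ 2 / (c ^+ 2 *+ 2)) *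
   expR (- (x - a * w / c ^+ 2) ^+ 2 / ((b / c) ^+ 2 *+ 2)))); last by ring.
rewrite mulVf// mulr1 -!expRD; congr (_ * expR _).
rewrite exprMn exprVn sqr_sqrtr ?(ltW c2_gt0)//.
field.
by rewrite b0 gt_eqF.
Qed.

(** After the Bayes factorisation and an exchange of integrals, the conditional density of x given w
    integrates to 1. The cases a = 0 and b = 0 are separate because [normal_pdf] with zero deviation
    does not describe a Dirac mass. *)
Lemma std_normal_convolution (u : R -> \bar R) (x0 a b : R) :
  measurable_fun setT u -> (forall x, 0 <= u x)%E ->
  (\int[leb]_x ((\int[leb]_y (u (x0 + a * x + b * y)%R * (p y)%:E)) * (p x)%:E) =
  \int[leb]_z (u (x0 + Num.sqrt (a ^+ 2 + b ^+ 2) * z)%R * (p z)%:E))%E.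
Proof.
move=> mu_ u0.
have [->|a0] := eqVneq a 0.
  under eq_integral do under eq_integral do rewrite mul0r addr0.
  by rewrite conv0// expr0n add0r sqrtr_sqr.
have [->|b0] := eqVneq b 0.
  rewrite expr0n addr0 sqrtr_sqr integral_std_pdf_sym//.
  apply: eq_integral => x _; congr (_ * _)%E.
  under eq_integral do rewrite mul0r addr0.
  rewrite ge0_integralZl ?integral_std_pdf ?mule1//.
  - exact: measurable_std_pdf.
  - by move=> y _; exact: std_pdf_ge0.
set c := Num.sqrt _.
have c0 : c != 0 by rewrite gt_eqF// sqrtr_gt0 ltr_pwDl ?sqr_ge0// exprn_even_gt0.
have bc0 : b / c != 0 by rewrite mulf_neq0// invr_neq0.
have mux : measurable_fun setT (fun w => u (x0 + w)).
  by apply: (measurableT_comp mu_); exact: measurable_funD.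
have ux0 w : (0 <= u (x0 + w)%R)%E by exact: u0.
have := @integral_normal_pdfE (fun w => u (x0 + w)) 0 c c0 mux ux0.
under [X in _ = X -> _]eq_integral do rewrite add0r.
move=> <-.
transitivity (\int[leb]_x \int[leb]_w ((u (x0 + w)%R * (normal_pdf (a * x) b w)%:E) * (p x)%:E))%E.
  apply: eq_integral => x _.
  have := @integral_normal_pdfE (fun w => u (x0 + w)) (a * x) b b0 mux ux0.
  under [X in _ = X -> _]eq_integral do rewrite addrA.
  move=> <-; rewrite ge0_integralZr//.
  - by apply: emeasurable_funM mux _; apply/measurable_EFinP; exact: measurable_normal_pdf.
  - by move=> w _; rewrite mule_ge0// lee_fin normal_pdf_ge0.
  - exact: std_pdf_ge0.
pose f := fun z : measurableTypeR R * measurableTypeR R => (u (x0 + z.2)%R * (normal_pdf 0 c z.2 * normal_pdf (a * z.2 / c ^+ 2) (b / c) z.1)%:E)%E.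
transitivity (\int[leb]_x \int[leb]_w f (x, w))%E.
  apply: eq_integral => x _; apply: eq_integral => w _.
  by rewrite -muleA -EFinM mulrC normal_pdf_bayes.
rewrite (@fubini_tonelli _ _ _ _ _ leb leb f).
- apply: eq_integral => w _; rewrite /f/=.
  under eq_integral do rewrite EFinM muleA.
  rewrite ge0_integralZl ?integral_normal_pdf ?mule1//.
  - by apply/measurable_EFinP; exact: measurable_normal_pdf.
  - by move=> x _; rewrite lee_fin normal_pdf_ge0.
  - by rewrite mule_ge0// lee_fin normal_pdf_ge0.
- apply: emeasurable_funM.
    exact: (measurableT_comp mux (@measurable_snd _ _ (measurableTypeR R) (measurableTypeR R))).
  have ms2 := (@measurable_snd _ _ (measurableTypeR R) (measurableTypeR R)).
  apply/measurable_EFinP; apply: measurable_funM.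
    exact: (measurableT_comp (measurable_normal_pdf 0 c) ms2).
  rewrite (_ : (fun _ => _) = (fun z : measurableTypeR R * measurableTypeR R =>
     normal_pdf 0 (b / c) (z.1 - a * z.2 / c ^+ 2))).
    apply: (measurableT_comp (measurable_normal_pdf 0 (b / c))).
    apply: measurable_funB; first exact: (@measurable_fst _ _ (measurableTypeR R) (measurableTypeR R)).
    by apply: measurable_funM => //; apply: measurable_funM.
  by apply/funext => z; rewrite !normal_pdfE// /normal_fun subr0.
- by move=> z; rewrite mule_ge0// lee_fin mulr_ge0// normal_pdf_ge0.
Qed.

End standard_normal.

Section gaussian_vectors.
Context {R : realType}.
Local Notation leb := (@lebesgue_measure R).
Local Notation p := (@normal_pdf R 0 1).

Lemma measurable_EFin_comp (f : R -> R) : measurable_fun setT f ->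
  @measurable_fun _ _ (measurableTypeR R) _ setT (fun x => (f x)%:E).
Proof. exact: (measurableT_comp (@EFin_measurable R setT)). Qed.

Lemma std_pdf_prod_ge0 n (v : n.-tuple R) : 0 <= \prod_(i < n) p (tnth v i).
Proof. by apply: prodr_ge0 => i _; exact: normal_pdf_ge0. Qed.

Lemma measurable_std_pdf_prod n : measurable_fun setT (fun v : n.-tuple R => \prod_(i < n) p (tnth v i)).
Proof.
apply: measurable_prod => i _.
exact: (measurableT_comp (measurable_normal_pdf 0 1) (measurable_tnth i)).
Qed.

(** A linear form of a standard normal vector is normal with variance the sum of the squared
    coefficients: the coordinates are absorbed one at a time by [std_normal_convolution]. *)
Lemma integral_dotp_std n (u : R -> \bar R) (x0 : R) (c : 'I_n -> R) :
  measurable_fun setT u -> (forall x, 0 <= u x)%E ->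
  (\int[lebesgue_tuple R n]_v (u (x0 + dotp c v)%R * (\prod_(i < n) p (tnth v i))%:E) =
   \int[leb]_z (u (x0 + Num.sqrt (\sum_(i < n) c i ^+ 2) * z)%R * (p z)%:E))%E.
Proof.
move=> mu_ u0; elim: n x0 c => [|n IHn] x0 c.
  rewrite ge0_integral_lebesgue_tuple0; last first.
    apply: emeasurable_funM; last by apply/measurable_EFinP; exact: measurable_std_pdf_prod.
    by apply: (measurableT_comp mu_); apply: measurable_funD => //; exact: measurable_dotp.
  rewrite /dotp !big_ord0 sqrtr0 mule1 addr0.
  under eq_integral do rewrite mul0r addr0.
  rewrite ge0_integralZl ?integral_std_pdf ?mule1//.
  - exact: measurable_std_pdf.
  - by move=> x _; exact: std_pdf_ge0.
have mF m y0 (e : 'I_m -> R) : measurable_fun setT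
    (fun v : m.-tuple R => u (y0 + dotp e v)%R * (\prod_(i < m) p (tnth v i))%:E)%E.
  apply: emeasurable_funM; last by apply/measurable_EFinP; exact: measurable_std_pdf_prod.
  by apply: (measurableT_comp mu_); apply: measurable_funD => //; exact: measurable_dotp.
have F0 m y0 (e : 'I_m -> R) (v : m.-tuple R) :
    (0 <= u (y0 + dotp e v)%R * (\prod_(i < m) p (tnth v i))%:E)%E.
  by rewrite mule_ge0// lee_fin std_pdf_prod_ge0.
rewrite (ge0_integral_lebesgue_tupleS (mF _ _ _) (F0 _ _ _)).
rewrite big_ord_recl.
have -> : Num.sqrt (c ord0 ^+ 2 + \sum_(i < n) c (lift ord0 i) ^+ 2) =
   Num.sqrt (c ord0 ^+ 2 + (Num.sqrt (\sum_(i < n) c (lift ord0 i) ^+ 2)) ^+ 2).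
  by rewrite sqr_sqrtr// sumr_ge0// => i _; exact: sqr_ge0.
rewrite -std_normal_convolution//; apply: eq_integral => x _.
rewrite -IHn.
have F0' v : setT v -> (0 <= u (x0 + c ord0 * x + dotp (fun i => c (lift ord0 i)) v)%R *
  (\prod_(i < n) p (tnth v i))%:E)%E by move=> _; exact: F0.
rewrite -(ge0_integralZr (lebesgue_tuple R n) measurableT (mF n _ _) F0' (std_pdf_ge0 x)).
apply: eq_integral => v _.
rewrite -muleA -EFinM /dotp !big_ord_recl tnth0 addrA [p x * _]mulrC; congr (u (_ + _)%R * (_ * _)%:E)%E.
  by apply: eq_bigr => i _; rewrite tnthS.
by apply: eq_bigr => i _; rewrite tnthS.
Qed.

Let cvg_invS : 1 + j.+1%:R^-1 @[j --> \oo] --> (1 : R).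
Proof.
rewrite -[X in _ --> X]addr0; apply: cvgD; [exact: cvg_cst|exact: cvg_harmonic].
Qed.

Lemma integral_std_pdf_scale (s : R) : 0 < s ->
  (\int[leb]_x (p (s * x))%:E = s^-1%:E)%E.
Proof.
move=> s0; have := @ge0_integral_affine _ (EFin \o p) 0 s.
rewrite gt_eqF// => /(_ isT measurable_std_pdf (@std_pdf_ge0 R)).
rewrite /= integral_std_pdf gtr0_norm//.
under eq_integral do rewrite add0r.
set I := (\int[_]_x _)%E => E.
have -> : I = (s^-1%:E * (s%:E * I))%E by rewrite muleA -EFinM mulVf ?gt_eqF// mul1e.
by rewrite -E mule1.
Qed.

(* The second moment is the limit of (p x - p (s x)) * 2 / (s^2 - 1) as s
   decreases to 1, where both integrals are known. *)
Lemma integral_std_pdf_sqr : (\int[leb]_x (x ^+ 2 * p x)%:E = 1)%E.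
Proof.
pose s j : R := 1 + j.+1%:R^-1.
have s1 j : 1 < s j by rewrite ltrDl invr_gt0.
have s0 j : 0 < s j by rewrite (lt_trans _ (s1 j)).
have s21 j : 0 < s j ^+ 2 - 1 by rewrite subr_gt0 expr_gt1// ltW.
have cs : s j @[j --> \oo] --> (1 : R) by exact: cvg_invS.
pose a j x := (s j ^+ 2 - 1) / 2 * x ^+ 2.
have a0 j x : 0 <= a j x by rewrite mulr_ge0 ?sqr_ge0// divr_ge0// ltW.
have psE j x : p (s j * x) = p x * expR (- a j x).
  rewrite !std_pdfE -[RHS]mulrA -expRD; congr (_ * expR _).
  by rewrite /a exprMn; field.
pose D j x := (p x - p (s j * x)) * (2 / (s j ^+ 2 - 1)).
have DE j x : D j x = p x * ((1 - expR (- a j x)) * 2 / (s j ^+ 2 - 1)).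
  by rewrite /D psE; field; rewrite gt_eqF.
have D_ge0 j x : 0 <= D j x.
  rewrite mulr_ge0 ?divr_ge0 ?(ltW (s21 j))// psE subr_ge0 ler_piMr ?normal_pdf_ge0//.
  by rewrite expR_le1 oppr_le0.
have D_le j x : D j x <= x ^+ 2 * p x.
  rewrite DE [leRHS]mulrC ler_wpM2l ?normal_pdf_ge0// ler_pdivrMr//.
  by have := expR_ge1Dx (- a j x); rewrite /a => H; lra.
have D_ge j x : x ^+ 2 * p x * expR (- a j x) <= D j x.
  rewrite DE [x ^+ 2 * _]mulrC -[leLHS]mulrA ler_wpM2l ?normal_pdf_ge0// ler_pdivlMr//.
  have : expR (- a j x) * (1 + a j x) <= 1.
    by rewrite expRN ler_pdivrMl ?expR_gt0// mulr1 expR_ge1Dx.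
  by rewrite {2}/a; set E := expR _ => H; lra.
have cD x : D j x @[j --> \oo] --> x ^+ 2 * p x.
  have c1 : x ^+ 2 * p x * expR (- a j x) @[j --> \oo] --> x ^+ 2 * p x.
    rewrite -[X in _ --> X]mulr1 -expR0; apply: cvgM; first exact: cvg_cst.
    apply: continuous_cvg; first exact: continuous_expR.
    rewrite -[X in _ --> X]oppr0; apply: cvgN.
    rewrite -[X in _ --> X](mul0r (x ^+ 2)); apply: cvgM; last exact: cvg_cst.
    rewrite -[X in _ --> X](mul0r 2^-1); apply: cvgM; last exact: cvg_cst.
    rewrite -[X in _ --> X](subrr (1 * 1)); apply: cvgB; last by rewrite mulr1; exact: cvg_cst.
    by under eq_fun do rewrite expr2; exact: cvgM.
  have c2 : x ^+ 2 * p x @[j --> \oo] --> x ^+ 2 * p x by exact: cvg_cst.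
  by apply: squeeze_cvgr c1 c2; apply: nearW => j; rewrite D_ge D_le.
have mp c : measurable_fun setT (fun x : R => p (c * x)).
  by apply: (measurableT_comp (measurable_normal_pdf 0 1)); exact: measurable_funM.
have m2 : measurable_fun setT (fun x : R => x ^+ 2 * p x).
  by apply: measurable_funM; [exact: measurable_funX|exact: measurable_normal_pdf].
have mD j : measurable_fun setT (D j).
  apply: measurable_funM => //; apply: measurable_funB => //; exact: measurable_normal_pdf.
have ip c : 0 < c -> leb.-integrable setT (fun x => (p (c * x))%:E).
  move=> c0; apply/integrableP; split; first exact: measurable_EFin_comp.
  under eq_integral do rewrite /= ger0_norm ?normal_pdf_ge0//.
  by rewrite integral_std_pdf_scale// ltry.
have i2 : leb.-integrable setT (fun x => (x ^+ 2 * p x)%:E).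
  (* Dominating function: x^2 <= 4 exp(x^2/4), and [p (Num.sqrt 2^-1 * x)] has exp(-x^2/4) in the
     place of exp(-x^2/2). *)
  apply: (@le_integrable _ _ _ leb setT measurableT _ (fun x => (4 * p (Num.sqrt 2^-1 * x))%:E)) => //.
  - exact: measurable_EFin_comp.
  - move=> x _; rewrite /= lee_fin ger0_norm; last by rewrite mulr_ge0 ?sqr_ge0 ?normal_pdf_ge0.
    rewrite ger0_norm; last by rewrite mulr_ge0 ?normal_pdf_ge0.
    rewrite !std_pdfE exprMn sqr_sqrtr//.
    have := expR_ge1Dx (x ^+ 2 / 4); have e0 := expR_gt0 (- (x ^+ 2 / 2)).
    have -> : expR (- (2^-1 * x ^+ 2 / 2)) = expR (x ^+ 2 / 4) * expR (- (x ^+ 2 / 2)) :> R.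
      by rewrite -expRD; congr expR; field.
    move=> H; rewrite mulrCA [leRHS]mulrCA ler_wpM2l ?normal_peak_ge0// mulrA.
    by rewrite ler_wpM2r ?expR_ge0//; nra.
  - rewrite (_ : (fun _ => _) = (fun x => 4%:E * (p (Num.sqrt 2^-1 * x))%:E)%E)//.
    by apply: integrableZl => //; apply: ip; rewrite sqrtr_gt0.
have L1 : (\int[leb]_x (D j x)%:E @[j --> \oo] --> \int[leb]_x (x ^+ 2 * p x)%:E)%E.
  apply: (@dominated_cvg _ _ _ leb setT measurableT _ _ (fun x => (x ^+ 2 * p x)%:E)) => //.
  - by move=> j; exact: measurable_EFin_comp.
  - by move=> x _; apply: cvg_EFin; [exact: nearW|exact: cD].
  - by move=> j x _; rewrite /= lee_fin ger0_norm.
have intD j : (\int[leb]_x (D j x)%:E = (2 / (s j * (s j + 1)))%:E)%E.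
  rewrite (_ : (fun x => _) = (fun x => ((p x)%:E - (p (s j * x))%:E) * (2 / (s j ^+ 2 - 1))%:E)%E)//.
  have ip1 : leb.-integrable setT (fun x => (p x)%:E).
    by have := ip 1 ltr01; under eq_fun do rewrite mul1r.
  rewrite integralZr//=; last exact: (integrableB measurableT ip1 (ip _ (s0 j))).
  have := @integralB _ _ _ leb setT measurableT _ _ ip1 (ip _ (s0 j)) => /= ->.
  rewrite (integral_std_pdf_scale (s0 j)).
  rewrite integral_std_pdf.
  rewrite -EFinB -EFinM; congr EFin.
  have := s0 j; have := s1 j => s1j s0j; field.
  by rewrite !gt_eqF// ?subr_gt0// addr_gt0.
have L2 : (\int[leb]_x (D j x)%:E @[j --> \oo] --> 1%:E)%E.
  under eq_fun do rewrite intD.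
  apply: cvg_EFin; first exact: nearW.
  have H : s j * (s j + 1) @[j --> \oo] --> (1 * (1 + 1) : R).
    by apply: cvgM => //; apply: cvgD => //; exact: cvg_cst.
  have n2 : 1 * (1 + 1) != 0 :> R by rewrite mul1r.
  rewrite [X in _ --> X](_ : 1 = 2 * (1 * (1 + 1))^-1); last by rewrite mul1r divff.
  by apply: cvgM; [exact: cvg_cst|exact: cvgV].
exact: (cvg_unique _ L1 L2).
Qed.

(** By symmetry of the density, s and -s give the same integral. In the sum of the two integrands
    the cross term cancels, so only integrals of nonnegative functions are handled. *)
Lemma integral_std_pdf_quadratic (m s : R) :
  (\int[leb]_x ((m + s * x) ^+ 2 * p x)%:E = (m ^+ 2 + s ^+ 2)%:E)%E.
Proof.
have m2 c : measurable_fun setT (fun x : R => (m + c * x) ^+ 2 * p x).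
  apply: measurable_funM; last exact: measurable_normal_pdf.
  by apply: measurable_funX; apply: measurable_funD => //; exact: measurable_funM.
have n0 c x : 0 <= (m + c * x) ^+ 2 * p x by rewrite mulr_ge0 ?sqr_ge0 ?normal_pdf_ge0.
have sym : (\int[leb]_x ((m + s * x) ^+ 2 * p x)%:E = \int[leb]_x ((m + - s * x) ^+ 2 * p x)%:E)%E.
  pose u (y : R) := ((m + y) ^+ 2)%:E.
  have mu_ : measurable_fun setT u by apply/measurable_EFinP; apply: measurable_funX; exact: measurable_funD.
  have u0 y : (0 <= u y)%E by rewrite lee_fin sqr_ge0.
  have := integral_std_pdf_sym 0 s mu_ u0; rewrite -(normrN s) integral_std_pdf_sym//.
  rewrite /u; under eq_integral do rewrite add0r -EFinM.
  under [X in _ = X -> _]eq_integral do rewrite add0r -EFinM.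
  by move=> ->.
have S : (\int[leb]_x ((m + s * x) ^+ 2 * p x)%:E + \int[leb]_x ((m + - s * x) ^+ 2 * p x)%:E =
   ((m ^+ 2 + s ^+ 2) *+ 2)%:E)%E.
  rewrite -ge0_integralD//; last 4 first.
  - by move=> x _; rewrite lee_fin.
  - exact: measurable_EFin_comp.
  - by move=> x _; rewrite lee_fin.
  - exact: measurable_EFin_comp.
  transitivity (\int[leb]_x (((m ^+ 2 *+ 2) * p x)%:E + ((s ^+ 2 *+ 2) * (x ^+ 2 * p x))%:E))%E.
    by apply: eq_integral => x _; rewrite -!EFinD; congr EFin; ring.
  have mx2 : measurable_fun setT (fun x : R => x ^+ 2 * p x).
    by apply: measurable_funM; [exact: measurable_funX|exact: measurable_normal_pdf].
  have mp1 : measurable_fun setT p by exact: measurable_normal_pdf.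
  have x20 x : 0 <= x ^+ 2 * p x by rewrite mulr_ge0 ?sqr_ge0 ?normal_pdf_ge0.
  have k0 (k : R) : 0 <= k ^+ 2 *+ 2 by rewrite mulrn_wge0// sqr_ge0.
  rewrite ge0_integralD//; last 4 first.
  - by move=> x _; rewrite lee_fin mulr_ge0// normal_pdf_ge0.
  - by apply: measurable_EFin_comp; exact: measurable_funM.
  - by move=> x _; rewrite lee_fin mulr_ge0.
  - by apply: measurable_EFin_comp; exact: measurable_funM.
  under eq_integral do rewrite EFinM.
  under [X in (_ + X)%E]eq_integral do rewrite EFinM.
  rewrite !ge0_integralZl ?lee_fin//.
  - by rewrite integral_std_pdf integral_std_pdf_sqr !mule1 -EFinD mulrnDl.
  - exact: measurable_EFin_comp.
  - by move=> x _; rewrite lee_fin.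
  - exact: measurable_EFin_comp.
  - by move=> x _; rewrite lee_fin normal_pdf_ge0.
rewrite -sym in S; move: S.
have : (0 <= \int[leb]_x ((m + s * x) ^+ 2 * p x)%:E)%E by apply: integral_ge0 => x _; rewrite lee_fin.
case: (integral _ _ _) => // r _ /=; rewrite -EFinD => -[E]; congr EFin.
by lra.
Qed.

End gaussian_vectors.

Section gaussian_law.
Context {R : realType} d (T : measurableType d) (P : probability T R).
Local Notation leb := (@lebesgue_measure R).
Local Notation p := (@normal_pdf R 0 1).

Lemma integral_is_gaussian (Y : T -> R) (m s : R) :
  measurable_fun setT Y ->
  (forall A : set R, measurable A ->
    P (Y @^-1` A) = if s == 0 then (\d_m A)%R else normal_prob m s A) ->
  forall u : R -> \bar R, measurable_fun setT u -> (forall x, 0 <= u x)%E ->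
  (\int[P]_w u (Y w) = \int[leb]_x (u (m + s * x)%R * (p x)%:E))%E.
Proof.
move=> mY YE u mu_ u0.
(* The transfer formula is needed for both measurable structures on the line: [R] for the Dirac
   case, [measurableTypeR R] for the Lebesgue case. *)
have pR := @ge0_integral_pushforward _ _ _ _ R Y mY P setT u measurableT mu_ (fun y _ => u0 y).
have pM := @ge0_integral_pushforward _ _ _ (measurableTypeR R) R Y mY P setT u measurableT mu_ (fun y _ => u0 y).
rewrite !preimage_setT in pR pM.
have [s0|s0] := eqVneq s 0.
  rewrite -[LHS]pR s0; under [RHS]eq_integral do rewrite mul0r addr0.
  rewrite ge0_integralZl ?integral_std_pdf ?mule1//; last 2 first.
  - exact: measurable_std_pdf.
  - by move=> x _; exact: std_pdf_ge0.
  transitivity (\int[\d_m]_y u y)%E.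
    by apply: eq_measure_integral => A mA _; rewrite /= /pushforward YE// s0 eqxx.
  by rewrite integral_dirac// diracT mul1e.
rewrite -[LHS]pM -integral_normal_pdfE//.
have mf : @measurable_fun _ _ (measurableTypeR R) _ setT (normal_pdf m s).
  exact: measurable_normal_pdf.
have f0 x : 0 <= normal_pdf m s x by exact: normal_pdf_ge0.
rewrite -(ge0_integral_density_measure leb mf f0)//.
by apply: eq_measure_integral => A mA _; rewrite /= /pushforward YE// (negbTE s0).
Qed.

(** The moments of Y and Y + 1 give m^2 + s^2 = v and (m + 1)^2 + s^2 = v + 1, hence m = 0 and |s| =
    sqrt v; the sign of s is immaterial by symmetry. *)
Lemma is_gaussian_centered (Y : T -> R) (v : R) : measurable_fun setT Y ->
  is_gaussian P Y ->
  (\int[P]_w (Y w ^+ 2)%:E = v%:E)%E ->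
  (\int[P]_w ((Y w + 1) ^+ 2)%:E = (v + 1)%:E)%E ->
  forall u : R -> \bar R, measurable_fun setT u -> (forall x, 0 <= u x)%E ->
  (\int[P]_w u (Y w) = \int[leb]_x (u (Num.sqrt v * x)%R * (p x)%:E))%E.
Proof.
move=> mY [m [s YE]] Y2 Y12 u mu_ u0.
have IY := integral_is_gaussian mY YE.
have E2 : m ^+ 2 + s ^+ 2 = v.
  have := IY (fun y => (y ^+ 2)%:E); rewrite Y2.
  under [X in (_ -> _ -> _ = X) -> _]eq_integral do rewrite -EFinM.
  rewrite integral_std_pdf_quadratic => H; apply: EFin_inj; rewrite H//.
  - by apply/measurable_EFinP; exact: measurable_funX.
  - by move=> x; rewrite lee_fin sqr_ge0.
have E12 : (m + 1) ^+ 2 + s ^+ 2 = v + 1.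
  have := IY (fun y => ((y + 1) ^+ 2)%:E); rewrite Y12.
  under [X in (_ -> _ -> _ = X) -> _]eq_integral do rewrite -EFinM addrAC.
  rewrite integral_std_pdf_quadratic => H; apply: EFin_inj; rewrite H//.
  - by apply/measurable_EFinP; apply: measurable_funX; exact: measurable_funD.
  - by move=> x; rewrite lee_fin sqr_ge0.
have m0 : m = 0 by move: E12; rewrite -E2 => E12; lra.
rewrite IY// m0 -E2 m0 expr0n/= add0r sqrtr_sqr.
under [RHS]eq_integral do rewrite -[(`|s| * _)%R]add0r.
by rewrite integral_std_pdf_sym.
Qed.

Section orthonormal.
Variables (n : nat) (V : 'I_n -> T -> R).
Hypothesis mV : forall i, measurable_fun setT (V i).
Hypothesis gV : forall e : 'I_n -> R, is_gaussian P (fun w => \sum_(i < n) e i * V i w).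
Hypothesis iV : forall i, P.-integrable setT (fun w => (V i w)%:E).
Hypothesis V0 : forall i, (\int[P]_w (V i w)%:E = 0)%E.
Hypothesis iVV : forall i j, P.-integrable setT (fun w => (V i w * V j w)%:E).
Hypothesis VV : forall i j, (\int[P]_w (V i w * V j w)%:E = (i == j)%:R%:E)%E.

Let Vt w : n.-tuple R := [tuple V i w | i < n].

Let mVt : measurable_fun setT Vt.
Proof. exact: measurable_fun_tuple. Qed.

Let dotpV e w : dotp e (Vt w) = \sum_(i < n) e i * V i w.
Proof. by apply: eq_bigr => i _; rewrite tnth_mktuple. Qed.

Let mdot e : measurable_fun setT (fun w => \sum_(i < n) e i * V i w).
Proof. by apply: measurable_sum => i; apply: measurable_funM. Qed.

Let dot2 (e : 'I_n -> R) : P.-integrable setT (fun w => ((\sum_(i < n) e i * V i w) ^+ 2)%:E) /\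
  (\int[P]_w ((\sum_(i < n) e i * V i w) ^+ 2)%:E = (\sum_(i < n) e i ^+ 2)%:E)%E.
Proof.
have E w : ((\sum_(i < n) e i * V i w) ^+ 2)%:E =
   (\sum_(i < n) \sum_(j < n) (e i * e j)%:E * (V i w * V j w)%:E)%E.
  rewrite expr2 mulr_suml -sumEFin; apply: eq_bigr => i _.
  rewrite mulr_sumr -sumEFin; apply: eq_bigr => j _.
  by rewrite -EFinM mulrACA.
have iij i j : P.-integrable setT (fun w => (e i * e j)%:E * (V i w * V j w)%:E)%E.
  exact: integrableZl.
have ii i : P.-integrable setT (fun w => \sum_(j < n) (e i * e j)%:E * (V i w * V j w)%:E)%E.
  exact: integrable_sum.
split.
  by under eq_fun do rewrite E; exact: integrable_sum.
under eq_integral do rewrite E.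
rewrite integral_sum// -sumEFin; apply: eq_bigr => i _.
rewrite integral_sum// (bigD1 i)//= big1 ?adde0.
  by rewrite integralZl// VV eqxx mule1 expr2.
by move=> j ji; rewrite integralZl// VV eq_sym (negbTE ji) mule0.
Qed.

Let dot1 (e : 'I_n -> R) : P.-integrable setT (fun w => (\sum_(i < n) e i * V i w)%:E) /\
  (\int[P]_w (\sum_(i < n) e i * V i w)%:E = 0)%E.
Proof.
have E w : (\sum_(i < n) e i * V i w)%:E = (\sum_(i < n) (e i)%:E * (V i w)%:E)%E.
  by rewrite -sumEFin.
have ii i : P.-integrable setT (fun w => (e i)%:E * (V i w)%:E)%E by exact: integrableZl.
split; first by under eq_fun do rewrite E; exact: integrable_sum.
under eq_integral do rewrite E.
by rewrite integral_sum// big1// => i _; rewrite integralZl// V0 mule0.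
Qed.

Let dot12 (e : 'I_n -> R) :
  (\int[P]_w ((\sum_(i < n) e i * V i w + 1) ^+ 2)%:E = (\sum_(i < n) e i ^+ 2 + 1)%:E)%E.
Proof.
have [i2 E2] := dot2 e; have [i1 E1] := dot1 e.
have E w : ((\sum_(i < n) e i * V i w + 1) ^+ 2)%:E =
   (((\sum_(i < n) e i * V i w) ^+ 2)%:E + (2%:E * (\sum_(i < n) e i * V i w)%:E + 1))%E.
  by rewrite -EFinM -!EFinD; congr EFin; ring.
under eq_integral do rewrite E.
have ic : P.-integrable setT (fun=> 1%E : \bar R) by exact: finite_measure_integrable_cst.
have i21 : P.-integrable setT (fun w => 2%:E * (\sum_(i < n) e i * V i w)%:E)%E by exact: integrableZl.
rewrite integralD//; last exact: integrableD.
rewrite integralD// E2 integralZl// E1 mule0 add0e integral_cst//.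
by rewrite mul1e EFinD; congr (_ + _)%E; exact: probability_setT.
Qed.

(** Orthonormality makes the combination a centred normal variable with variance the sum of the
    e_i^2, and the same linear form of a standard normal vector has that law too. *)
Lemma ge0_integral_dot_orthonormal (e : 'I_n -> R) (u : R -> \bar R) :
  measurable_fun setT u -> (forall x, 0 <= u x)%E ->
  (\int[P]_w u (\sum_(i < n) e i * V i w)%R =
   \int[lebesgue_tuple R n]_v (u (dotp e v) * (\prod_(i < n) p (tnth v i))%:E))%E.
Proof.
move=> mu_ u0.
rewrite (is_gaussian_centered (mdot e) (gV e) (dot2 e).2 (dot12 e) mu_ u0).
under [RHS]eq_integral do rewrite -[dotp e _]add0r.
by rewrite integral_dotp_std//; under [RHS]eq_integral do rewrite add0r.
Qed.

(** Cramer-Wold argument: the law of the vector and the standard normal law agree on every linear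
    form, hence on all cosine transforms, hence on continuous bounded functions. *)
Lemma integral_orthonormal_gaussian (g : n.-tuple R -> R) (M : R) :
  continuous (g \o @tuple_of_row R n) -> (forall v, 0 <= g v <= M) ->
  (\int[P]_w (g (Vt w))%:E =
   \int[lebesgue_tuple R n]_v (g v * \prod_(i < n) p (tnth v i))%:E)%E.
Proof.
move=> cg gM; have mg := measurable_continuous_tuple cg.
have g0 v : 0 <= g v by have /andP[] := gM v.
pose mu := measure_function_pushforward__canonical__measure_function_Measure P mVt.
pose nu := density_measure (lebesgue_tuple R n) (@measurable_std_pdf_prod R n) (@std_pdf_prod_ge0 R n).
have intmu (h : n.-tuple R -> \bar R) : measurable_fun setT h -> (forall v, 0 <= h v)%E ->
    (\int[mu]_v h v = \int[P]_w h (Vt w))%E.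
  by move=> mh h0; rewrite ge0_integral_pushforward.
have intnu (h : n.-tuple R -> \bar R) : measurable_fun setT h -> (forall v, 0 <= h v)%E ->
    (\int[nu]_v h v = \int[lebesgue_tuple R n]_v (h v * (\prod_(i < n) p (tnth v i))%:E))%E.
  by move=> mh h0; rewrite ge0_integral_density_measure.
have muT : mu setT = 1%E by rewrite /mu /= /pushforward preimage_setT; exact: probability_setT.
(* Total mass one is the case e = 0, u = 1 of the identity for linear forms. *)
have nuT : nu setT = 1%E.
  have := @ge0_integral_dot_orthonormal (fun=> 0) (cst 1%E) (measurable_cst _) (fun=> lee01).
  rewrite integral_cst// mul1e => H.
  transitivity (P setT); last exact: probability_setT.
  rewrite H.
  by rewrite /nu /density_measure; apply: eq_integral => v _; rewrite mul1e.
transitivity (\int[mu]_v (g v)%:E)%E.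
  by rewrite intmu//; exact/measurable_EFinP.
transitivity (\int[nu]_v (g v)%:E)%E; last first.
  by rewrite intnu//; exact/measurable_EFinP.
apply: (@integral_eq_of_cos _ _ g M) => //.
- by move=> v; rewrite ger0_norm//; have /andP[] := gM v.
- by apply: (le_lt_trans _ (ltry 1)); rewrite le_eqVlt; apply/orP; left; apply/eqP; exact: muT.
- by apply: (le_lt_trans _ (ltry 1)); rewrite le_eqVlt; apply/orP; left; apply/eqP; exact: nuT.
move=> a e.
(* The identity for linear forms concerns nonnegative functions, so the cosine is raised by 1 and
   the unit mass subtracted. *)
have cE (m : {measure set (n.-tuple R) -> \bar R}) : m setT = 1%E ->
    (\int[m]_z (cos (a + dotp e z))%:E = \int[m]_z (1 + cos (a + dotp e z))%:E - 1)%E.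
  move=> m1; under [in RHS]eq_integral do rewrite EFinD.
  have ic : m.-integrable setT (fun z => (cos (a + dotp e z))%:E).
    apply: (@integrable_bounded _ _ _ m _ 1) => [||z]; last exact: cos_max.
      by rewrite m1 ltry.
    exact: measurable_cos_dotp.
  have i1 : m.-integrable setT (fun=> 1%:E : \bar R).
    by apply: (@integrable_bounded _ _ _ m (cst 1) 1) => // [|z]; rewrite ?m1 ?ltry// normr1.
  rewrite integralD// integral_cst// m1 mule1 addeAC -EFinB subrr add0e//.
rewrite !cE//; congr (_ - _)%E.
pose u y := (1 + cos (a + y))%:E : \bar R.
have mu_ : measurable_fun setT u.
  apply/measurable_EFinP; apply: measurable_funD => //.
  by apply: (measurableT_comp (@measurable_cos R)); exact: measurable_funD.
have u0 y : (0 <= u y)%E by rewrite lee_fin; have := cos_geN1 (a + y); lra.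
have mud : measurable_fun setT (fun v : n.-tuple R => u (dotp e v)).
  exact: (measurableT_comp mu_ (measurable_dotp e)).
rewrite (intmu (fun v => u (dotp e v)))// (intnu (fun v => u (dotp e v)))//.
rewrite -ge0_integral_dot_orthonormal//.
by apply: eq_integral => w _; rewrite dotpV.
Qed.

End orthonormal.
End gaussian_law.

(** * Whitening the Brownian bridge at the points i/k *)

Section bridge_increments.
Context {R : realType} d' (T' : measurableType d') (P' : probability T' R).
Variable W : R -> {RV P' >-> R}.
Hypothesis bW : brownian_bridge W.

Lemma bridge_mean y : 0 <= y <= 1 -> (\int[P']_w (W y w)%:E = 0)%E.
Proof. by case: bW => _ W0 _ y01; have := W0 _ y01; rewrite unlock. Qed.

Lemma bridge_cov y1 y2 : 0 <= y1 -> y1 <= y2 -> y2 <= 1 ->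
  (\int[P']_w (W y1 w * W y2 w)%:E = (y1 * (1 - y2))%:E)%E.
Proof.
move=> y10 y12 y21; case: bW => _ W0 /(_ y1 y2 y10 y12 y21).
rewrite unlock !W0/=.
- by rewrite unlock /= => <-; apply: eq_integral => w _; rewrite fctE /=; congr (_ * _)%:E; rewrite ?subr0.
- by rewrite (le_trans y10).
- by rewrite y10 (le_trans y12).
Qed.

(** The covariance at equal times gives finite second moments, and |a b| <= a^2 + b^2. *)
Lemma bridge_integrable2 y1 y2 : 0 <= y1 <= 1 -> 0 <= y2 <= 1 ->
  P'.-integrable setT (fun w => (W y1 w * W y2 w)%:E).
Proof.
have sq y : 0 <= y <= 1 -> P'.-integrable setT (fun w => (W y w ^+ 2)%:E).
  move=> /andP[y_ge0 y_le1]; apply/integrableP; split.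
    by apply/measurable_EFinP; exact: measurable_funX.
  under eq_integral do rewrite /= ger0_norm ?sqr_ge0// expr2.
  by rewrite bridge_cov// ltry.
move=> y1P y2P.
apply: (@le_integrable _ _ _ P' setT measurableT _ (fun w => (W y1 w ^+ 2)%:E + (W y2 w ^+ 2)%:E)%E) => //.
- by apply/measurable_EFinP; exact: measurable_funM.
- move=> w _; rewrite /= lee_fin [leRHS]ger0_norm ?addr_ge0 ?sqr_ge0//.
  by rewrite ler_norml; apply/andP; split; nra.
- by apply: integrableD => //; exact: sq.
Qed.

Lemma bridge_integrable y : 0 <= y <= 1 -> P'.-integrable setT (fun w => (W y w)%:E).
Proof.
move=> yP.
apply: (@le_integrable _ _ _ P' setT measurableT _ (fun w => 1%:E + (W y w * W y w)%:E)%E) => //.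
- exact/measurable_EFinP.
- move=> w _; rewrite /= lee_fin [leRHS]ger0_norm ?addr_ge0// -?expr2 ?sqr_ge0//.
  by rewrite ler_norml; apply/andP; split; nra.
- apply: integrableD => //; last exact: bridge_integrable2.
  exact: finite_measure_integrable_cst.
Qed.

Variable d : nat.
Let k : R := d.+1%:R.
Let K (i : nat) : R := (d.+1 - i)%:R.
Let tm (i : nat) : R := i%:R / k.

Let k0 : 0 < k. Proof. by rewrite /k. Qed.

Let K_gt0 i : (i <= d)%N -> 0 < K i.
Proof. by move=> id; rewrite /K ltr0n subn_gt0. Qed.

Let KE i : (i <= d)%N -> K i = k - i%:R.
Proof. by move=> id; rewrite /K natrB// ltnW. Qed.

Let tm01 i : (i <= d)%N -> 0 <= tm i <= 1.
Proof.
by move=> id; rewrite /tm divr_ge0 ?(ltW k0)//= ler_pdivrMr// mul1r ler_nat ltnW.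
Qed.

(** W(t)/(1 - t), up to the factor k, at t = i/k: a Brownian motion in the time t/(1 - t). At i = 0
    it is set to 0 exactly, where W(0) vanishes only almost surely. *)
Let B (i : nat) (w : T') : R := if i is 0%N then 0 else W (tm i) w / K i.

Let h (i : nat) : R := i%:R / (k ^+ 2 * K i).

Let mB i : measurable_fun setT (B i).
Proof. by case: i => [|i]; [exact: measurable_cst|exact: measurable_funM]. Qed.

Let iB i : (i <= d)%N -> P'.-integrable setT (fun w => (B i w)%:E).
Proof.
case: i => [|i] id; first exact: integrable0.
rewrite (_ : (fun _ => _) = (fun w => (K i.+1)^-1%:E * (W (tm i.+1) w)%:E)%E).
  by apply: integrableZl => //; apply: bridge_integrable; exact: tm01.
by apply/funext => w; rewrite -EFinM mulrC.
Qed.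

Let B1 i : (i <= d)%N -> (\int[P']_w (B i w)%:E = 0)%E.
Proof.
case: i => [|i] id; first by rewrite integral0.
rewrite (_ : (fun _ => _) = (fun w => (K i.+1)^-1%:E * (W (tm i.+1) w)%:E)%E).
  rewrite integralZl ?bridge_mean ?mule0//; first exact: tm01.
  by apply: bridge_integrable; exact: tm01.
by apply/funext => w; rewrite -EFinM mulrC.
Qed.

Let iBB i j : (i <= d)%N -> (j <= d)%N -> P'.-integrable setT (fun w => (B i w * B j w)%:E).
Proof.
case: i => [|i] id; first by move=> _; under eq_fun do rewrite mul0r; exact: integrable0.
case: j => [|j] jd; first by under eq_fun do rewrite mulr0; exact: integrable0.
rewrite (_ : (fun _ => _) = (fun w => ((K i.+1)^-1 * (K j.+1)^-1)%:E * (W (tm i.+1) w * W (tm j.+1) w)%:E)%E).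
  by apply: integrableZl => //; apply: bridge_integrable2; exact: tm01.
by apply/funext => w; rewrite -EFinM /B; congr EFin; ring.
Qed.

(** The factor 1 - t_j of the bridge covariance cancels against K_j, so the covariance depends on
    the smaller index only, as for a Brownian motion. *)
Let BB i j : (i <= j)%N -> (j <= d)%N -> (\int[P']_w (B i w * B j w)%:E = (h i)%:E)%E.
Proof.
case: i => [|i] ij jd.
  by under eq_integral do rewrite mul0r; rewrite integral0 /h mul0r.
case: j => [//|j] in ij jd *.
have id : (i < d)%N by rewrite (leq_trans ij).
rewrite (_ : (fun _ => _) = (fun w => ((K i.+1)^-1 * (K j.+1)^-1)%:E * (W (tm i.+1) w * W (tm j.+1) w)%:E)%E).
  rewrite integralZl//; last by apply: bridge_integrable2; exact: tm01.
  have /andP[ti0 _] := tm01 id; have /andP[_ tj1] := tm01 jd.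
  rewrite bridge_cov//; last by rewrite ler_pM2r ?invr_gt0// ler_nat.
  rewrite -EFinM; congr EFin; rewrite /h /tm.
  have := K_gt0 jd; have := K_gt0 id; rewrite !KE// => Ki Kj.
  move: k0 Ki Kj; move: (k) (i.+1%:R : R) (j.+1%:R : R) => k' a b k'0 Ka Kb.
  by field; rewrite !gt_eqF.
by apply/funext => w; rewrite -EFinM /B; congr EFin; ring.
Qed.

(** Inverse standard deviation of the increment B_(i+1) - B_i, since h(i+1) - h(i) = 1 / (k K_i
    K_(i+1)). *)
Let al (i : nat) : R := Num.sqrt (k * K i * K i.+1).

Let al_gt0 i : (i < d)%N -> 0 < al i.
Proof. by move=> id; rewrite sqrtr_gt0 !mulr_gt0// K_gt0// ltnW. Qed.

Let al2 i : (i < d)%N -> al i ^+ 2 = k * K i * K i.+1.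
Proof. by move=> id; rewrite sqr_sqrtr// ltW// !mulr_gt0// K_gt0// ltnW. Qed.

Let V (i : 'I_d) (w : T') : R := al i * (B i.+1 w - B i w).

Let mV i : measurable_fun setT (V i).
Proof. by apply: measurable_funM => //; exact: measurable_funB. Qed.

Let VE (i : 'I_d) w : (V i w)%:E = ((al i)%:E * ((B i.+1 w)%:E - (B i w)%:E))%E.
Proof. by rewrite -EFinB -EFinM. Qed.

Let iV i : P'.-integrable setT (fun w => (V i w)%:E).
Proof.
under eq_fun do rewrite VE; apply: integrableZl => //.
by apply: integrableB => //; apply: iB => //; exact: ltnW.
Qed.

Let V0 i : (\int[P']_w (V i w)%:E = 0)%E.
Proof.
have i1 := iB (ltn_ord i); have i2 := iB (ltnW (ltn_ord i)).
under eq_integral do rewrite VE; rewrite integralZl//; last exact: integrableB.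
by rewrite integralB// !B1 ?sube0 ?mule0//; exact: ltnW.
Qed.

Let VVE (i j : 'I_d) w : (V i w * V j w)%:E = ((al i * al j)%:E *
  (((B i.+1 w * B j.+1 w)%:E - (B i.+1 w * B j w)%:E) -
   ((B i w * B j.+1 w)%:E - (B i w * B j w)%:E)))%E.
Proof. by rewrite -!EFinB -EFinM; congr EFin; rewrite /V; ring. Qed.

Let iVV i j : P'.-integrable setT (fun w => (V i w * V j w)%:E).
Proof.
have [i1 i2] := (ltn_ord i, ltnW (ltn_ord i)).
have [j1 j2] := (ltn_ord j, ltnW (ltn_ord j)).
under eq_fun do rewrite VVE; apply: integrableZl => //.
by apply: integrableB => //; apply: integrableB => //; exact: iBB.
Qed.

Let VV_le (i j : 'I_d) : (i <= j)%N -> (\int[P']_w (V i w * V j w)%:E = (i == j)%:R%:E)%E.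
Proof.
move=> ij; have [i1 i2] := (ltn_ord i, ltnW (ltn_ord i)).
have [j1 j2] := (ltn_ord j, ltnW (ltn_ord j)).
under eq_integral do rewrite VVE.
rewrite integralZl//; last by apply: integrableB => //; apply: integrableB => //; exact: iBB.
rewrite integralB//; try by apply: integrableB => //; exact: iBB.
rewrite integralB//; try exact: iBB.
rewrite integralB//; try exact: iBB.
rewrite (BB ij j2) (BB (leqW ij) j1) (@BB i.+1 j.+1)//.
move: ij; rewrite leq_eqVlt => /predU1P[/val_inj ->|ij]; last first.
  rewrite (BB ij j2) -!EFinB !subrr mule0 -val_eqE/=.
  by rewrite (ltn_eqF ij).
rewrite eqxx (_ : (\int[P']_w (B j.+1 w * B j w)%:E = (h j)%:E)%E); last first.
  by rewrite -(BB (leqnSn j) j1); apply: eq_integral => w _; rewrite mulrC.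
rewrite -!EFinB -EFinM -expr2 al2//; congr EFin.
rewrite /h; have := K_gt0 j1; have := K_gt0 j2; rewrite !KE// -natr1.
move: k0; move: (k) (j%:R : R) => k' a k'0 Ka Kb.
rewrite (_ : true%:R = 1)//.
by field; rewrite !gt_eqF.
Qed.

Let VV i j : (\int[P']_w (V i w * V j w)%:E = (i == j)%:R%:E)%E.
Proof.
have [ij|/ltnW ij] := leqP i j; first exact: VV_le.
by rewrite eq_sym -VV_le//; apply: eq_integral => w _; rewrite mulrC.
Qed.

Lemma summation_by_parts (a b : nat -> R) n :
  \sum_(i < n) a i * (b i.+1 - b i) =
  \sum_(i < n) (a i - a i.+1) * b i.+1 + a n * b n - a 0%N * b 0%N.
Proof.
elim: n => [|n IHn]; first by rewrite !big_ord0 add0r subrr.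
by rewrite !big_ord_recr/= IHn; ring.
Qed.

(** Summation by parts turns the combination of increments into one of the values W(i/k), which the
    process hypothesis covers. The boundary terms vanish: [a] is extended by 0 at index d, and B_0 =
    0. *)
Let gV (e : 'I_d -> R) : is_gaussian P' (fun w => \sum_(i < d) e i * V i w).
Proof.
pose a (i : nat) : R := if insub i is Some j then e j * al i else 0.
pose c (i : 'I_d) := (a i - a i.+1) / K i.+1.
case: bW => gW _ _.
have := gW d (fun i => tm i.+1) c (fun i => tm01 (ltn_ord i)).
congr (is_gaussian _ _); apply/funext => w.
transitivity (\sum_(i < d) (a i - a i.+1) * B i.+1 w).
  by apply: eq_bigr => i _; rewrite /c /B mulrAC mulrA.
have ad : a d = 0 by rewrite /a insubF// ltnn.
transitivity (\sum_(i < d) a i * (B i.+1 w - B i w)).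
  by rewrite (summation_by_parts a (B ^~ w)) ad mul0r (_ : B 0%N w = 0)// mulr0 addr0 subr0.
by apply: eq_bigr => i _; rewrite /a valK /V mulrA.
Qed.

Variables (fq : nat -> R).
Hypothesis fq0 : forall j, (1 <= j <= d)%N -> 0 < fq j.

(** Both endpoints read 0: index 0 by the added head, index d+1 by the default value of [nth],
    matching the fixed values Q(0) and Q(1). *)
Definition qcoord (t : d.-tuple R) (j : nat) : R := fq j * nth 0 (0 :: t) j.

Definition bridge_density (t : d.-tuple R) : R :=
  expR (- (d.+1%:R / 2 * \sum_(j < d.+1) (qcoord t j.+1 - qcoord t j) ^+ 2)).

(** Inverse of the whitening: it rebuilds W(i/k)/f_i from the normalised increments by partial
    sums. *)
Let L (v : d.-tuple R) : d.-tuple R :=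
  [tuple K i.+1 / fq i.+1 * \sum_(j < d | (j <= i)%N) tnth v j / al j | i < d].

Let sum_ltE (F : nat -> R) (i : 'I_d) :
  \sum_(j < d | (j <= i)%N) F j = \sum_(j < i.+1) F j.
Proof. by rewrite [RHS](big_ord_widen d F (ltn_ord i)). Qed.

Let LV w : L [tuple V i w | i < d] = [tuple W (i.+1%:R / k) w / fq i.+1 | i < d].
Proof.
apply: eq_from_tnth => i; rewrite !tnth_mktuple.
under eq_bigr => j _ do rewrite tnth_mktuple /V mulrAC divff ?gt_eqF ?al_gt0// mul1r.
rewrite (sum_ltE (fun j => B j.+1 w - B j w)).
rewrite -(big_mkord xpredT (fun j => B j.+1 w - B j w)) telescope_sumr// subr0 /B.
by have := K_gt0 (ltn_ord i) => Ki; have := fq0 (j := i.+1) (ltn_ord i) => fi; field; rewrite !gt_eqF.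
Qed.

(** Coefficients of the chain map inverse to [L]. The value 1 for i >= d only serves the change of
    variables, which asks for a nonzero factor at every index. *)
Let s (i : nat) : R := if (i < d)%N then al i * fq i.+1 / K i.+1 else 1.
Let r (i : nat) : R := - (al i * fq i / K i).

Let s_gt0 i : 0 < s i.
Proof.
by rewrite /s; case: ifPn => // id; rewrite divr_gt0 ?mulr_gt0 ?al_gt0 ?fq0 ?K_gt0.
Qed.

Let TE (t : d.-tuple R) (i : 'I_d) :
  tnth (chain_map (fun=> 0) s r 0 t) i =
  al i * (qcoord t i.+1 / K i.+1 - qcoord t i / K i).
Proof.
rewrite tnth_mktuple /s ltn_ord /r /qcoord /= (tnth_nth 0); ring.
Qed.

Let LT t : L (chain_map (fun=> 0) s r 0 t) = t.
Proof.
apply: eq_from_tnth => i; rewrite tnth_mktuple.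
under eq_bigr => j _ do rewrite TE mulrAC divff ?gt_eqF ?al_gt0// mul1r.
rewrite (sum_ltE (fun j => qcoord t j.+1 / K j.+1 - qcoord t j / K j)).
rewrite -(big_mkord xpredT (fun j => qcoord t j.+1 / K j.+1 - qcoord t j / K j)).
rewrite telescope_sumr// {2}/qcoord /= mulr0 mul0r subr0 /qcoord/= (tnth_nth 0).
by have := K_gt0 (ltn_ord i) => Ki; have := fq0 (j := i.+1) (ltn_ord i) => fi; field; rewrite !gt_eqF.
Qed.

(** As K_i = K_(i+1) + 1, each term equals k (z_(i+1) - z_i)^2 plus a telescoping difference of k
    z_i^2 / K_i. *)
Let sumTE (z : nat -> R) n : (n <= d)%N ->
  \sum_(i < n) al i ^+ 2 * (z i.+1 / K i.+1 - z i / K i) ^+ 2 =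
  k * (\sum_(i < n) (z i.+1 - z i) ^+ 2) + k * (z n ^+ 2 / K n - z 0%N ^+ 2 / K 0%N).
Proof.
elim: n => [_|n IHn nd]; first by rewrite !big_ord0 subrr mulr0 addr0.
rewrite !big_ord_recr/= IHn 1?ltnW// al2//.
have := K_gt0 nd; have := K_gt0 (ltnW nd); have := K_gt0 (leq0n d).
rewrite !KE// 1?ltnW// -natr1.
move: (k) (n%:R : R) (\sum_(i < n) _) (z n) (z n.+1) => k' a S zn zn1; rewrite subr0 => K0 Kn Kn1.
by field; rewrite !gt_eqF.
Qed.

(** The boundary term z_d^2 / K_d with K_d = 1 is exactly the missing last squared increment, from
    z_d to z_(d+1) = 0. *)
Let densityE t : \prod_(i < d) normal_pdf 0 1 (tnth (chain_map (fun=> 0) s r 0 t) i) =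
  normal_peak 1 ^+ d * bridge_density t.
Proof.
under eq_bigr do rewrite std_pdfE TE exprMn.
rewrite big_split/= prodr_const card_ord -expR_sum; congr (_ * expR _).
rewrite sumrN; congr (- _); rewrite -mulr_suml sumTE//.
have -> : K d = 1 by rewrite /K subSnn.
have -> : qcoord t 0 = 0 by rewrite /qcoord mulr0.
have qd : qcoord t d.+1 = 0 by rewrite /qcoord nth_default ?mulr0//= size_tuple.
rewrite big_ord_recr/= qd sub0r sqrrN -/k expr0n mul0r subr0 divr1; ring.
Qed.

(** The constant collects the Jacobian of the whitening and the peaks of the normal densities. Only
    its positivity is recorded; the case g = 1 identifies it when needed. *)
Lemma bridge_limit_density : exists2 c : R, 0 < c & forall (g : d.-tuple R -> R) (M : R),
  continuous (g \o @tuple_of_row R d) -> (forall v, 0 <= g v <= M) ->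
  (\int[P']_w (g [tuple W (i.+1%:R / d.+1%:R) w / fq i.+1 | i < d])%:E =
   c%:E * \int[lebesgue_tuple R d]_t (g t * bridge_density t)%:E)%E.
Proof.
exists (\prod_(i < d) s i * normal_peak 1 ^+ d).
  by rewrite mulr_gt0 ?prodr_gt0// exprn_gt0// normal_peak_gt0// oner_neq0.
move=> g M cg gM.
have cL : continuous ((g \o L) \o @tuple_of_row R d).
  move=> v; apply: (@continuous_tuple_cvg R 'rV[R]_d (nbhs v) _ d g (fun x => L (tuple_of_row x)) (L (tuple_of_row v))) => [|i].
    exact: cg.
  rewrite tnth_mktuple; under eq_fun do rewrite tnth_mktuple.
  apply: cvgM; first exact: cvg_cst.
  apply: cvg_big => [|j _]; first exact: add_continuous.
  rewrite tnth_mktuple; under eq_fun do rewrite tnth_mktuple.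
  by apply: cvgM; [exact: coord_continuous|exact: cvg_cst].
have := @integral_orthonormal_gaussian R _ _ P' d V mV gV iV V0 iVV VV (g \o L) M cL.
move=> /(_ (fun v => gM (L v))).
under eq_integral do rewrite /= LV.
move=> ->.
have mgL : measurable_fun setT (g \o L) by exact: measurable_continuous_tuple.
have g0 v : 0 <= g v by have /andP[] := gM v.
rewrite (@ge0_integral_chain_map _ _ (fun=> 0) s r 0)//; last 3 first.
- by move=> i; rewrite gt_eqF.
- apply/measurable_EFinP; apply: measurable_funM => //; exact: measurable_std_pdf_prod.
- by move=> v; rewrite lee_fin; apply: mulr_ge0; [exact: g0|exact: std_pdf_prod_ge0].
under eq_integral do rewrite /= densityE LT mulrCA EFinM.
rewrite ge0_integralZl//.
- rewrite muleA -EFinM; congr ((_ * _)%:E * _)%E.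
  by apply: eq_bigr => i _; rewrite gtr0_norm.
- apply/measurable_EFinP; apply: measurable_funM.
    exact: measurable_continuous_tuple.
  rewrite /bridge_density; apply: (measurableT_comp (@measurable_expR R)).
  apply: (measurableT_comp (@oppr_measurable R setT)).
  apply: measurable_funM => //; apply: measurable_sum => j.
  apply: measurable_funX; apply: measurable_funB; apply: measurable_funM => //.
    exact: measurable_nth_tuple.
  case: j => -[|j] Hj/=; first exact: measurable_cst.
  exact: measurable_nth_tuple.
- by move=> t _; rewrite lee_fin mulr_ge0// expR_ge0.
- by rewrite lee_fin exprn_ge0// normal_peak_ge0.
Qed.

End bridge_increments.

(** * The mass of a quantile pyramid prior *)

Section pyramid_integral.
Context {R : realType}.
Local Notation leb := (@lebesgue_measure R).

(** The finest level of a pyramid on [a, 1]: in [a :: rcons q 1] the entries at odd positions are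
    new, each drawn given its two neighbours. The left end [a] is free so that an induction can move
    it to the right. *)
Definition level_weight (h : nat -> R -> R -> R -> R) (a : R) N (q : seq R) : R :=
  let s := a :: rcons q 1 in
  \prod_(i < N.+1) h i (nth 0 s i.*2) (nth 0 s i.*2.+2) (nth 0 s i.*2.+1).

Definition even_part N (q : seq R) : N.-tuple R := [tuple nth 0 q i.*2.+1 | i < N].

Lemma measurable_even_part n N : measurable_fun setT (fun q : n.-tuple R => even_part N q).
Proof. by apply: measurable_fun_tuple => i; exact: measurable_nth_tuple. Qed.

Lemma level_weight_ge0 (h : nat -> R -> R -> R -> R) a N q :
  (forall i x y z, 0 <= h i x y z) -> 0 <= level_weight h a N q.
Proof. by move=> h0; apply: prodr_ge0. Qed.

Lemma measurable_comp3 d (T : measurableType d) (f : R -> R -> R -> R) (A B C : T -> R) :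
  measurable_fun setT (fun z : R * R * R => f z.1.1 z.1.2 z.2) ->
  measurable_fun setT A -> measurable_fun setT B -> measurable_fun setT C ->
  measurable_fun setT (fun x => f (A x) (B x) (C x)).
Proof.
move=> mf mA mB mC.
have H := measurableT_comp mf (measurable_fun_pair (measurable_fun_pair mA mB) mC).
exact: H.
Qed.

Lemma measurable_level_weight d (T : measurableType d) (h : nat -> R -> R -> R -> R)
    n N (A : T -> R) (Q : T -> n.-tuple R) :
  (forall i, measurable_fun setT (fun z : R * R * R => h i z.1.1 z.1.2 z.2)) ->
  measurable_fun setT A -> measurable_fun setT Q ->
  measurable_fun setT (fun x => level_weight h (A x) N (Q x)).
Proof.
move=> mh mA mQ.
have mn i : measurable_fun setT (fun x => nth 0 (A x :: rcons (Q x) 1) i).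
  case: i => [|i] //=; have [ni|ni] := ltnP i n.
    rewrite (_ : (fun _ => _) = (fun x => nth 0 (Q x) i)).
      exact: (measurableT_comp (measurable_nth_tuple i 0) mQ).
    by apply/funext => x; rewrite nth_rcons size_tuple ni.
  rewrite (_ : (fun _ => _) = cst (if i == n then 1 else 0)); first exact: measurable_cst.
  by apply/funext => x; rewrite nth_rcons size_tuple ltnNge ni.
apply: measurable_prod => i _.
exact: measurable_comp3.
Qed.

(** Given the coarser quantiles the new ones are conditionally independent, each with mass at most
    1. The induction removes two coordinates, a new x and a kept y, and y becomes the left end of
    the rest. *)
Lemma integral_level_weight_le (h : nat -> R -> R -> R -> R) N (a : R)
    (F : N.-tuple R -> R) :
  (forall i, measurable_fun setT (fun z : R * R * R => h i z.1.1 z.1.2 z.2)) ->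
  (forall i x y z, 0 <= h i x y z) ->
  (forall i x y, \int[leb]_z (h i x y z)%:E <= 1)%E ->
  measurable_fun setT F -> (forall v, 0 <= F v) ->
  (\int[lebesgue_tuple R N.*2.+1]_q (F (even_part N q) * level_weight h a N q)%:E <=
   \int[lebesgue_tuple R N]_e (F e)%:E)%E.
Proof.
elim: N h a F => [|N IHN] h a F mh h0 h1 mF F0.
  have mI : measurable_fun setT (fun q : 1.-tuple R => (F (even_part 0 q) * level_weight h a 0 q)%:E).
    apply/measurable_EFinP; apply: measurable_funM.
      by have H := measurableT_comp mF (@measurable_even_part 1 0); exact: H.
    exact: measurable_level_weight.
  rewrite (@ge0_integral_lebesgue_tupleS _ 0 _ mI); last first.
    by move=> v; rewrite lee_fin mulr_ge0// level_weight_ge0// => *; exact: h0.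
  rewrite (ge0_integral_lebesgue_tuple0 (F := EFin \o F)); last exact/measurable_EFinP.
  have mh0 : measurable_fun setT (fun x => h 0%N a 1 x).
    by apply: (measurable_comp3 (mh 0%N)).
  apply: (@le_trans _ _ (\int[leb]_x ((F [tuple])%:E * (h 0%N a 1 x)%:E))%E).
    rewrite le_eqVlt; apply/orP; left; apply/eqP; apply: eq_integral => x _.
    rewrite ge0_integral_lebesgue_tuple0; last exact: (measurable_cons_l _ mI).
    rewrite -EFinM /level_weight big_ord_recl big_ord0 mulr1 /=; congr (F _ * _)%:E.
    by apply: eq_from_tnth => -[].
  rewrite ge0_integralZl ?lee_fin//=; last 2 first.
    exact: (measurableT_comp (@EFin_measurable R setT) mh0).
    by move=> x _; rewrite lee_fin.
  by rewrite -[leRHS]mule1 lee_wpmul2l ?lee_fin.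
pose h' i := h i.+1.
pose I (y : R) (q : N.*2.+1.-tuple R) := F [tuple of y :: even_part N q] * level_weight h' y N q.
have mI : measurable_fun setT (fun z : measurableTypeR R * N.*2.+1.-tuple R => I z.1 z.2).
  apply: measurable_funM; last by apply: measurable_level_weight => // i; exact: mh.
  apply: (measurableT_comp mF); apply: measurable_cons => //.
  by have H := measurableT_comp (@measurable_even_part N.*2.+1 N) (@measurable_snd _ _ (measurableTypeR R) _); exact: H.
have I0 y q : 0 <= I y q by rewrite mulr_ge0// level_weight_ge0// => *; exact: h0.
have mJ : measurable_fun setT (fun q : N.+1.*2.+1.-tuple R => (F (even_part N.+1 q) * level_weight h a N.+1 q)%:E).
  apply/measurable_EFinP; apply: measurable_funM.
    by have H := measurableT_comp mF (@measurable_even_part N.+1.*2.+1 N.+1); exact: H.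
  exact: measurable_level_weight.
have J0 (q : N.+1.*2.+1.-tuple R) : (0 <= (F (even_part N.+1 q) * level_weight h a N.+1 q)%:E)%E.
  by rewrite lee_fin mulr_ge0// level_weight_ge0// => *; exact: h0.
pose G y := (\int[lebesgue_tuple R N.*2.+1]_q (I y q)%:E)%E.
have mG : measurable_fun setT G.
  apply: (@measurable_fun_fubini_tonelli_F _ _ (measurableTypeR R) _ _ (lebesgue_tuple R N.*2.+1)
    (fun z => (I z.1 z.2)%:E)); first exact/measurable_EFinP.
  by move=> z; rewrite lee_fin.
have G0 y : (0 <= G y)%E by apply: integral_ge0 => q _; rewrite lee_fin.
have JE x y (q : N.*2.+1.-tuple R) :
    F (even_part N.+1 [tuple of x :: [tuple of y :: q]]) *
    level_weight h a N.+1 [tuple of x :: [tuple of y :: q]] = h 0%N a y x * I y q.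
  rewrite /level_weight big_ord_recl/= mulrCA; congr (_ * (F _ * _)).
  by apply: eq_from_tnth => i; rewrite tnth_mktuple; have [j ->|->] := unliftP ord0 i;
    rewrite ?tnth0// tnthS tnth_mktuple.
have -> : (\int[lebesgue_tuple R N.+1.*2.+1]_q (F (even_part N.+1 q) * level_weight h a N.+1 q)%:E =
    \int[leb]_x \int[leb]_y ((h 0%N a y x)%:E * G y))%E.
  rewrite (@ge0_integral_lebesgue_tupleS _ N.*2.+2 _ mJ J0).
  apply: eq_integral => x _.
  rewrite (@ge0_integral_lebesgue_tupleS _ N.*2.+1 _ (measurable_cons_l x mJ)); last by move=> v; exact: J0.
  apply: eq_integral => y _; rewrite /G -ge0_integralZl ?lee_fin//.
  - by apply: eq_integral => q _; rewrite JE EFinM.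
  - apply/measurable_EFinP.
    exact: (measurableT_comp mI (measurable_fun_pair (measurable_cst (y : measurableTypeR R)) (@measurable_id _ _ _))).
  - by move=> q _; rewrite lee_fin.
pose f := fun z : measurableTypeR R * measurableTypeR R => ((h 0%N a z.2 z.1)%:E * G z.2)%E.
have mh0 : measurable_fun setT (fun z : measurableTypeR R * measurableTypeR R => h 0%N a z.2 z.1).
  apply: (measurable_comp3 (mh 0%N)) => //.
have mf : measurable_fun setT f.
  apply: emeasurable_funM; first exact/measurable_EFinP.
  exact: (measurableT_comp mG (@measurable_snd _ _ (measurableTypeR R) (measurableTypeR R))).
have f0 z : (0 <= f z)%E by rewrite mule_ge0 ?lee_fin.
(* The exchange lets the new quantile x be integrated while its right neighbour y is fixed, which is
   where the bound by 1 on the conditional density enters. *)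
rewrite [X in (X <= _)%E](@fubini_tonelli _ _ _ _ _ leb leb f mf f0).
rewrite (ge0_integral_lebesgue_tupleS (F := EFin \o F)); last 2 first.
- exact/measurable_EFinP.
- by move=> v; rewrite lee_fin.
apply: ge0_le_integral => //.
- by move=> y _; apply: integral_ge0.
- exact: (@measurable_fun_fubini_tonelli_G _ _ (measurableTypeR R) (measurableTypeR R) R leb f mf f0).
- by apply: (@measurable_integral_tuple_cons R N (EFin \o F)); [exact/measurable_EFinP|move=> v; rewrite lee_fin].
- move=> y _; rewrite /f/=.
  rewrite ge0_integralZr//; last 2 first.
    exact: (measurableT_comp (@EFin_measurable R setT) (measurableT_comp mh0 (measurable_fun_pair (@measurable_id _ _ _) (measurable_cst (y : measurableTypeR R))))).
    by move=> x _; rewrite lee_fin.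
  apply: (@le_trans _ _ (1 * G y)%E); first by rewrite lee_wpmul2r.
  rewrite mul1e /G /I; apply: (IHN h' y (fun e => F [tuple of y :: e])) => //.
  - by move=> i; exact: mh.
  - by move=> i x z w; exact: h0.
  - by move=> i x z; exact: h1.
  - exact: (measurableT_comp mF (measurable_cons (measurable_cst y) (@measurable_id _ _ _))).
Qed.

Lemma ltr_path_nth (q : seq R) : path <%R 0 (rcons q 1) -> forall i j,
  (i < j <= (size q).+1)%N ->
  [/\ 0 <= nth 0 (0 :: rcons q 1) i, nth 0 (0 :: rcons q 1) i < nth 0 (0 :: rcons q 1) j
    & nth 0 (0 :: rcons q 1) j <= 1].
Proof.
move=> qP; set s := 0 :: rcons q 1.
have ss : size s = (size q).+2 by rewrite /= size_rcons.
have lt i j : (i < j)%N -> (j < size s)%N -> nth 0 s i < nth 0 s j.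
  by move=> ij js; apply: (sorted_ltn_nth lt_trans) => //; rewrite inE// (ltn_trans ij).
move=> i j /andP[ij jq]; split.
- case: i ij => [|i] ij //; apply/ltW/(lt 0%N) => //.
  by rewrite ss ltnS ltnW// (leq_trans ij).
- by apply: lt => //; rewrite ss ltnS.
- have -> : 1 = nth 0 s (size q).+1 by rewrite /= nth_rcons ltnn eqxx.
  move: jq; rewrite leq_eqVlt => /predU1P[->//|jq].
  by apply/ltW/lt => //; rewrite ss.
Qed.

Lemma big_odd_nat (f : nat -> R) M :
  \prod_(1 <= j < M.*2 | odd j) f j = \prod_(i < M) f i.*2.+1.
Proof.
elim: M => [|M IHM]; first by rewrite big_ord0 big_geq.
rewrite big_ord_recr /= -IHM doubleS; case: M {IHM} => [|M].
  by rewrite [LHS]big_mkcond/= big_nat1 [X in X * _]big_geq// mul1r.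
rewrite [LHS]big_mkcond big_nat_recr// big_nat_recr//= -big_mkcond.
by rewrite !odd_double/= mulr1.
Qed.

Section pyramid.
Variables (m0 : nat) (dens : nat -> nat -> R -> R -> R -> R).
Hypothesis qp : quantile_pyramid m0 dens.

(** The prior on plain sequences, so that the even part of a vector can be handed to the coarser
    level without any cast on lengths. *)
Definition prior_seq (m n : nat) (q : seq R) : R :=
  let Q l j := nth 0 (0 :: rcons q 1) (j * 2 ^ (m - l))%N in
  if path <%R 0 (rcons q 1) then
    \prod_(1 <= l < n.+1) \prod_(1 <= j < (2 ^ l)%N | odd j)
      dens l j (Q l j.-1) (Q l j.+1) (Q l j)
  else 0.

Let admissible (a b : R) := [&& 0 <= a, a < b & b <= 1].
(** The pyramid hypotheses only concern pairs 0 <= a < b <= 1 and valid indices. Extension by 0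
    makes positivity, measurability and the mass bound hold for all arguments. *)
Let h (l : nat) (i : nat) (a b x : R) : R :=
  if (i < 2 ^ l)%N && admissible a b then dens l.+1 i.*2.+1 a b x else 0.

Let odd_lt l i : (i < 2 ^ l)%N -> (i.*2.+1 < 2 ^ l.+1)%N.
Proof. by move=> il; rewrite expnS mul2n -doubleS leq_double. Qed.

Let qp_odd l i : (l < m0)%N -> (i < 2 ^ l)%N ->
  measurable_fun setT (fun z : R * R * R => dens l.+1 i.*2.+1 z.1.1 z.1.2 z.2) /\
  forall a b, 0 <= a -> a < b -> b <= 1 -> is_density a b (dens l.+1 i.*2.+1 a b).
Proof. by move=> lm il; apply: qp => //; [exact: odd_lt|rewrite /= odd_double]. Qed.

Let measurable_admissible : measurable_fun setT (fun z : R * R * R => admissible z.1.1 z.1.2).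
Proof.
have m1 : measurable_fun setT (fun z : R * R * R => z.1.1) by exact: measurableT_comp.
have m2 : measurable_fun setT (fun z : R * R * R => z.1.2) by exact: measurableT_comp.
apply: measurable_and; first exact: measurable_fun_ler.
by apply: measurable_and; [exact: measurable_fun_ltr|exact: measurable_fun_ler].
Qed.

Let mh l i : (l < m0)%N -> measurable_fun setT (fun z : R * R * R => h l i z.1.1 z.1.2 z.2).
Proof.
move=> lm; rewrite /h; case: ltnP => [il|_] /=; last exact: measurable_cst.
apply: measurable_fun_ifT => //.
by have [] := qp_odd lm il.
Qed.

Let h0 l i : (l < m0)%N -> forall a b x, 0 <= h l i a b x.
Proof.
move=> lm a b x; rewrite /h; case: ifPn => // /andP[il /and3P[a0 ab b1]].
by have [_ /(_ a b a0 ab b1)[]] := qp_odd lm il.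
Qed.

Let h1 l i : (l < m0)%N -> forall a b, (\int[leb]_x (h l i a b x)%:E <= 1)%E.
Proof.
move=> lm a b; rewrite /h.
have [/andP[il /and3P[a0 ab b1]]|_] := boolP ((i < 2 ^ l)%N && admissible a b).
  by have [_ /(_ a b a0 ab b1)[_ _ _ E]] := qp_odd lm il; rewrite [X in (X <= _)%E]E.
by rewrite integral0.
Qed.

Let path_even (q : seq R) N : size q = N.*2.+1 ->
  (forall j, nth 0 (0 :: rcons q 1) j.*2 = nth 0 (0 :: rcons (even_part N q) 1) j) /\
  (path <%R 0 (rcons q 1) -> path <%R 0 (rcons (even_part N q) 1)).
Proof.
move=> sq.
have nthE j : nth 0 (0 :: rcons q 1) j.*2 = nth 0 (0 :: rcons (even_part N q) 1) j.
  case: j => [//|j]; rewrite doubleS -[LHS]/(nth 0 (rcons q 1) j.*2.+1) -[RHS]/(nth 0 (rcons (even_part N q) 1) j).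
  rewrite !nth_rcons sq size_tuple.
  have [jN|Nj|->] := ltngtP j N.
  - have -> : (j.*2.+1 < N.*2.+1)%N by rewrite ltnS ltn_double.
    by rewrite -[RHS](tnth_nth 0 _ (Ordinal jN)) tnth_mktuple.
  - have -> : (j.*2.+1 < N.*2.+1)%N = false by rewrite ltnS ltn_double ltnNge ltnW.
    by rewrite eqSS (inj_eq double_inj) gtn_eqF.
  - by rewrite ltnn eqxx.
split=> // qP; apply/(pathP 0) => i; rewrite size_rcons size_tuple => iN.
rewrite -[X in _ < X]/(nth 0 (0 :: rcons (even_part N q) 1) i.+1) -!nthE.
have [|_ //] := ltr_path_nth qP (i := i.*2) (j := i.+1.*2).
by rewrite sq doubleS !ltnS leqnSn/= leq_double.
Qed.

Lemma prior_seq_ge0 m q : (m <= m0)%N -> size q = (2 ^ m).-1 -> 0 <= prior_seq m m q.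
Proof.
move=> mm sq; rewrite /prior_seq; case: ifPn => // qP.
rewrite big_nat; apply: prodr_ge0 => l /andP[l1 lm].
rewrite big_nat_cond; apply: prodr_ge0 => j /andP[/andP[j1 jl] oj].
have lm0 : (1 <= l <= m0)%N by rewrite l1 (leq_trans _ mm).
have [_ H] := qp lm0 jl oj.
have [|a0 ab b1] := ltr_path_nth qP (i := (j.-1 * 2 ^ (m - l))%N) (j := (j.+1 * 2 ^ (m - l))%N).
  rewrite ltn_pmul2r ?expn_gt0// prednK// leqnSn/= sq prednK ?expn_gt0//.
  rewrite -{2}(subnKC (n := m) (m := l)) // expnD leq_pmul2r ?expn_gt0//.
by have [] := H _ _ a0 ab b1.
Qed.

(** Q(j/2^l) sits at position j 2^(m+1-l) of the fine grid and j 2^(m-l) of its even part, so the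
    coarse levels factor out. Equality holds for increasing q; otherwise the left side is 0, while
    the even part may still be increasing. *)
Lemma prior_seq_le m N q : (m < m0)%N -> N.+1 = (2 ^ m)%N -> size q = N.*2.+1 ->
  prior_seq m.+1 m.+1 q <= prior_seq m m (even_part N q) * level_weight (h m) 0 N q.
Proof.
move=> mm NE sq; have [nthE pE] := path_even sq.
have pos : 0 <= prior_seq m m (even_part N q) * level_weight (h m) 0 N q.
  apply: mulr_ge0; last by apply: level_weight_ge0 => i x y z; exact: h0.
  by apply: prior_seq_ge0; [exact: ltnW|rewrite size_tuple -NE].
rewrite {1}/prior_seq; case: ifPn => // qP.
rewrite /prior_seq pE// big_nat_recr//= le_eqVlt; apply/orP; left; apply/eqP; congr (_ * _).
  rewrite !big_nat; apply: eq_bigr => l /andP[l1 lm].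
  apply: eq_bigr => j _.
  have E i : nth 0 (0 :: rcons q 1) (i * 2 ^ (m.+1 - l)) =
     nth 0 (0 :: rcons (even_part N q) 1) (i * 2 ^ (m - l)).
    by rewrite -nthE subSn// expnS mulnCA mul2n.
  by rewrite !E.
rewrite expnS mul2n -NE (big_odd_nat (fun j => dens m.+1 j _ _ _)) /level_weight.
apply: eq_bigr => i _; rewrite subnn expn0 !muln1 /h -NE ltn_ord/=.
have [|a0 ab b1] := ltr_path_nth qP (i := i.*2) (j := i.*2.+2).
  by rewrite leqnSn sq/= !ltnS leq_double -ltnS.
by rewrite /admissible a0 ab b1.
Qed.

Lemma measurable_prior_seq m n : (m <= m0)%N ->
  measurable_fun setT (fun q : n.-tuple R => prior_seq m m q).
Proof.
move=> mm.
have mn i : measurable_fun setT (fun q : n.-tuple R => nth 0 (0 :: rcons q 1) i).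
  case: i => [|i] /=; first exact: measurable_cst.
  have [ni|ni] := ltnP i n.
    rewrite (_ : (fun _ => _) = (fun q : n.-tuple R => nth 0 q i)); first exact: measurable_nth_tuple.
    by apply/funext => x; rewrite nth_rcons size_tuple ni.
  rewrite (_ : (fun _ => _) = cst (if i == n then 1 else 0)); first exact: measurable_cst.
  by apply/funext => x; rewrite nth_rcons size_tuple ltnNge ni.
apply: measurable_fun_ifT; last exact: measurable_cst.
- apply: (measurable_fun_bool true); rewrite setTI.
  rewrite (_ : _ @^-1` _ = \bigcap_(i in `I_n.+1)
    [set q : n.-tuple R | nth 0 (0 :: rcons q 1) i < nth 0 (rcons q 1) i]).
    apply: fin_bigcap_measurable => // i _.
    rewrite (_ : [set q | _] = (fun q : n.-tuple R => nth 0 (0 :: rcons q 1) i < nth 0 (rcons q 1) i) @^-1` [set true]).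
      rewrite -[X in measurable X]setTI; apply: measurable_fun_ltr => //.
      exact: (mn i.+1).
    by apply/seteqP; split => q.
  apply/seteqP; split => q /=.
    by move=> /(pathP 0) H i /= ni; apply: H; rewrite size_rcons size_tuple.
  by move=> H; apply/(pathP 0) => i; rewrite size_rcons size_tuple => ni; exact: H.
(* The side conditions move into the index lists, because measurability of a product is asked for
   each index that occurs in its list. *)
- rewrite (_ : (fun _ => _) = (fun q : n.-tuple R => \prod_(l <- index_iota 1 m.+1)
    (if (l <= m0)%N then \prod_(j <- [seq j <- index_iota 1 (2 ^ l) | odd j && (j < 2 ^ l)%N])
    dens l j (nth 0 (0 :: rcons q 1) (j.-1 * 2 ^ (m - l))) (nth 0 (0 :: rcons q 1) (j.+1 * 2 ^ (m - l)))
      (nth 0 (0 :: rcons q 1) (j * 2 ^ (m - l))) else 1))).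
    apply: measurable_prod => l; rewrite mem_index_iota => /andP[l1 lm].
    case: (boolP (l <= m0)%N) => lm0; last exact: measurable_cst.
    apply: measurable_prod => j; rewrite mem_filter => /andP[/andP[oj jl] _].
    have l1m : (1 <= l <= m0)%N by rewrite l1.
    have [md _] := qp l1m jl oj; exact: measurable_comp3.
  apply/funext => q; rewrite !big_nat; apply: eq_bigr => l /andP[l1 lm].
  have lm0 : (l <= m0)%N by apply: leq_trans mm; rewrite -ltnS.
  rewrite lm0 big_filter [LHS]big_seq_cond [RHS]big_seq_cond; apply: eq_bigl => j.
  by rewrite mem_index_iota; case: (j < 2 ^ l)%N; rewrite ?andbT ?andbF.
Qed.

(** Integrate out the finest level, then induct. The bound by 1 is all that the region far from the
    true quantiles requires. *)
Lemma integral_prior_seq_le1 m n : (m <= m0)%N -> n = (2 ^ m).-1 ->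
  (\int[lebesgue_tuple R n]_q (prior_seq m m q)%:E <= 1)%E.
Proof.
elim: m n => [|m IHm] n mm ->.
  rewrite ge0_integral_lebesgue_tuple0.
    by rewrite /prior_seq /= ltr01/= big_geq.
  by apply/measurable_EFinP; exact: measurable_prior_seq.
pose N := (2 ^ m).-1.
have NE : N.+1 = (2 ^ m)%N by rewrite prednK ?expn_gt0.
have -> : (2 ^ m.+1).-1 = N.*2.+1 by rewrite expnS mul2n -NE.
apply: le_trans (IHm N (ltnW mm) erefl).
have mF : measurable_fun setT (fun v : N.-tuple R => prior_seq m m v).
  exact: measurable_prior_seq (ltnW mm).
have F0 (v : N.-tuple R) : 0 <= prior_seq m m v.
  by apply: prior_seq_ge0; rewrite ?size_tuple// ltnW.
have mh' i := mh i mm.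
apply: le_trans (integral_level_weight_le 0 mh' (fun i => h0 i mm) (fun i => h1 i mm) mF F0).
apply: ge0_le_integral => //.
- by move=> q _; rewrite lee_fin prior_seq_ge0// size_tuple expnS mul2n -NE.
- by apply/measurable_EFinP; exact: measurable_prior_seq.
- apply/measurable_EFinP; apply: measurable_funM; last by apply: measurable_level_weight.
  by have H := measurableT_comp mF (@measurable_even_part N.*2.+1 N); exact: H.
- by move=> q _; rewrite lee_fin prior_seq_le// size_tuple.
Qed.

End pyramid.

Lemma pyramid_priorE m dens (q : (2 ^ m).-1.-tuple R) :
  pyramid_prior dens q = prior_seq dens m m q.
Proof. by []. Qed.

End pyramid_integral.

(** * Poisson ratios, empirical counts and the multinomial likelihood *)

Section poisson_ratio.
Context {R : realType}.

(* Up to factors that do not depend on N this is a Poisson weight with mean a,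
   normalized to be 1 at N = a. *)
Definition poisson_ratio (a N : nat) : R :=
  a`!%:R / N`!%:R * a%:R ^+ N / a%:R ^+ a.

Lemma poisson_ratio_id a : (0 < a)%N -> poisson_ratio a a = 1.
Proof.
move=> a0; rewrite /poisson_ratio divff ?mul1r ?divff//.
by rewrite expf_neq0// pnatr_eq0 -lt0n.
Qed.

Lemma poisson_ratioS a N : poisson_ratio a N.+1 = poisson_ratio a N * (a%:R / N.+1%:R).
Proof.
rewrite /poisson_ratio factS natrM exprS !invfM.
by move: (a`!%:R : R) (N`!%:R^-1 : R) (N.+1%:R^-1 : R) (a%:R ^+ a)^-1 => f g h i; ring.
Qed.

Lemma poisson_ratio_ge0 a N : 0 <= poisson_ratio a N.
Proof. by rewrite /poisson_ratio !(mulr_ge0, exprn_ge0, divr_ge0). Qed.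

Lemma tri_natrS (h : nat) : (h%:R * h.+1%:R / 2 + h.+1%:R = h.+1%:R * h.+2%:R / 2 :> R).
Proof. by rewrite -![in RHS]natr1 -![in LHS]natr1; field. Qed.

(** The step to a + i multiplies by a/(a+i) = 1 - i/(a+i) <= exp(-i/M), and 1 + ... + h =
    h(h+1)/2. *)
Lemma poisson_ratio_above_le a h (M : R) : (0 < a)%N -> (a + h)%:R <= M ->
  poisson_ratio a (a + h) <= expR (- (h%:R * h.+1%:R / 2 / M)).
Proof.
move=> a0; elim: h => [|h IHh] hM.
  by rewrite addn0 poisson_ratio_id// !mul0r oppr0 expR0.
have M0 : 0 < M by rewrite (lt_le_trans _ hM)// ltr0n addnS.
rewrite addnS poisson_ratioS.
rewrite -tri_natrS mulrDl opprD expRD; apply: ler_pM => //.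
- exact: poisson_ratio_ge0.
- by apply: IHh; rewrite (le_trans _ hM)// ler_nat addnS.
- have -> : a%:R / (a + h).+1%:R = 1 + - (h.+1%:R / (a + h).+1%:R) :> R.
    have s0 : 0 < a%:R + h.+1%:R :> R by rewrite -natrD ltr0n addnS.
    rewrite -addnS natrD; move: s0; move: (a%:R : R) (h.+1%:R : R) => u v s0.
    by field; rewrite gt_eqF.
  apply: le_trans (expR_ge1Dx _) _; rewrite ler_expR lerN2.
  by rewrite ler_wpM2l// lef_pV2 ?posrE// -addnS.
Qed.

(** Here a/(a+i) is the inverse of 1 + i/a <= exp(i/a). *)
Lemma poisson_ratio_above_ge a h : (0 < a)%N ->
  expR (- (h%:R * h.+1%:R / 2 / a%:R)) <= poisson_ratio a (a + h).
Proof.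
move=> a0; elim: h => [|h IHh].
  by rewrite addn0 poisson_ratio_id// !mul0r oppr0 expR0.
have aR : 0 < a%:R :> R by rewrite ltr0n.
rewrite addnS poisson_ratioS -tri_natrS mulrDl opprD expRD; apply: ler_pM => //.
- rewrite expRN -[leRHS]invrK lef_pV2 ?posrE ?expR_gt0 ?invr_gt0 ?divr_gt0//.
  apply: le_trans (expR_ge1Dx _).
  rewrite invf_div le_eqVlt; apply/orP; left; apply/eqP; rewrite -addnS natrD.
  by move: aR; move: (a%:R : R) (h.+1%:R : R) => u v u0; field; rewrite gt_eqF.
Qed.

Lemma poisson_ratio_belowE a b : (b < a)%N ->
  poisson_ratio a (a - b.+1) = poisson_ratio a (a - b) * (1 - b%:R / a%:R).
Proof.
move=> ba; have -> : (a - b = (a - b.+1).+1)%N by rewrite -subSn.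
rewrite poisson_ratioS -mulrA -[LHS]mulr1; congr (_ * _).
rewrite -subSn// subSS natrB 1?ltnW//.
have aR : 0 < a%:R :> R by rewrite ltr0n (leq_ltn_trans _ ba).
have abR : 0 < a%:R - b%:R :> R by rewrite subr_gt0 ltr_nat.
by field; rewrite !gt_eqF.
Qed.

Lemma tri_natr (b : nat) : (b%:R * (b%:R - 1) / 2 + b%:R = b.+1%:R * (b.+1%:R - 1) / 2 :> R).
Proof. by rewrite -![in RHS]natr1; field. Qed.

(** Downwards the factors are 1 - i/a for i < b, starting at i = 0; hence b(b-1)/2 instead of
    b(b+1)/2. *)
Lemma poisson_ratio_below_le a b (M : R) : (b <= a)%N -> (0 < a)%N -> a%:R <= M ->
  poisson_ratio a (a - b) <= expR (- (b%:R * (b%:R - 1) / 2 / M)).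
Proof.
move=> + a0 aM; elim: b => [|b IHb] ba.
  by rewrite subn0 poisson_ratio_id// !mul0r oppr0 expR0.
have aR : 0 < a%:R :> R by rewrite ltr0n.
rewrite poisson_ratio_belowE// -tri_natr mulrDl opprD expRD; apply: ler_pM => //.
- exact: poisson_ratio_ge0.
- by rewrite subr_ge0 ler_pdivrMr// mul1r ler_nat ltnW.
- exact: IHb (ltnW ba).
- apply: le_trans (expR_ge1Dx _) _; rewrite ler_expR lerN2.
  by rewrite ler_wpM2l// lef_pV2 ?posrE// (lt_le_trans aR).
Qed.

(** 1 - i/a is the inverse of 1 + i/(a-i), where a - i stays at least M. *)
Lemma poisson_ratio_below_ge a b (M : R) : (b < a)%N -> M <= (a - b)%:R -> 0 < M ->
  expR (- (b%:R * (b%:R - 1) / 2 / M)) <= poisson_ratio a (a - b).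
Proof.
move=> + + M0; elim: b => [|b IHb] ba Mab.
  by rewrite subn0 poisson_ratio_id// !mul0r oppr0 expR0.
have ab : (b < a)%N by exact: ltnW.
have aR : 0 < a%:R :> R by rewrite ltr0n (leq_ltn_trans _ ba).
have abR : 0 < a%:R - b%:R :> R by rewrite subr_gt0 ltr_nat.
have Mb : M <= (a - b)%:R by rewrite (le_trans Mab)// ler_nat leq_sub2l.
rewrite poisson_ratio_belowE// -tri_natr mulrDl opprD expRD; apply: ler_pM => //.
- exact: IHb.
- have d0 : 0 < 1 - b%:R / a%:R :> R by rewrite subr_gt0 ltr_pdivrMr// mul1r ltr_nat.
  rewrite expRN -[leRHS]invrK lef_pV2 ?posrE ?expR_gt0 ?invr_gt0//.
  apply: le_trans (expR_ge1Dx _).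
  apply: (@le_trans _ _ (1 + b%:R / (a - b)%:R)).
    by rewrite natrB 1?ltnW// le_eqVlt; apply/orP; left; apply/eqP; field; rewrite !gt_eqF.
  by rewrite lerD2l ler_wpM2l// lef_pV2 ?posrE// (lt_le_trans M0).
Qed.

(** With D = |N - a| the two sides yield D(D+1) and D(D-1); the smaller D^2 - D serves both. *)
Lemma poisson_ratio_le a N (M : R) : (0 < a)%N -> a%:R <= M -> N%:R <= M ->
  poisson_ratio a N <= expR (- (((N%:R - a%:R) ^+ 2 - `|N%:R - a%:R|) / (2 * M))).
Proof.
move=> a0 aM NM.
have M0 : 0 < M by rewrite (lt_le_trans _ aM)// ltr0n.
have [aN|Na] := leqP a N.
  have := poisson_ratio_above_le (h := (N - a)%N) (M := M) a0; rewrite subnKC// => /(_ NM).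
  move=> H; apply: le_trans H _; rewrite ler_expR lerN2 natrB//.
  have d0 : 0 <= N%:R - a%:R :> R by rewrite subr_ge0 ler_nat.
  rewrite (ger0_norm d0) -(natr1 (N - a)) natrB// -mulrA -invfM ler_wpM2r ?invr_ge0 ?mulr_ge0 ?(ltW M0)//.
  by nra.
have := poisson_ratio_below_le (leq_subr N a) a0 aM; rewrite subKn 1?ltnW//.
move=> H; apply: le_trans H _; rewrite ler_expR lerN2 natrB 1?ltnW//.
have d0 : N%:R - a%:R < 0 :> R by rewrite subr_lt0 ltr_nat.
rewrite (ltr0_norm d0) -mulrA -invfM ler_wpM2r ?invr_ge0 ?mulr_ge0 ?(ltW M0)//.
by nra.
Qed.

Lemma poisson_ratio_ge a N : (0 < a)%N -> `|N%:R - a%:R| < a%:R :> R ->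
  expR (- (((N%:R - a%:R) ^+ 2 + `|N%:R - a%:R|) / (2 * (a%:R - `|N%:R - a%:R|)))) <=
  poisson_ratio a N.
Proof.
move=> a0 dlt; have aR : 0 < a%:R :> R by rewrite ltr0n.
have D0 : 0 < a%:R - `|N%:R - a%:R| :> R by rewrite subr_gt0.
have [aN|Na] := leqP a N.
  have := poisson_ratio_above_ge (N - a) a0; rewrite subnKC//.
  apply: le_trans; rewrite ler_expR lerN2 -(natr1 (N - a)) natrB//.
  have d0 : 0 <= N%:R - a%:R :> R by rewrite subr_ge0 ler_nat.
  rewrite (ger0_norm d0) in dlt D0 *.
  rewrite -mulrA -invfM; apply: ler_pM.
  - by apply: mulr_ge0 => //; lra.
  - by rewrite invr_ge0 mulr_ge0.
  - by nra.
  - by rewrite lef_pV2 ?posrE ?mulr_gt0// ler_pM2l//; lra.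
have d0 : N%:R - a%:R < 0 :> R by rewrite subr_lt0 ltr_nat.
rewrite (ltr0_norm d0) opprB in dlt D0 *.
have N0 : (0 < N)%N by rewrite -(ltr_nat R); lra.
have aNa : (a - N < a)%N by rewrite ltn_subrL N0.
have := @poisson_ratio_below_ge a (a - N)%N N%:R aNa; rewrite subKn 1?ltnW//.
rewrite ltr0n N0 => /(_ (lexx _) isT).
apply: le_trans; rewrite ler_expR lerN2 natrB 1?ltnW//.
rewrite -mulrA -invfM (_ : a%:R - (a%:R - N%:R) = N%:R); last by ring.
by rewrite ler_wpM2r ?invr_ge0 ?mulr_ge0//; nra.
Qed.

(** Divide the numerator and denominator of both exponents by n: (N-a)^2/n tends to x^2, |N-a|/n to
    0 and a/n to 1/k, so the two bounds share their limit. *)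
Lemma cvg_poisson_ratio (a N : nat -> nat) (k x : R) : 0 < k ->
  (a n)%:R / n%:R @[n --> \oo] --> k^-1 ->
  ((N n)%:R - (a n)%:R) / Num.sqrt n%:R @[n --> \oo] --> x ->
  poisson_ratio (a n) (N n) @[n --> \oo] --> expR (- (k / 2 * x ^+ 2)).
Proof.
move=> k0 ca cx.
pose h n : R := (N n)%:R - (a n)%:R.
have n0 : \forall n \near \oo, (0 < n)%N by exists 1%N.
have csq : (Num.sqrt n%:R)^-1 @[n --> \oo] --> (0 : R).
  apply/cvgrPdist_lt => /= e e0; near=> n.
  have nn : 0 < n%:R :> R by rewrite ltr0n; near: n.
  rewrite sub0r normrN gtr0_norm ?invr_gt0 ?sqrtr_gt0// invf_plt ?posrE ?sqrtr_gt0//.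
  rewrite -(@ltr_pXn2r _ 2)// ?nnegrE ?invr_ge0 ?(ltW e0)//.
  rewrite sqr_sqrtr ?ltW//; near: n; exact: nbhs_infty_gtr.
have ch2 : (h n ^+ 2) / n%:R @[n --> \oo] --> x ^+ 2.
  rewrite expr2; apply: cvg_trans (cvgM cx cx); apply: near_eq_cvg; near=> n.
  by rewrite /= -/(h n) -expr2 exprMn exprVn sqr_sqrtr.
have ch1 : `|h n| / n%:R @[n --> \oo] --> (0 : R).
  rewrite -(mulr0 `|x|); apply: cvg_trans (cvgM (cvg_norm cx) csq); apply: near_eq_cvg; near=> n.
  rewrite /= -/(h n) normrM normfV [`|Num.sqrt _|]ger0_norm ?sqrtr_ge0// -mulrA -invfM -expr2 sqr_sqrtr//.
have kk : expR (- (k / 2 * x ^+ 2)) = expR (- ((x ^+ 2 - 0) / (2 * (k^-1 + 0)))).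
  by congr (expR (- _)); rewrite subr0 addr0; field; rewrite gt_eqF.
have kk' : expR (- (k / 2 * x ^+ 2)) = expR (- ((x ^+ 2 + 0) / (2 * (k^-1 - 0)))).
  by congr (expR (- _)); rewrite subr0 addr0; field; rewrite gt_eqF.
have kV : 0 < k^-1 by rewrite invr_gt0.
have cup : expR (- (((h n ^+ 2) / n%:R - `|h n| / n%:R) / (2 * ((a n)%:R / n%:R + `|h n| / n%:R))))
    @[n --> \oo] --> expR (- (k / 2 * x ^+ 2)).
  rewrite kk; apply: continuous_cvg; [exact: continuous_expR|apply: cvgN].
  apply: cvgM; first exact: cvgB.
  apply: cvgV; first by rewrite addr0 mulf_neq0// gt_eqF.
  by apply: cvgM; [exact: cvg_cst|exact: cvgD].
have clo : expR (- (((h n ^+ 2) / n%:R + `|h n| / n%:R) / (2 * ((a n)%:R / n%:R - `|h n| / n%:R))))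
    @[n --> \oo] --> expR (- (k / 2 * x ^+ 2)).
  rewrite kk'; apply: continuous_cvg; [exact: continuous_expR|apply: cvgN].
  apply: cvgM; first exact: cvgD.
  apply: cvgV; first by rewrite subr0 mulf_neq0// gt_eqF.
  by apply: cvgM; [exact: cvg_cst|exact: cvgB].
apply: squeeze_cvgr clo cup; near=> n.
have nn : 0 < n%:R :> R by rewrite ltr0n; near: n.
have ha : `|h n| / n%:R < (a n)%:R / n%:R.
  rewrite -subr_gt0; near: n; apply: (cvgr_gt _ (cvgB ca ch1)).
  by rewrite subr0.
have {}ha : `|h n| < (a n)%:R by move: ha; rewrite ltr_pM2r// invr_gt0.
have a0 : (0 < a n)%N by rewrite -(ltr0n R) (le_lt_trans _ ha).
have sc (u v : R) : u / n%:R / (2 * (v / n%:R)) = u / (2 * v).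
  by have [->|v0] := eqVneq v 0; [rewrite mul0r !mulr0 invr0 !mulr0|field; rewrite v0 gt_eqF].
rewrite -!mulrDl -!mulrBl !sc; apply/andP; split; first exact: poisson_ratio_ge.
apply: poisson_ratio_le => //; first by rewrite lerDl.
rewrite /h; have := ler_norm ((N n)%:R - (a n)%:R : R); set u := `|_| => H; lra.
Unshelve. all: by end_near. Qed.

End poisson_ratio.

Lemma excess_slack {R : realFieldType} (e s t : R) : 0 <= e * s -> 0 <= e * t ->
  e / 2 * s + e / 4 * (s + t) <= e * (s + t).
Proof. by lra. Qed.

(** Here A and B are the counts just left and right of the sample quantile, C the count at it and Y
    = n y. Both C and Y lie between A and B, which are close. *)
Lemma excess_at_quantile {R : realFieldType} (A B C Y f e s : R) :
  A <= C -> C <= B -> A < Y -> Y <= B -> `|B - A - 2 * f| <= e / 4 * (s + 2) ->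
  2 * f + e / 2 <= e / 4 * s -> `|C - Y| <= e / 2 * s.
Proof. by rewrite !ler_norml => AC CB AY YB /andP[? ?] ?; apply/andP; split; lra. Qed.

(** * Counts of a fixed sample: behaviour near a quantile, and factorisation of the likelihood *)

Section sample_counts.
Context {R : realType}.
Variable x : nat -> R.

Definition cnt (n : nat) (t : R) : nat := (\sum_(i < n) (x i <= t)%R)%N.

Lemma cnt_le n a b : a <= b -> (cnt n a <= cnt n b)%N.
Proof.
by move=> ab; apply: leq_sum => i _; case: (leP (x i) a) => // xa; rewrite (le_trans xa ab).
Qed.

Lemma cell_count_cnt n a b : a <= b -> (cell_count x n a b + cnt n a = cnt n b)%N.
Proof.
move=> ab; rewrite /cell_count /cnt -big_split/=; apply: eq_bigr => i _.
by case: (leP (x i) a) => // xa; rewrite ?addn0//= (le_trans xa ab).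
Qed.

Lemma cnt_size n t : (forall i, x i <= t) -> cnt n t = n.
Proof.
move=> xt; rewrite /cnt (eq_bigr (fun=> 1%N)) => [|i _]; last by rewrite xt.
by rewrite sum_nat_const card_ord muln1.
Qed.

Lemma cnt0 n t : (forall i, t < x i) -> cnt n t = 0%N.
Proof. by move=> xt; rewrite /cnt big1// => i _; rewrite leNgt xt. Qed.

Lemma near_sqrt_ge (A e : R) : 0 < e -> \forall n \near \oo, A <= e * Num.sqrt n%:R.
Proof.
move=> e0; near=> n.
have [A0|A0] := leP A 0; first by rewrite (le_trans A0)// mulr_ge0// ltW.
rewrite -ler_pdivrMl// -(@ler_pXn2r _ 2)// ?nnegrE ?mulr_ge0 ?invr_ge0 ?(ltW A0) ?(ltW e0)//.
by rewrite sqr_sqrtr//; near: n; exact: nbhs_infty_ger.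
Unshelve. all: by end_near. Qed.

Lemma natr_sqrt n : n%:R = Num.sqrt n%:R * Num.sqrt n%:R :> R.
Proof. by rewrite -expr2 sqr_sqrtr. Qed.

Lemma near_natr_ge (A e : R) : 0 < e -> \forall n \near \oo, A <= e * n%:R.
Proof.
move=> e0; near=> n; rewrite -ler_pdivrMl//.
by near: n; exact: nbhs_infty_ger.
Unshelve. all: by end_near. Qed.

Lemma near_sqrt_le (e : R) : 0 < e -> \forall n \near \oo, Num.sqrt n%:R <= e * n%:R.
Proof.
move=> e0; near=> n; rewrite [in leRHS]natr_sqrt mulrA ler_peMl//.
by near: n; exact: near_sqrt_ge.
Unshelve. all: by end_near. Qed.

Section local_quantile.
Variables (y q0 f : R).
Hypotheses (f0 : 0 < f).
Hypothesis lln : (cnt n q0)%:R / n%:R @[n --> \oo] --> y.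
(** Uniform control of the empirical increments near q0: sqrt n is the tolerance on intervals of
    length 1/sqrt n, and n(b - a) takes over on longer ones. *)
Hypothesis osc : forall eta, 0 < eta -> exists2 de, 0 < de &
  \forall n \near \oo, forall a b, q0 - de <= a -> a <= b -> b <= q0 + de ->
    `|(cnt n b)%:R - (cnt n a)%:R - n%:R * f * (b - a)| <= eta * (Num.sqrt n%:R + n%:R * (b - a)).

Let qs n := quantile_fun (ecdf x n) y.

Let S n := [set t | y <= ecdf x n t].

Let SE n t : (0 < n)%N -> S n t = (n%:R * y <= (cnt n t)%:R).
Proof.
by move=> n0; rewrite /S /= /ecdf ler_pdivlMr ?ltr0n// mulrC.
Qed.

(** Properties of the generalised inverse strictly on either side of it. At [qs n] itself neither
    inequality is claimed, so later estimates step aside by 1/n. *)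
Let bracket n a b : (0 < n)%N -> (cnt n a)%:R < n%:R * y -> n%:R * y <= (cnt n b)%:R ->
  [/\ a <= qs n, qs n <= b, forall t, t < qs n -> (cnt n t)%:R < n%:R * y &
      forall t, qs n < t -> n%:R * y <= (cnt n t)%:R].
Proof.
move=> n0 ca cb.
have Sb : S n b by rewrite SE.
have lbS : lbound (S n) a.
  move=> t; rewrite SE// => yt; rewrite leNgt; apply/negP => ta.
  have : (cnt n t)%:R <= (cnt n a)%:R :> R by rewrite ler_nat cnt_le// ltW.
  by lra.
have hS : has_inf (S n) by split; [exists b|exists a].
split.
- by apply: lb_le_inf => //; exists b.
- by apply: ge_inf => //; exists a.
- move=> t tq; rewrite ltNge; apply/negP => yt.
  have St : S n t by rewrite SE.
  have : qs n <= t by apply: ge_inf St; exists a.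
  by rewrite leNgt tq.
- move=> t qt; have [s Ss st] := inf_adherent (ltac:(rewrite subr_gt0; exact: qt) : 0 < t - qs n) hS.
  move: Ss; rewrite SE// => /le_trans; apply; rewrite ler_nat cnt_le//.
  by rewrite ltW// (lt_le_trans st)// /qs /quantile_fun addrC subrK.
Qed.

Let growth (d1 : R) : 0 < d1 -> exists d2 c : R, [/\ 0 < d2, d2 <= d1, 0 < c &
  \forall n \near \oo, n%:R * y + c * n%:R <= (cnt n (q0 + d2))%:R /\
    (cnt n (q0 - d2))%:R <= n%:R * y - c * n%:R].
Proof.
move=> d10; have f40 : 0 < f / 4 by rewrite divr_gt0.
have [d2 d20 H] := osc f40.
pose de := Num.min d1 d2.
have de0 : 0 < de by rewrite lt_min d10.
exists de, (f * de / 4); split => //; [by rewrite ge_min lexx|by rewrite divr_gt0// mulr_gt0|].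
near=> n.
have n0 : (0 < n)%N by near: n; exists 1%N.
have nR : 0 < n%:R :> R by rewrite ltr0n.
have L : `|y - (cnt n q0)%:R / n%:R| <= f * de / 8.
  by near: n; move/cvgrPdist_le : lln; apply; rewrite divr_gt0// mulr_gt0.
have {}L : `|(cnt n q0)%:R - n%:R * y| <= f * de / 8 * n%:R.
  rewrite -ler_pdivrMr// -[X in _ / X](gtr0_norm nR) -normfV -normrM.
  by rewrite mulrBl mulrAC divff ?gt_eqF// mul1r distrC.
have sq : Num.sqrt n%:R <= de * n%:R by near: n; exact: near_sqrt_le.
have Hn : forall a b, q0 - d2 <= a -> a <= b -> b <= q0 + d2 ->
    `|(cnt n b)%:R - (cnt n a)%:R - n%:R * f * (b - a)| <= f / 4 * (Num.sqrt n%:R + n%:R * (b - a)).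
  by near: n.
have dd2 : de <= d2 by rewrite ge_min lexx orbT.
have H1 := Hn q0 (q0 + de); have H2 := Hn (q0 - de) q0.
have {}H1 : `|(cnt n (q0 + de))%:R - (cnt n q0)%:R - n%:R * f * (q0 + de - q0)| <=
    f / 4 * (Num.sqrt n%:R + n%:R * (q0 + de - q0)).
  by apply: H1; rewrite ?lerBlDr ?lerDl ?lerD2l// ltW.
have {}H2 : `|(cnt n q0)%:R - (cnt n (q0 - de))%:R - n%:R * f * (q0 - (q0 - de))| <=
    f / 4 * (Num.sqrt n%:R + n%:R * (q0 - (q0 - de))).
  by apply: H2; rewrite ?lerD2l ?lerN2 ?lerBlDr ?lerDl// ltW.
have e1 : q0 + de - q0 = de by ring.
have e2 : q0 - (q0 - de) = de by ring.
rewrite e1 in H1; rewrite e2 in H2.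
have fsq : f * Num.sqrt n%:R <= f * (de * n%:R) by rewrite ler_pM2l.
have fdn : 0 < f * de * n%:R by rewrite !mulr_gt0.
move: L H1 H2; rewrite !ler_norml.
move: fsq fdn; move: (Num.sqrt n%:R) => r.
move: (cnt n q0)%:R (cnt n (q0 + de))%:R (cnt n (q0 - de))%:R => c0 c1 c2.
move=> fsq fdn /andP[L1 L2] /andP[A1 A2] /andP[B1 B2].
split; lra.
Unshelve. all: by end_near. Qed.

Lemma cvg_empirical_quantile : qs n @[n --> \oo] --> q0.
Proof.
apply/cvgrPdist_le => /= e e0.
have [d2 [c [d20 d2e c0 H]]] := growth e0.
near=> n.
have n0 : (0 < n)%N by near: n; exists 1%N.
have nR : 0 < c * n%:R :> R by rewrite mulr_gt0// ltr0n.
have [H1 H2] : n%:R * y + c * n%:R <= (cnt n (q0 + d2))%:R /\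
    (cnt n (q0 - d2))%:R <= n%:R * y - c * n%:R by near: n.
have [||A B _ _] := bracket n0 (a := q0 - d2) (b := q0 + d2); [lra|lra|].
by rewrite ler_norml; apply/andP; split; lra.
Unshelve. all: by end_near. Qed.

(** Counts are monotone, so the gap at q0 + d2 and q0 - d2 persists at all farther points. *)
Lemma cnt_far (d1 : R) : 0 < d1 -> exists2 c : R, 0 < c &
  \forall n \near \oo, forall q, d1 <= `|q - q0| -> c * n%:R <= `|(cnt n q)%:R - n%:R * y|.
Proof.
move=> d10; have [d2 [c [d20 d2e c0 H]]] := growth d10.
exists c => //; near=> n => q dq.
have [H1 H2] : n%:R * y + c * n%:R <= (cnt n (q0 + d2))%:R /\
    (cnt n (q0 - d2))%:R <= n%:R * y - c * n%:R by near: n.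
have [qq|qq] := leP q0 q.
  have : (cnt n (q0 + d2))%:R <= (cnt n q)%:R :> R.
    by rewrite ler_nat cnt_le//; rewrite ger0_norm ?subr_ge0// in dq; lra.
  by move=> H3; apply: le_trans (ler_norm _); lra.
have : (cnt n q)%:R <= (cnt n (q0 - d2))%:R :> R.
  by rewrite ler_nat cnt_le//; rewrite ltr0_norm ?subr_lt0// in dq; lra.
by move=> H3; rewrite -normrN; apply: le_trans (ler_norm _); lra.
Unshelve. all: by end_near. Qed.

(** The centre is the sample quantile, where the count misses n y by at most a small multiple of
    sqrt n; at q0 the hypothesis [lln] would leave an error o(n). *)
Lemma cnt_local (eta : R) : 0 < eta -> exists2 de, 0 < de &
  \forall n \near \oo, forall q, `|q - q0| <= de ->
    `|(cnt n q)%:R - n%:R * y - n%:R * f * (q - qs n)| <=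
      eta * (Num.sqrt n%:R + n%:R * `|q - qs n|).
Proof.
move=> eta0; have eta20 : 0 < eta / 4 by rewrite divr_gt0.
have [de de0 H] := osc eta20.
exists de => //.
have de2 : 0 < de / 2 by rewrite divr_gt0.
have [d2 [c [d20 d2e c0 G]]] := growth de2.
near=> n => q dq.
have n0 : (0 < n)%N by near: n; exists 1%N.
have nR : 0 < n%:R :> R by rewrite ltr0n.
have cn : 0 < c * n%:R by rewrite mulr_gt0.
have [H1 H2] : n%:R * y + c * n%:R <= (cnt n (q0 + d2))%:R /\
    (cnt n (q0 - d2))%:R <= n%:R * y - c * n%:R by near: n.
have [||A B lo hi] := bracket n0 (a := q0 - d2) (b := q0 + d2); [lra|lra|].
have Hn : forall a b, q0 - de <= a -> a <= b -> b <= q0 + de ->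
    `|(cnt n b)%:R - (cnt n a)%:R - n%:R * f * (b - a)| <= eta / 4 * (Num.sqrt n%:R + n%:R * (b - a)).
  by near: n.
(* On the window of half-width 1/n around the sample quantile the main term is only 2 f, so the
   count increases by little more than the tolerance eta/4 sqrt n. *)
have nV : n%:R^-1 <= de / 2.
  rewrite invf_ple ?posrE// -[leRHS]mul1r; near: n; apply: near_natr_ge; exact: ltr01.
have nV0 : 0 < n%:R^-1 :> R by rewrite invr_gt0.
have big : 2 * f + eta / 2 <= eta / 4 * Num.sqrt n%:R by near: n; exact: near_sqrt_ge.
have A1 : q0 - de <= qs n - n%:R^-1.
  apply: le_trans (lerB A nV).
  by rewrite -addrA lerD2l -opprD lerN2 (le_trans (lerD d2e (lexx _)))// -splitr.
have B1 : qs n + n%:R^-1 <= q0 + de.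
  apply: (le_trans (lerD B nV)).
  by rewrite -addrA lerD2l (le_trans (lerD d2e (lexx _)))// -splitr.
have v1 : qs n - n%:R^-1 < qs n by rewrite ltrBlDr ltrDl.
have v2 : qs n < qs n + n%:R^-1 by rewrite ltrDl.
have E := Hn _ _ A1 (ltW (lt_trans v1 v2)) B1.
have wE : qs n + n%:R^-1 - (qs n - n%:R^-1) = 2 * n%:R^-1 by ring.
rewrite wE in E.
have n2 : n%:R * (2 * n%:R^-1) = 2 :> R by rewrite mulrCA divff ?mulr1// gt_eqF.
have n2f : n%:R * f * (2 * n%:R^-1) = 2 * f :> R by rewrite mulrAC n2.
rewrite n2 n2f in E.
have m1 : (cnt n (qs n - n%:R^-1))%:R <= (cnt n (qs n))%:R :> R.
  by rewrite ler_nat cnt_le// ltW.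
have m2 : (cnt n (qs n))%:R <= (cnt n (qs n + n%:R^-1))%:R :> R.
  by rewrite ler_nat cnt_le// ltW.
have D := excess_at_quantile m1 m2 (lo _ v1) (hi _ v2) E big.
rewrite ler_norml lerBrDr lerBlDr ![_ + q0]addrC in dq; move/andP : dq => [dq1 dq2].
have qq1 : q0 - de <= qs n by rewrite (le_trans A1)// ltW.
have qq2 : qs n <= q0 + de by rewrite (le_trans _ B1)// ltW.
have F : `|(cnt n q)%:R - (cnt n (qs n))%:R - n%:R * f * (q - qs n)| <=
    eta / 4 * (Num.sqrt n%:R + n%:R * `|q - qs n|).
  have [qq|qq] := leP (qs n) q; first by rewrite [`|q - _|]ger0_norm ?subr_ge0//; exact: Hn.
  have -> : (cnt n q)%:R - (cnt n (qs n))%:R - n%:R * f * (q - qs n) =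
      - ((cnt n (qs n))%:R - (cnt n q)%:R - n%:R * f * (qs n - q)) by ring.
  by rewrite normrN [`|q - _|]distrC [`|qs n - _|]ger0_norm ?subr_ge0 ?(ltW qq)//; apply: Hn; rewrite ?(ltW qq).
have -> : (cnt n q)%:R - n%:R * y - n%:R * f * (q - qs n) = ((cnt n (qs n))%:R - n%:R * y) +
    ((cnt n q)%:R - (cnt n (qs n))%:R - n%:R * f * (q - qs n)) by ring.
apply: (le_trans (ler_normD _ _)); apply: (le_trans (lerD D F)).
have t0 : 0 <= eta * (n%:R * `|q - qs n|) by rewrite !mulr_ge0 ?(ltW eta0).
have s0 : 0 <= eta * Num.sqrt n%:R by rewrite mulr_ge0 ?(ltW eta0).
exact: excess_slack.
Unshelve. all: by end_near. Qed.

End local_quantile.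

Section likelihood.
Variables (k : nat) (q : k.-1.-tuple R).
Hypothesis k0 : (0 < k)%N.
Hypothesis x01 : forall i, 0 < x i <= 1.
Hypothesis qP : path <%R 0 (rcons q 1).

Lemma qtl_le j : (j < k)%N -> qtl q j <= qtl q j.+1.
Proof.
move=> jk; apply/ltW; move/(pathP 0) : qP; apply.
by rewrite size_rcons size_tuple prednK.
Qed.

Lemma qtl_last : qtl q k = 1.
Proof.
rewrite /qtl; case: k k0 q => // k' _ q'.
by rewrite /= nth_rcons size_tuple ltnn eqxx.
Qed.

(** The sum telescopes. The sample lies in ]0, 1], so no point is lost at the open end 0. *)
Lemma sum_cell_count n : (\sum_(1 <= j < k.+1) cell_count x n (qtl q j.-1) (qtl q j) = n)%N.
Proof.
have E m : (m <= k)%N ->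
    (\sum_(1 <= j < m.+1) cell_count x n (qtl q j.-1) (qtl q j) = cnt n (qtl q m))%N.
  elim: m => [_|m IHm mk].
    rewrite big_geq//; apply/esym/cnt0 => i.
    by have /andP[] := x01 i.
  rewrite big_nat_recr//= IHm 1?ltnW// addnC cell_count_cnt//.
  exact: qtl_le.
by rewrite E// qtl_last cnt_size// => i; have /andP[] := x01 i.
Qed.

(** This is kappa_n: what remains once each 1/N_j! is replaced by the Poisson ratio. The powers
    a^(N_j) combine to a^n because the cells exhaust the sample, so it is free of q. *)
Definition likelihood_const (n a : nat) : R :=
  n`!%:R * k%:R^-1 ^+ n * (a%:R ^+ a / a`!%:R) ^+ k / a%:R ^+ n.

Lemma likelihood_const_gt0 n a : (0 < a)%N -> 0 < likelihood_const n a.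
Proof.
move=> a0; rewrite /likelihood_const !(mulr_gt0, divr_gt0, exprn_gt0, invr_gt0) ?ltr0n ?fact_gt0//.
Qed.

Lemma multinomial_likelihoodE n a : (0 < a)%N ->
  multinomial_likelihood x n q = likelihood_const n a *
    \prod_(1 <= j < k.+1) poisson_ratio a (cell_count x n (qtl q j.-1) (qtl q j)).
Proof.
move=> a0; have aR : 0 < a%:R :> R by rewrite ltr0n.
have fR : 0 < a`!%:R :> R by rewrite ltr0n fact_gt0.
rewrite /multinomial_likelihood.
under [X in _ = _ * X]eq_bigr do rewrite /poisson_ratio.
rewrite !big_split/= !prodr_const_nat subn1 /= -expr_sum sum_cell_count prodfV.
rewrite /likelihood_const.
set p := \prod_(1 <= j < k.+1) _.
rewrite !expr_div_n !exprVn.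
have u0 : (a%:R ^+ a) ^+ k != 0 :> R by rewrite !expf_neq0// gt_eqF.
have v0 : a`!%:R ^+ k != 0 :> R by rewrite expf_neq0// gt_eqF.
have w0 : a%:R ^+ n != 0 :> R by rewrite expf_neq0// gt_eqF.
have kn0 : k%:R ^+ n != 0 :> R by rewrite expf_neq0// pnatr_eq0 -lt0n.
have : p != 0.
  by rewrite gt_eqF// prodr_gt0// => j _; rewrite ltr0n fact_gt0.
move: u0 v0 w0; move: (_ ^+ k) => u; move: (_ ^+ k) => v; move: (a%:R ^+ n) => w u0 v0 w0 p0.
by move: (k%:R ^+ n) kn0 => z z0; field; rewrite ?u0 ?v0 ?w0 ?p0 ?z0.
Qed.

End likelihood.

End sample_counts.

(** * Almost sure behaviour of the empirical counts *)

Section chernoff_bounds.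
Context {R : realType} d (T : measurableType d) (P : probability T R).
Variable X : nat -> {RV P >-> R}.
Hypothesis indX : mutually_independent X.

Section fixed_event.
Variables (A : set R) (p : R).
Hypothesis mA : measurable A.
Hypothesis pA : forall i, P (X i @^-1` A) = p%:E.

Let I (i : nat) (w : T) : R := \1_A (X i w).

Let mI i : measurable_fun setT (I i).
Proof. by apply: measurableT_comp => //; exact: measurable_indic. Qed.

Let I01 i w : I i w = 0 \/ I i w = 1.
Proof. by rewrite /I indicE; case: (_ \in _); [right|left]. Qed.

Let PT : P setT = 1%E. Proof. exact: probability_setT. Qed.

Let p0 : 0 <= p. Proof. by rewrite -lee_fin -(pA 0%N). Qed.

Let integral_prod_indic (s : seq nat) : uniq s ->
  (\int[P]_w (\prod_(i <- s) I i w)%:E = (p ^+ size s)%:E)%E.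
Proof.
move=> us.
have mc : measurable (\bigcap_(i in [set` s]) (X i @^-1` A)).
  apply: fin_bigcap_measurable; first exact: finite_seq.
  by move=> i _; rewrite -[X in measurable X]setTI; exact: measurable_funP.
transitivity (\int[P]_w (\1_(\bigcap_(i in [set` s]) (X i @^-1` A)) w)%:E)%E.
  apply: eq_integral => w _; congr EFin; rewrite indicE.
  have [/set_mem wA|wA] := boolP (w \in _).
    rewrite big_seq big1// => i si; rewrite /I indicE mem_set//.
    exact: wA.
  have [i si wi] : exists2 i, i \in s & ~ A (X i w).
    apply: contrapT => H; move: wA; rewrite notin_setE; apply => i /= si.
    by apply: contrapT => nA; apply: H; exists i.
  by rewrite (big_rem i)//= /I indicE memNset// mul0r.
rewrite integral_indic// setIT.
transitivity (\prod_(i <- s) P (X i @^-1` A))%E; first exact: (indX us (fun=> mA)).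
under eq_bigr do rewrite pA.
rewrite prodEFin; congr EFin; elim: (s) => [|i r IHr]; first by rewrite big_nil.
by rewrite big_cons IHr -exprS.
Qed.

Let prod_bound (s r : seq nat) (u : R) w :
  `|\prod_(i <- s) I i w * \prod_(i <- r) (1 + u * I i w)| <= (1 + `|u|) ^+ size r.
Proof.
have u1 : 1 <= 1 + `|u| by rewrite lerDl.
rewrite normrM -[leRHS]mul1r ler_pM//.
  rewrite normr_prod; elim: s => [|i s IHs]; first by rewrite big_nil.
  have ? : 0 <= \prod_(j <- s) `|I j w| by apply: prodr_ge0.
  rewrite big_cons -[leRHS]mul1r ler_pM//.
  by case: (I01 i w) => ->; rewrite ?normr0 ?normr1.
rewrite normr_prod; elim: r => [|i r IHr]; first by rewrite big_nil.
have ? : 0 <= \prod_(j <- r) `|1 + u * I j w| by apply: prodr_ge0.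
rewrite big_cons exprS ler_pM//.
rewrite (le_trans (ler_normD _ _))// normr1 lerD2l normrM ler_piMr//.
by case: (I01 i w) => ->; rewrite ?normr0 ?normr1.
Qed.

Let mprod (s r : seq nat) (u : R) :
  measurable_fun setT (fun w => \prod_(i <- s) I i w * \prod_(i <- r) (1 + u * I i w)).
Proof.
apply: measurable_funM; apply: measurable_prod => i _ //.
by apply: measurable_funD => //; exact: measurable_funM.
Qed.

Let iprod (s r : seq nat) (u : R) : P.-integrable setT
  (fun w => (\prod_(i <- s) I i w * \prod_(i <- r) (1 + u * I i w))%:E).
Proof.
apply: (@integrable_bounded R _ _ _ _ ((1 + `|u|) ^+ size r)) => [||w]; last exact: prod_bound.
- by apply: (le_lt_trans _ (ltry 1)); rewrite le_eqVlt; apply/orP; left; apply/eqP; exact: PT.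
- exact: mprod.
Qed.

(** Each factor 1 + u I_i is expanded in turn: the term u I_i moves the index from [r] to [s].
    Independence of the events thus suffices, without a product rule for expectations. *)
Let integral_mgf (s r : seq nat) (u : R) : uniq (s ++ r) ->
  (\int[P]_w (\prod_(i <- s) I i w * \prod_(i <- r) (1 + u * I i w))%:E =
   (p ^+ size s * (1 + u * p) ^+ size r)%:E)%E.
Proof.
elim: r s => [|i r IHr] s.
  rewrite cats0 => us; rewrite mulr1 -integral_prod_indic//.
  by apply: eq_integral => w _; rewrite big_nil mulr1.
move=> us.
have us' : uniq (s ++ r) by apply: subseq_uniq us; rewrite cat_subseq// subseq_cons.
have us'' : uniq ((i :: s) ++ r).
  by move: us; rewrite -cat1s uniq_catCA.
have E w : (\prod_(j <- s) I j w * \prod_(j <- i :: r) (1 + u * I j w))%:E =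
   ((\prod_(j <- s) I j w * \prod_(j <- r) (1 + u * I j w))%:E +
    u%:E * (\prod_(j <- i :: s) I j w * \prod_(j <- r) (1 + u * I j w))%:E)%E.
  by rewrite -EFinM -EFinD !big_cons; congr EFin; ring.
under eq_integral do rewrite E.
have i1 := iprod s r u; have i2 := iprod (i :: s) r u.
rewrite integralD//; last exact: integrableZl.
rewrite integralZl//.
rewrite (IHr _ us') (IHr _ us'') -EFinM -EFinD; congr EFin.
by rewrite /= !exprS; ring.
Qed.

Let S n (w : T) : R := \sum_(i < n) I i w.

Lemma measurable_indic_sum n : measurable_fun setT (S n).
Proof. by apply: measurable_sum => i. Qed.

(** Markov's inequality for exp(s S), using exp(s I) = 1 + (exp s - 1) I for an indicator, then 1 +
    u <= exp u. The sign of s is free, so both tails are covered. *)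
Lemma chernoff_indic_sum n (s m : R) :
  (P [set w | (s * n%:R * p + m <= s * S n w)%R] <=
   (expR (n%:R * p * (expR s - 1 - s) - m))%:E)%E.
Proof.
have mE : measurable [set w | s * n%:R * p + m <= s * S n w].
  rewrite (_ : [set w | _] = (fun w => s * n%:R * p + m <= s * S n w) @^-1` [set true]); last first.
    by apply/seteqP; split.
  rewrite -[X in measurable X]setTI; apply: measurable_fun_ler => //.
  by apply: measurable_funM => //; exact: measurable_indic_sum.
set E := [set w | _] in mE *.
have expE w : expR (s * S n w) = \prod_(i <- index_iota 0 n) (1 + (expR s - 1) * I i w).
  rewrite /S mulr_sumr expR_sum big_mkord; apply: eq_bigr => i _.
  by case: (I01 i w) => ->; rewrite ?mulr0 ?expR0 ?addr0// !mulr1 addrC subrK.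
have intE : (\int[P]_w (expR (s * S n w))%:E = ((1 + (expR s - 1) * p) ^+ n)%:E)%E.
  have := @integral_mgf [::] (index_iota 0 n) (expR s - 1) (iota_uniq _ _).
  rewrite size_iota subn0 mul1r => <-.
  by apply: eq_integral => w _; rewrite big_nil mul1r expE.
have mexp : measurable_fun setT (fun w => expR (s * S n w)).
  apply: (measurableT_comp (@measurable_expR R)).
  by apply: measurable_funM => //; exact: measurable_indic_sum.
have H : ((expR (s * n%:R * p + m))%:E * P E <= ((1 + (expR s - 1) * p) ^+ n)%:E)%E.
  have intI : (\int[P]_w (\1_E w)%:E = P E)%E by rewrite integral_indic// setIT.
  have mIE : measurable_fun setT (fun w => (\1_E w : R)%:E).
    by apply/measurable_EFinP; exact: measurable_indic.
  have IE0 w : setT w -> (0 <= (\1_E w : R)%:E)%E by rewrite lee_fin.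
  rewrite -intE -intI -ge0_integralZl ?lee_fin ?expR_ge0//.
  apply: ge0_le_integral => //.
  - exact: measurable_funeM.
  - exact/measurable_EFinP.
  - move=> w _; rewrite -EFinM lee_fin indicE.
    have [/set_mem wE|_] := boolP (w \in E); last by rewrite mulr0 expR_ge0.
    by rewrite mulr1 ler_expR.
have Pfin : P E \is a fin_num by exact: fin_num_measure.
rewrite -(fineK Pfin) -EFinM !lee_fin in H *.
apply: (@le_trans _ _ (expR (- (s * n%:R * p + m)) * (1 + (expR s - 1) * p) ^+ n)).
  by rewrite expRN ler_pdivlMl ?expR_gt0.
apply: (@le_trans _ _ (expR (- (s * n%:R * p + m)) * (expR ((expR s - 1) * p)) ^+ n)).
  rewrite ler_wpM2l ?expR_ge0// lerXn2r ?nnegrE ?expR_ge0 ?expR_ge1Dx//.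
  have p1 : p <= 1 by rewrite -lee_fin -(pA 0%N) probability_le1// -[X in measurable X]setTI; exact: measurable_funP.
  by have := mulr_ge0 (expR_ge0 s) p0; have := p0; lra.
rewrite -expRM_natl -expRD ler_expR le_eqVlt; apply/orP; left; apply/eqP; ring.
Qed.

(** exp s <= 1/(1 - s) = 1 + s + s^2/(1 - s), where 1 - s >= 1/2. *)
Lemma expR_le_quadratic (s : R) : s <= 2^-1 -> expR s - 1 - s <= 2 * s ^+ 2.
Proof.
move=> s2; have d0 : 0 < 1 - s by lra.
have : expR s <= (1 - s)^-1.
  rewrite -[leLHS]invrK lef_pV2 ?posrE ?invr_gt0 ?expR_gt0// -expRN.
  exact: expR_ge1Dx.
have E : (1 - s)^-1 = 1 + s + s ^+ 2 / (1 - s) by field; rewrite gt_eqF.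
rewrite E => H.
have : s ^+ 2 / (1 - s) <= s ^+ 2 * 2.
  by rewrite ler_wpM2l ?sqr_ge0// invf_ple ?posrE//; lra.
lra.
Qed.

Lemma indic_sum_deviation n (s l : R) : 0 <= s <= 2^-1 ->
  (P [set w | (l <= `|S n w - n%:R * p|)%R] <=
   (2 * expR (n%:R * p * (2 * s ^+ 2) - s * l))%:E)%E.
Proof.
move=> /andP[s0 s2].
have mS := measurable_indic_sum n.
have mev t : measurable [set w | t * n%:R * p + s * l <= t * S n w].
  rewrite (_ : [set w | _] = (fun w => t * n%:R * p + s * l <= t * S n w) @^-1` [set true]); last first.
    by apply/seteqP; split.
  by rewrite -[X in measurable X]setTI; apply: measurable_fun_ler => //; exact: measurable_funM.
have np0 : 0 <= n%:R * p by rewrite mulr_ge0.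
have B t : t <= 2^-1 -> t ^+ 2 = s ^+ 2 ->
    (P [set w | (t * n%:R * p + s * l <= t * S n w)%R] <=
     (expR (n%:R * p * (2 * s ^+ 2) - s * l))%:E)%E.
  move=> t2 ts; apply: le_trans (chernoff_indic_sum _ _ _) _.
  rewrite lee_fin ler_expR lerD2r ler_wpM2l// -ts; exact: expR_le_quadratic.
apply: (@le_trans _ _ (P ([set w | s * n%:R * p + s * l <= s * S n w] `|`
   [set w | - s * n%:R * p + s * l <= - s * S n w]))).
  apply: le_measure; rewrite ?inE//.
  - rewrite (_ : [set w | _] = (fun w => l <= `|S n w - n%:R * p|) @^-1` [set true]); last first.
      by apply/seteqP; split.
    rewrite -[X in measurable X]setTI; apply: measurable_fun_ler => //.
    by apply: measurableT_comp => //; exact: measurable_funB.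
  - exact: measurableU.
  move=> w /=; rewrite leNgt => lw.
  have [H|H] := leP (n%:R * p) (S n w).
    left; rewrite -mulrA -mulrDr ler_wpM2l//.
    by move: lw; rewrite -leNgt ger0_norm ?subr_ge0//; lra.
  right; have lS : l <= n%:R * p - S n w.
    by move: lw; rewrite -leNgt ltr0_norm ?subr_lt0//; lra.
  by have := ler_wpM2l s0 lS; rewrite !mulNr -mulrA mulrBr; lra.
apply: (le_trans (measureU2 _ _ _)) => //.
rewrite mulr_natl mulr2n EFinD leeD//; apply: B => //.
- by lra.
- by rewrite sqrrN.
Qed.

End fixed_event.
End chernoff_bounds.

(** * Borel-Cantelli for events of probability O(1/n^2) *)

Section borel_cantelli_square.
Context {R : realType} d (T : measurableType d) (P : probability T R).

Lemma sum_inv_sqr_le n : \sum_(0 <= i < n.+1) (i.+1%:R ^+ 2)^-1 <= 2 - (n.+1%:R)^-1 :> R.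
Proof.
elim: n => [|n IHn]; first by rewrite big_nat1 expr1n invr1; lra.
rewrite big_nat_recr//=; apply: le_trans (lerD IHn (lexx _)) _.
have n1 : 0 < n.+1%:R :> R by [].
have -> : n.+2%:R = n.+1%:R + 1 :> R by rewrite -natr1.
move: (n.+1%:R : R) n1 => a a0.
have E : a^-1 - (a + 1)^-1 - ((a + 1) ^+ 2)^-1 = (a * (a + 1) ^+ 2)^-1.
  by field; rewrite !gt_eqF//; lra.
have : 0 <= (a * (a + 1) ^+ 2)^-1 by rewrite invr_ge0 mulr_ge0 ?sqr_ge0 ?ltW.
rewrite -E; move: (a^-1) ((a + 1)^-1) (((a + 1) ^+ 2)^-1) => p q r; lra.
Qed.

Lemma ae_near_not_of_le (F : nat -> set T) (K : R) : 0 <= K ->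
  (forall n, measurable (F n)) ->
  (\forall n \near \oo, (P (F n) <= (K / n.+1%:R ^+ 2)%:E)%E) ->
  {ae P, forall w, \forall n \near \oo, ~ F n w}.
Proof.
move=> K0 mF [N _ FN].
(* The events before the rank N, where no bound is known, are emptied; the limit superior does not
   change. *)
pose G n := if (n < N)%N then set0 else F n.
have mG n : measurable (G n) by rewrite /G; case: ifP.
have PG n : (P (G n) <= (K / n.+1%:R ^+ 2)%:E)%E.
  rewrite /G; case: ifPn => nN; first by rewrite measure0 lee_fin divr_ge0.
  by apply: FN; rewrite /= leqNgt.
have sumG : (\sum_(n <oo) P (G n) < +oo)%E.
  apply: (@le_lt_trans _ _ (K * 2)%:E); last by rewrite ltry.
  apply: lime_le; first by apply: is_cvg_nneseries => *; exact: measure_ge0.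
  apply: nearW => n; apply: (@le_trans _ _ (\sum_(0 <= i < n) (K / i.+1%:R ^+ 2)%:E)%E).
    by apply: lee_sum => i _; exact: PG.
  rewrite sumEFin lee_fin -mulr_sumr ler_wpM2l//.
  apply: (@le_trans _ _ (\sum_(0 <= i < n.+1) (i.+1%:R ^+ 2)^-1)).
    by rewrite [leRHS]big_nat_recr//= lerDl invr_ge0 sqr_ge0.
  by apply: le_trans (sum_inv_sqr_le n) _; rewrite gerBl.
exists (lim_sup_set G); split; [|exact: lim_sup_set_cvg0|].
  by apply: bigcap_measurable => // i _; apply: bigcup_measurable.
move=> w /= Fw i _ /=; apply: contrapT => H; apply: Fw.
exists (maxn i N) => // n /=; rewrite geq_max => /andP[ni nN] Fn.
by apply: H; exists n => //=; rewrite /G ltnNge nN.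
Qed.

(** exp z >= z^6/6! at z = c sqrt(n+1) gives a decay of order (n+1)^(-3), one power of which pays
    for the factor n + 1. *)
Lemma expR_sqrt_le (c : R) : 0 < c -> exists2 K : R, 0 <= K & forall n : nat,
  n.+1%:R * expR (- (c * Num.sqrt n%:R)) <= K / n.+1%:R ^+ 2.
Proof.
move=> c0; pose N : R := (6`!)%:R.
have N0 : 0 < N by rewrite /N ltr0n fact_gt0.
have Nexp z : 0 <= z -> z ^+ 6 / N <= expR z.
  by move=> z0; have := @expR_ge1Dxn R z 5 z0; rewrite -/N; move: (_ / N) => t; lra.
move: N N0 Nexp => N N0 Nexp; exists (expR c * (N / c ^+ 6)) => [|n].
  by rewrite mulr_ge0 ?expR_ge0// divr_ge0 ?exprn_ge0// ?(ltW c0) ?(ltW N0).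
set y : R := Num.sqrt n.+1%:R.
have y0 : 0 < y by rewrite sqrtr_gt0.
have n1 : n.+1%:R = y ^+ 2 by rewrite sqr_sqrtr.
have ys : y <= Num.sqrt n%:R + 1.
  rewrite -(@ler_pXn2r _ 2)// ?nnegrE ?addr_ge0 ?sqrtr_ge0 ?(ltW y0)//.
  rewrite -n1 sqrrD expr1n mulr1 sqr_sqrtr// -natr1.
  by have := sqrtr_ge0 (n%:R : R); lra.
have e1 : expR (- (c * Num.sqrt n%:R)) <= expR c * expR (- (c * y)).
  rewrite -expRD ler_expR; have := ler_wpM2l (ltW c0) ys; lra.
have e2 : expR (- (c * y)) <= N / (c * y) ^+ 6.
  rewrite expRN -[leRHS]invrK lef_pV2 ?posrE ?expR_gt0 ?invr_gt0 ?divr_gt0 ?exprn_gt0 ?mulr_gt0//.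
  by rewrite invf_div Nexp// mulr_ge0// ltW.
rewrite n1.
apply: (@le_trans _ _ (y ^+ 2 * (expR c * (N / (c * y) ^+ 6)))).
  by rewrite ler_wpM2l ?sqr_ge0// (le_trans e1)// ler_wpM2l ?expR_ge0.
rewrite le_eqVlt; apply/orP; left; apply/eqP; move: (expR c) => u.
by field; rewrite !gt_eqF.
Qed.

End borel_cantelli_square.

(* Monotone counts that follow n f (b - a) on the cells of a grid of mesh w
   follow it on all intervals, up to two cells at each end. *)
Lemma grid_oscillation {R : realType} (c : R -> R) (g w u v : R) (M : nat) :
  {homo c : a b / a <= b} -> 0 < w -> 0 <= u ->
  (forall l, (l < M)%N -> u <= c (g + l.+1%:R * w) - c (g + l%:R * w) <= v) ->
  forall a b, g <= a -> a <= b -> b < g + M%:R * w ->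
  u * ((b - a) / w - 2) <= c b - c a <= v * ((b - a) / w + 2).
Proof.
move=> cmono w0 u0 cell a b ga ab bM.
pose l t := Num.trunc ((t - g) / w).
have lP t : g <= t -> g + (l t)%:R * w <= t < g + (l t).+1%:R * w.
  move=> gt; have := @trunc_itv _ ((t - g) / w).
  rewrite divr_ge0 ?subr_ge0 ?(ltW w0)// => /(_ isT).
  by rewrite ler_pdivlMr// ltr_pdivrMr// => /andP[]; rewrite /l; lra.
have gb := le_trans ga ab.
have /andP[la1 la2] := lP _ ga; have /andP[lb1 lb2] := lP _ gb.
have lbM : (l b < M)%N.
  rewrite ltnNge; apply/negP => Ml.
  have : M%:R * w <= (l b)%:R * w by rewrite ler_pM2r// ler_nat.
  lra.
have lab : (l a <= l b)%N by apply: le_truncn; rewrite ler_pM2r ?invr_gt0//; lra.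
have v0 : 0 <= v.
  have := cell _ lbM; lra.
have sumU i j : (i <= j)%N -> (j <= M)%N ->
   u * (j - i)%:R <= c (g + j%:R * w) - c (g + i%:R * w) <= v * (j - i)%:R.
  move=> ij; rewrite -(subnKC ij); set h := (j - i)%N => iM; rewrite addKn.
  elim: h iM => [|h IHh] hM; first by rewrite addn0 !mulr0 subrr lexx.
  have := IHh (ltnW _); rewrite -addnS => /(_ hM).
  have := cell (i + h)%N; rewrite -addnS => /(_ hM).
  rewrite -natr1; lra.
have wE t : (t / w) * w = t by rewrite divfK// gt_eqF.
have /andP[_ up] := sumU (l a) (l b).+1 (leqW lab) lbM.
have cb := cmono _ _ (ltW lb2); have ca := cmono _ _ la1.
have lbE : (l b)%:R <= (b - g) / w by rewrite ler_pdivlMr//; lra.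
have lbE' : (b - g) / w < (l b)%:R + 1 by rewrite ltr_pdivrMr//; move: lb2; rewrite -natr1; lra.
have laE : (l a)%:R <= (a - g) / w by rewrite ler_pdivlMr//; lra.
have laE' : (a - g) / w < (l a)%:R + 1 by rewrite ltr_pdivrMr//; move: la2; rewrite -natr1; lra.
have dE : (b - a) / w = (b - g) / w - (a - g) / w by rewrite -mulrBl; congr (_ / _); lra.
rewrite dE; apply/andP; split; last first.
  have : v * ((l b).+1 - l a)%:R <= v * ((b - g) / w - (a - g) / w + 2).
    by rewrite ler_wpM2l// natrB ?leqW// -natr1; lra.
  lra.
have [lab1|lab1] := ltnP (l a) (l b).
  have /andP[lo _] := sumU (l a).+1 (l b) lab1 (ltnW lbM).
  have cb' := cmono _ _ lb1; have ca' := cmono _ _ (ltW la2).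
  have : u * ((b - g) / w - (a - g) / w - 2) <= u * (l b - (l a).+1)%:R.
    by rewrite ler_wpM2l// natrB// -natr1; lra.
  lra.
(* Both points lie in one cell, so (b - a)/w < 1, the lower bound is nonpositive and monotonicity is
   enough. *)
have E : l a = l b by apply/eqP; rewrite eqn_leq lab.
have : u * ((b - g) / w - (a - g) / w - 2) <= 0.
  by rewrite mulr_ge0_le0//; rewrite -E in lbE'; lra.
have := cmono _ _ ab; lra.
Qed.

(** * Almost sure regularity of samples from the density *)

Section regular_samples.
Context {R : realType} d (T : measurableType d) (P : probability T R).
Variables (X : nat -> {RV P >-> R}) (f0 : R -> R).
Hypothesis indX : mutually_independent X.
Hypothesis df0 : is_density 0 1 f0.
Hypothesis Xf0 : forall i, has_density (X i) f0.

Let mf0 : measurable_fun setT f0. Proof. by case: df0. Qed.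
Let f0_ge0 t : 0 <= f0 t. Proof. by case: df0. Qed.

Let pr (A : set R) : R := fine (\int[lebesgue_measure]_(t in A) (f0 t)%:E)%E.

Let PX i A : measurable A -> P (X i @^-1` A) = (pr A)%:E.
Proof.
move=> mA; have E := Xf0 i mA.
rewrite /pr -E fineK//; exact: fin_num_measure.
Qed.

Let preimage_measurable i A : measurable A -> measurable (X i @^-1` A).
Proof. by move=> mA; rewrite -[X in measurable X]setTI; exact: measurable_funP. Qed.

Local Notation F0 := (cdf_of_density f0).

Let F0E t : F0 t = pr `]-oo, t]. Proof. by []. Qed.

Let pr_split a b : a <= b -> F0 b = F0 a + pr `]a, b].
Proof.
move=> ab; apply: EFin_inj; rewrite EFinD !F0E -!(PX 0%N)//.
rewrite -measureU//; [|exact: preimage_measurable..|].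
  congr (P _); rewrite -preimage_setU; congr (_ @^-1` _).
  apply/seteqP; split => t /=; rewrite !in_itv/=.
    by case: (leP t a) => ta tb; [left|right].
  by move=> [ta|/andP[]//]; exact: le_trans ab.
rewrite -preimage_setI; apply/seteqP; split => // w /=.
by rewrite !in_itv/= => -[wa /andP[aw _]]; rewrite ltNge wa in aw.
Qed.

Let pr_itv a b lo hi : a <= b -> (forall t, a < t -> t <= b -> lo <= f0 t <= hi) ->
  0 <= lo -> 0 <= hi -> lo * (b - a) <= pr `]a, b] <= hi * (b - a).
Proof.
move=> ab H lo0 hi0; pose mu := @lebesgue_measure R.
have E : (\int[mu]_(t in `]a, b]) (f0 t)%:E = (pr `]a, b])%:E)%E.
  by rewrite -(PX 0%N)//; exact/esym/Xf0.
have mE : measurable_fun `]a, b]%classic (fun t => (f0 t)%:E).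
  by apply/measurable_EFinP; exact: measurable_funS mf0.
have cstE c : (\int[mu]_(t in `]a, b]) (cst c%:E t) = (c * (b - a))%:E)%E.
  have -> : (\int[mu]_(t in `]a, b]) (cst c%:E t) = c%:E * mu `]a, b]%classic)%E.
    by rewrite integral_cst.
  have -> : mu `]a, b]%classic = (b - a)%:E.
    rewrite /mu lebesgue_measure_itv/= lte_fin.
    by case: ltP => // ba; rewrite (@le_anti _ _ a b) ?ab// subrr.
  by [].
apply/andP; split.
  rewrite -lee_fin -E -cstE; apply: ge0_le_integral => // t /=; rewrite in_itv/= => /andP[ta tb].
  by rewrite lee_fin; case/andP: (H _ ta tb).
rewrite -lee_fin -E -cstE; apply: ge0_le_integral => // t /=.
- by rewrite lee_fin.
- by rewrite in_itv/= => /andP[ta tb]; rewrite lee_fin; case/andP: (H _ ta tb).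
Qed.

Let pr_ge0 A : measurable A -> 0 <= pr A.
Proof. by move=> mA; rewrite -lee_fin -(PX 0%N). Qed.

Let F0_homo : {homo F0 : a b / a <= b}.
Proof. by move=> a b ab; rewrite (pr_split ab) lerDl pr_ge0. Qed.

Let pr01 : pr `]0, 1] = 1.
Proof.
case: df0 => _ _ f00 f01; rewrite /pr.
rewrite integral_itv_obnd_cbnd; last first.
  by apply/measurable_EFinP; exact: measurable_funS mf0.
rewrite integral_mkcond (_ : (fun t => _) \_ _ = fun t => (f0 t)%:E).
  by rewrite f01.
apply/funext => t; rewrite patchE; case: ifPn => // tn.
by rewrite f00//; move: tn; apply: contra => /mem_set.
Qed.

(** The cells ]q_(j-1), q_j] start at 0 and miss a data point equal to 0; as the law has a density
    this has probability 0. *)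
Lemma ae_sample_itv : {ae P, forall w, forall i, 0 < X i w <= 1}.
Proof.
apply: ae_foralln => i; exists (X i @^-1` (~` `]0, 1])); split.
- by apply: preimage_measurable; exact: measurableC.
- have := probability_setC P (preimage_measurable i (@measurable_itv R `]0, 1])).
  by rewrite -preimage_setC (PX i)// pr01 subee.
- by move=> w /=; rewrite in_itv/=.
Qed.

(** Continuity of f0 at q0 bounds it near q0, so F0 is Lipschitz there and F0(q0 - h) < y <= F0(q0 +
    h) closes up as h tends to 0. *)
Lemma cdf_quantile y : 0 < y -> y < 1 ->
  let q0 := quantile_fun F0 y in {for q0, continuous f0} -> F0 q0 = y.
Proof.
move=> y0 y1 q0 cf.
have F00 : F0 0 = 0.
  apply/eqP; rewrite eq_le F0E pr_ge0// andbT.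
  pose L := `]-oo, (0 : R)]%classic; pose U := `](0 : R), 1]%classic.
  have : (P (X 0%N @^-1` L) + P (X 0%N @^-1` U) <= 1)%E.
    have mL : measurable (X 0%N @^-1` L) by apply: preimage_measurable; exact: measurable_itv.
    have mU : measurable (X 0%N @^-1` U) by apply: preimage_measurable; exact: measurable_itv.
    rewrite -measureU//.
      by apply: probability_le1; exact: measurableU.
    rewrite -preimage_setI; apply/seteqP; split => // w /=.
    by rewrite /L /U/= !in_itv/= => -[w0 /andP[w1 _]]; rewrite ltNge w0 in w1.
  have -> : P (X 0%N @^-1` L) = (pr `]-oo, 0])%:E by rewrite -(PX 0%N)//; exact: measurable_itv.
  have -> : P (X 0%N @^-1` U) = 1%:E by rewrite -pr01 -(PX 0%N)//; exact: measurable_itv.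
  rewrite -EFinD lee_fin; lra.
have F01 : F0 1 = 1 by rewrite (pr_split ler01) F00 pr01 add0r.
have S0 : has_inf [set t | y <= F0 t].
  split; first by exists 1 => /=; rewrite F01 ltW.
  exists 0 => t /= yt; rewrite leNgt; apply/negP => t0.
  by have := F0_homo (ltW t0); rewrite F00; lra.
have lo t : t < q0 -> F0 t < y.
  move=> tq; rewrite ltNge; apply/negP => yt.
  by have := ge_inf S0.2 yt; rewrite -/(quantile_fun F0 y) -/q0 leNgt tq.
have hi t : q0 < t -> y <= F0 t.
  move=> qt; have tq : 0 < t - q0 by lra.
  have [u /= yu uq] := inf_adherent tq S0.
  apply: (le_trans yu); apply: F0_homo; apply/ltW/(lt_le_trans uq).
  by rewrite -/(quantile_fun F0 y) -/q0; lra.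
have /cvgrPdist_lt/(_ 1 ltr01)[r /= r0 Hr] := cf.
have fb t : `|t - q0| < r -> f0 t <= f0 q0 + 1.
  move=> tq; have := Hr t; rewrite /= distrC => /(_ tq).
  by rewrite ltr_norml => /andP[]; lra.
set B := f0 q0 + 1 in fb; have B0 : 0 < B by rewrite /B; have := f0_ge0 q0; lra.
have near_le a b : a <= b -> `|a - q0| < r -> `|b - q0| < r -> F0 b - F0 a <= B * (b - a).
  move=> ab; rewrite !ltr_norml => /andP[a1 a2] /andP[b1 b2].
  have /andP[_] : 0 * (b - a) <= pr `]a, b] <= B * (b - a).
    apply: pr_itv => //; last exact: ltW.
    by move=> t ta tb; rewrite f0_ge0 fb// ltr_norml; apply/andP; split; lra.
  by rewrite (pr_split ab); lra.
apply/eqP; rewrite eq_le; apply/andP; split; apply/ler_addgt0Pr => e e0.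
- pose h := Num.min (r / 2) (e / B).
  have h0 : 0 < h by rewrite lt_min !divr_gt0.
  have hr : h <= r / 2 by rewrite ge_min lexx.
  have hB : B * h <= e by rewrite mulrC -ler_pdivlMr// ge_min lexx orbT.
  have := near_le (q0 - h) q0; rewrite subrr normr0 => /(_ _ _ r0).
  have -> : q0 - h - q0 = - h by lra.
  rewrite normrN gtr0_norm// => H.
  have {}H := H ltac:(lra) ltac:(lra).
  by have := lo (q0 - h) ltac:(lra); lra.
- pose h := Num.min (r / 2) (e / B).
  have h0 : 0 < h by rewrite lt_min !divr_gt0.
  have hr : h <= r / 2 by rewrite ge_min lexx.
  have hB : B * h <= e by rewrite mulrC -ler_pdivlMr// ge_min lexx orbT.
  have := near_le q0 (q0 + h); rewrite subrr normr0 => /(_ _ r0).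
  have -> : q0 + h - q0 = h by lra.
  rewrite gtr0_norm// => H.
  have {}H := H ltac:(lra) ltac:(lra).
  by have := hi (q0 + h) ltac:(lra); lra.
Qed.

Let ae_near_not_exp (F : nat -> set T) (B c : R) : 0 <= B -> 0 < c ->
  (forall n, measurable (F n)) ->
  (\forall n \near \oo, (P (F n) <= (B * (n.+1%:R * expR (- (c * Num.sqrt n%:R))))%:E)%E) ->
  {ae P, forall w, \forall n \near \oo, ~ F n w}.
Proof.
move=> B0 c0 mF FB; have [K K0 HK] := expR_sqrt_le c0.
apply: (@ae_near_not_of_le _ _ _ P F (B * K)); rewrite ?mulr_ge0//.
apply: filterS FB => n /le_trans; apply; by rewrite lee_fin -mulrA ler_wpM2l.
Qed.

Let measurable_dev A n (l p : R) : measurable A ->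
  measurable [set w | l <= `|\sum_(i < n) \1_A (X i w) - n%:R * p|].
Proof.
move=> mA; rewrite (_ : [set w | _] =
    (fun w => l <= `|\sum_(i < n) \1_A (X i w) - n%:R * p|) @^-1` [set true]); last first.
  by apply/seteqP; split.
rewrite -[X in measurable X]setTI; apply: measurable_fun_ler => //.
apply: measurableT_comp => //; apply: measurable_funB => //.
by apply: measurable_sum => i; apply: measurableT_comp => //; exact: measurable_indic.
Qed.

(** Deviations of n/(q+1) are excluded for each q, so countably many null sets are discarded. The
    bound exp(-c n) is weakened to exp(-c sqrt n) to share one Borel-Cantelli lemma with the grid
    argument. *)
Lemma ae_lln t : {ae P, forall w, (cnt (X ^~ w) n t)%:R / n%:R @[n --> \oo] --> F0 t}.
Proof.
pose A := `]-oo, t]%classic.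
have mA : measurable A by exact: measurable_itv.
pose F q n := [set w | n%:R * q.+1%:R^-1 <= `|\sum_(i < n) \1_A (X i w) - n%:R * F0 t|].
have H q : {ae P, forall w, \forall n \near \oo, ~ F q n w}.
  have e0 : 0 < q.+1%:R^-1 :> R by rewrite invr_gt0.
  set e := q.+1%:R^-1 in e0.
  have e1 : e <= 1 by rewrite invf_le1// ler1n.
  have c0 : 0 < e ^+ 2 / 8 by rewrite divr_gt0// exprn_gt0.
  have mF n : measurable (F q n) by exact: measurable_dev.
  apply: (@ae_near_not_exp _ 2 _ _ c0) => //.
  apply: nearW => n.
  have PA i : P (X i @^-1` A) = (F0 t)%:E by rewrite (PX i mA).
  (* s = e/4 minimises 2 s^2 - s e, the exponent per observation, with value -e^2/8. *)
  have s0 : 0 <= e / 4 <= 2^-1 by apply/andP; split; lra.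
  apply: (le_trans (indic_sum_deviation indX mA PA n _ s0)).
  rewrite lee_fin ler_wpM2l//.
  apply: (@le_trans _ _ (expR (- (e ^+ 2 / 8 * Num.sqrt n%:R)))); last first.
    by rewrite ler_peMl ?expR_ge0// ler1n.
  rewrite ler_expR.
  have F1 : F0 t <= 1.
    by rewrite -lee_fin -(PA 0%N) probability_le1//; exact: preimage_measurable.
  have : n%:R * (F0 t * e ^+ 2) <= n%:R * (1 * e ^+ 2).
    by rewrite ler_wpM2l// ler_wpM2r ?sqr_ge0.
  have : e ^+ 2 * Num.sqrt n%:R <= e ^+ 2 * n%:R.
    rewrite ler_wpM2l ?sqr_ge0//; case: n => [|n]; first by rewrite sqrtr0.
    by rewrite [leRHS]natr_sqrt ler_peMl ?sqrtr_ge0// -[leLHS]sqrtr1 ler_wsqrtr// ler1n.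
  rewrite -/e; lra.
have := ae_foralln H; apply: filterS => w Hw.
apply/cvgrPdist_lt => e e0.
have [q _ /(_ q (leqnn q)) qe] := near_infty_natSinv_lt (PosNum e0).
have := Hw q; apply: filterS2 (nbhs_infty_gt 0) => n n0 /negP; rewrite -ltNge => lt.
have nR : 0 < n%:R :> R by rewrite ltr0n.
have E : (cnt (X ^~ w) n t)%:R = \sum_(i < n) \1_A (X i w) :> R.
  rewrite natr_sum; apply: eq_bigr => i _; rewrite indicE /A.
  by congr (nat_of_bool _)%:R; apply/idP/idP; rewrite inE/= in_itv.
rewrite E; apply: lt_trans qe => /=.
rewrite -(@ltr_pM2l _ n%:R)//; apply: le_lt_trans lt.
rewrite -[X in X * _]ger0_norm// -normrM distrC mulrBr mulrCA divff ?mulr1//.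
by rewrite gt_eqF.
Qed.

Lemma ae_osc q0 : 0 < f0 q0 -> {for q0, continuous f0} ->
  {ae P, forall w, forall eta : R, 0 < eta -> exists2 de : R, 0 < de &
  \forall n \near \oo, forall a b, q0 - de <= a -> a <= b -> b <= q0 + de ->
    `|(cnt (X ^~ w) n b)%:R - (cnt (X ^~ w) n a)%:R - n%:R * f0 q0 * (b - a)| <=
    eta * (Num.sqrt n%:R + n%:R * (b - a))}.
Proof.
set f := f0 q0 => f_gt0 cf.
(* The tolerances 1/(q+1) suffice, so that the exceptional sets are countably many. *)
suff H eta : 0 < eta -> exists2 de : R, 0 < de & {ae P, forall w,
  \forall n \near \oo, forall a b, q0 - de <= a -> a <= b -> b <= q0 + de ->
    `|(cnt (X ^~ w) n b)%:R - (cnt (X ^~ w) n a)%:R - n%:R * f * (b - a)| <=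
    eta * (Num.sqrt n%:R + n%:R * (b - a))}.
  have /ae_foralln : forall q, {ae P, forall w, exists2 de : R, 0 < de &
    \forall n \near \oo, forall a b, q0 - de <= a -> a <= b -> b <= q0 + de ->
    `|(cnt (X ^~ w) n b)%:R - (cnt (X ^~ w) n a)%:R - n%:R * f * (b - a)| <=
    q.+1%:R^-1 * (Num.sqrt n%:R + n%:R * (b - a))}.
    move=> q; have [|de de0] := H q.+1%:R^-1; first by rewrite invr_gt0.
    by apply: filterS => w Hw; exists de.
  apply: filterS => w Hw eta eta0.
  have [q _ /(_ q (leqnn q)) /= qe] := near_infty_natSinv_lt (PosNum eta0).
  have [de de0 Hde] := Hw q; exists de => //; apply: filterS Hde => n Hn a b qa ab bq.
  apply: le_trans (Hn a b qa ab bq) _; rewrite ler_wpM2r ?(ltW qe)//.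
  by rewrite addr_ge0 ?sqrtr_ge0// mulr_ge0// subr_ge0.
move=> eta0.
pose h := Num.min (eta / 2) (f / 2).
have h0 : 0 < h by rewrite lt_min !divr_gt0.
have he : h <= eta / 2 by rewrite ge_min lexx.
have hf : h <= f / 2 by rewrite ge_min lexx orbT.
have /cvgrPdist_lt/(_ h h0)[r /= r0 Hr] := cf.
have fb t : `|t - q0| < r -> f - h <= f0 t <= f + h.
  move=> tq; have := Hr t; rewrite /= distrC => /(_ tq).
  by rewrite ltr_norml -/f => /andP[]; lra.
(* A third of r: the last grid cell may overshoot q0 + de by one mesh, at most [de], and must stay
   where [fb] holds. *)
pose de := r / 3; have de0 : 0 < de by rewrite divr_gt0.
have der : 2 * de < r by rewrite /de; lra.
exists de => //.
(* With this mesh the two extra cells of the grid lemma cost 2 (f + 2h) ep sqrt n = eta sqrt n. *)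
pose ep := eta / (2 * (f + 2 * h)).
have ep0 : 0 < ep by rewrite divr_gt0// mulr_gt0//; lra.
have epE : 2 * ep * (f + 2 * h) = eta by rewrite /ep; field; rewrite gt_eqF//; lra.
pose th := ep * h; have th0 : 0 < th by exact: mulr_gt0.
pose C := f + h; have C0 : 0 < C by rewrite /C; lra.
(* Chernoff parameter: the quadratic term, at most 2 C ep s^2 sqrt n, is then at most half of the
   linear term s th sqrt n. *)
pose s := Num.min (2^-1) (th / (4 * C * ep)).
have s0 : 0 < s by rewrite lt_min invr_gt0 ltr0n/= divr_gt0// mulr_gt0// mulr_gt0.
have s2 : 0 <= s <= 2^-1 by rewrite (ltW s0) ge_min lexx.
have sth : 4 * C * ep * s <= th.
  have D0 : 0 < 4 * C * ep by rewrite mulr_gt0// mulr_gt0.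
  by rewrite mulrC -(ler_pdivlMr _ _ D0) ge_min lexx orbT.
pose w n := ep / Num.sqrt n%:R.
pose M n := (Num.trunc (2 * de / w n)).+1.
pose g n l := q0 - de + l%:R * w n.
pose A n l := `]g n l, g n l.+1]%classic.
have mA n l : measurable (A n l) by exact: measurable_itv.
pose p n l := pr (A n l).
pose dev n l := [set x | th * Num.sqrt n%:R <= `|\sum_(i < n) \1_(A n l) (X i x) - n%:R * p n l|].
have mdev n l : measurable (dev n l) by exact: measurable_dev.
pose F n := \big[setU/set0]_(l < M n) dev n l.
have mF n : measurable (F n) by apply: bigsetU_measurable.
have tw0 n : 0 <= 2 * de / w n.
  apply: divr_ge0; first by rewrite mulr_ge0// ltW.
  by apply: divr_ge0; [exact: ltW|exact: sqrtr_ge0].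
have near_pos : \forall n \near \oo, [/\ 0 < Num.sqrt n%:R :> R, w n <= de & (0 < n)%N].
  near=> n.
  have n0 : (0 < n)%N by near: n; exact: nbhs_infty_gt.
  have sn : 0 < Num.sqrt n%:R :> R by rewrite sqrtr_gt0 ltr0n.
  split => //; rewrite /w ler_pdivrMr//.
  by near: n; exact: near_sqrt_ge.
have pP n l : 0 < Num.sqrt n%:R :> R -> w n <= de -> (l < M n)%N ->
    [/\ n%:R * p n l <= C * ep * Num.sqrt n%:R & (f - h) * ep * Num.sqrt n%:R <= n%:R * p n l].
  move=> sn wd lM; have w0 : 0 < w n by exact: divr_gt0.
  have nw : n%:R * w n = ep * Num.sqrt n%:R.
    rewrite [X in X * w n]natr_sqrt /w; move: (Num.sqrt _) sn => q q_gt0.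
    by field; exact: lt0r_neq0.
  have gw : g n l.+1 - g n l = w n by rewrite /g -natr1; lra.
  have lw : l%:R * w n <= 2 * de.
    rewrite -ler_pdivlMr//; apply: (@le_trans _ _ (Num.trunc (2 * de / w n))%:R).
      by rewrite ler_nat.
    by rewrite truncn_le tw0.
  have lw0 : 0 <= l%:R * w n by apply: mulr_ge0 => //; exact: ltW.
  have gl : g n l <= g n l.+1 by rewrite -subr_ge0 gw ltW.
  have fg t : g n l < t -> t <= g n l.+1 -> f - h <= f0 t <= f + h.
    move=> t1 t2; apply: fb; rewrite ltr_norml; apply/andP.
    by move: t1 t2; rewrite /g -natr1; split; lra.
  have := pr_itv gl fg ltac:(lra) ltac:(lra).
  rewrite gw -/(A n l) -/(p n l) => /andP[lo hi].
  have n_ge0 : 0 <= n%:R :> R by [].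
  have := ler_wpM2l n_ge0 lo; have := ler_wpM2l n_ge0 hi.
  by rewrite (mulrCA _ (f + h)) (mulrCA _ (f - h)) nw /C; split; lra.
have : {ae P, forall w, \forall n \near \oo, ~ F n w}.
  pose c := s * th / 2; have c0 : 0 < c by rewrite divr_gt0// mulr_gt0.
  pose B := (2 * de / ep + 1) * 2.
  have dep0 : 0 <= 2 * de / ep by apply: divr_ge0; [rewrite mulr_ge0// ltW|exact: ltW].
  have B0 : 0 <= B by rewrite /B; lra.
  apply: (@ae_near_not_exp _ B _ B0 c0) => //.
  apply: filterS near_pos => n [sn wd n0].
  apply: (@le_trans _ _ (\sum_(l < M n) (2 * expR (- (c * Num.sqrt n%:R)))%:E)%E).
    apply: le_trans (le_mu_bigsetU _ _) _ => //.
    apply: lee_sum => l _.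
    have pA i : P (X i @^-1` A n l) = (p n l)%:E by rewrite PX.
    apply: (le_trans (indic_sum_deviation indX (mA n l) pA n _ s2)).
    rewrite lee_fin ler_wpM2l// ler_expR.
    have [pu _] := pP n l sn wd (ltn_ord l).
    have s20 : 0 <= 2 * s ^+ 2 by rewrite mulr_ge0 ?sqr_ge0.
    have H1 := ler_wpM2r s20 pu.
    have H2 := ler_wpM2r (mulr_ge0 (ltW s0) (ltW sn)) sth.
    by rewrite /c; move: H1 H2; set q := Num.sqrt _; nra.
  rewrite sumEFin lee_fin sumr_const card_ord -mulr_natr.
  set E := expR _; have E0 : 0 <= E by exact: expR_ge0.
  (* There are O(sqrt n) cells; the cruder bound O(n) is what [expR_sqrt_le] absorbs. *)
  suff : (M n)%:R <= (2 * de / ep + 1) * n.+1%:R :> R.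
    move=> MB; have := ler_wpM2l E0 MB; rewrite /B; lra.
  have w0 : 0 < w n by exact: divr_gt0.
  rewrite /M -[leLHS]natr1 -[in leRHS]natr1.
  have : (Num.trunc (2 * de / w n))%:R <= 2 * de / w n.
    by rewrite truncn_le tw0.
  have -> : 2 * de / w n = 2 * de / ep * Num.sqrt n%:R.
    by rewrite /w invf_div mulrA mulrAC.
  have : 2 * de / ep * Num.sqrt n%:R <= 2 * de / ep * n%:R.
    rewrite ler_wpM2l// [leRHS]natr_sqrt ler_peMl ?(ltW sn)//.
    by rewrite -[leLHS]sqrtr1 ler_wsqrtr// ler1n.
  have : 0 <= n%:R :> R by [].
  lra.
apply: filterS => x; apply: filterS2 near_pos => n [sn wd n0] nF a b qa ab bq.
have w0 : 0 < w n by exact: divr_gt0.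
(* On a cell, f0 varies by at most h around f and the count deviates by less than th sqrt n = h ep
   sqrt n: together a slope error of 2h. *)
pose u := (f - 2 * h) * ep * Num.sqrt n%:R.
pose v := (f + 2 * h) * ep * Num.sqrt n%:R.
have u0 : 0 <= u.
  by rewrite /u; apply: mulr_ge0 (ltW sn); apply: mulr_ge0 (ltW ep0); lra.
have cmono : {homo (fun t => (cnt (X ^~ x) n t)%:R : R) : t t' / t <= t'}.
  by move=> t t' tt'; rewrite ler_nat; exact: cnt_le.
have := @grid_oscillation R _ (q0 - de) (w n) u v (M n) cmono w0 u0.
move=> /(_ _ a b qa ab _)/andP[||lo hi].
- move=> l lM; have [pu pl] := pP n l sn wd lM.
  have : ~ dev n l x.
    by move=> dx; apply: nF; rewrite /F -bigcup_mkord; exists l.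
  move=> /negP; rewrite -ltNge.
  have gl : g n l <= g n l.+1 by rewrite lerD2l ler_wpM2r ?(ltW w0)// ler_nat.
  have -> : \sum_(i < n) \1_(A n l) (X i x) =
      (cnt (X ^~ x) n (g n l.+1))%:R - (cnt (X ^~ x) n (g n l))%:R :> R.
    rewrite -(cell_count_cnt _ _ gl) natrD addrK natr_sum; apply: eq_bigr => i _.
    rewrite indicE /A; congr (nat_of_bool _)%:R.
    by apply/idP/idP; rewrite inE/= in_itv.
  rewrite ltr_norml -/(g n l) -/(g n l.+1) /u /v => /andP[].
  by move: pu pl; rewrite /C /th; lra.
- have := @trunc_itv _ (2 * de / w n); rewrite tw0// => /(_ isT).
  by rewrite ltr_pdivrMr// => /andP[_]; rewrite -/(M n); lra.
have bw : (b - a) / w n = (b - a) * Num.sqrt n%:R / ep by rewrite /w invf_div mulrA.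
rewrite bw in lo hi.
have Dv z : z * ep * Num.sqrt n%:R * ((b - a) * Num.sqrt n%:R / ep) = z * (n%:R * (b - a)).
  rewrite [X in _ = _ * (X * _)]natr_sqrt; field; exact: lt0r_neq0.
rewrite /u mulrBr Dv in lo; rewrite /v mulrDr Dv in hi.
have nb : 0 <= n%:R * (b - a) by rewrite mulr_ge0// subr_ge0.
have e1 := ler_wpM2r nb he.
have e2 : 2 * ep * (f + 2 * h) * Num.sqrt n%:R = eta * Num.sqrt n%:R by rewrite epE.
have e3 : 0 <= h * ep * Num.sqrt n%:R.
  by apply: mulr_ge0 (ltW sn); apply: mulr_ge0; exact: ltW.
rewrite ler_norml; apply/andP; split; lra.
Unshelve. all: by end_near. Qed.

End regular_samples.

(** * Asymptotics of the pseudo-posterior *)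

(** Cauchy-Schwarz against the constant vector; with S the sum of the first a terms and z the next
    one, the inductive step is (S - a z)^2 >= 0. *)
Lemma sqr_sum_le {R : realFieldType} (h : nat -> R) j :
  (\sum_(i < j) h i) ^+ 2 <= j%:R * \sum_(i < j) h i ^+ 2.
Proof.
elim: j => [|j IHj]; first by rewrite !big_ord0 expr0n mulr0.
rewrite !big_ord_recr/= -natr1.
have T0 : 0 <= \sum_(i < j) h i ^+ 2 by apply: sumr_ge0 => i _; exact: sqr_ge0.
move: IHj T0; case: j => [|j]; first by rewrite !big_ord0; lra.
have : 0 < j.+1%:R :> R by [].
move: (j.+1%:R : R) (\sum_(i < _) h i) (\sum_(i < _) h i ^+ 2) (h j.+1) => a S U z a0 H U0.
rewrite -subr_ge0 -(@pmulr_rge0 _ a)//.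
have := sqr_ge0 (S - a * z); nra.
Qed.

Section cell_ratios.
Context {R : realType}.
Variables (x : nat -> R) (d : nat).
Hypothesis x01 : forall i, 0 < x i <= 1.

Definition cell_ratio n (q : d.-tuple R) : R :=
  \prod_(1 <= j < d.+2) poisson_ratio (n %/ d.+1)
    (cell_count x n (@qtl R d.+1 q j.-1) (@qtl R d.+1 q j)).

(** n (F_n(t) - j/k) for k = [d.+1]. Unlike a cell count, the excess at q_j involves the single
    coordinate q_j; cell counts are its increments, up to rounding. *)
Definition count_excess n j (t : R) : R :=
  (cnt x n t)%:R - n%:R * (j%:R / d.+1%:R).

Lemma cell_ratio_ge0 n q : 0 <= cell_ratio n q.
Proof. by apply: prodr_ge0 => j _; exact: poisson_ratio_ge0. Qed.

Let phi n : R := n%:R / d.+1%:R - (n %/ d.+1)%:R.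

Let phi01 n : 0 <= phi n <= 1.
Proof.
have k0 : 0 < d.+1%:R :> R by [].
rewrite /phi subr_ge0 lerBlDr ler_pdivlMr// ler_pdivrMr// -natrM ler_nat leq_divM/=.
by rewrite addrC natr1 -natrM ler_nat; apply/ltnW/ltn_ceil.
Qed.

Lemma cell_count_excess n (q : d.-tuple R) i : path <%R 0 (rcons q 1) -> (i < d.+1)%N ->
  (cell_count x n (@qtl R d.+1 q i) (@qtl R d.+1 q i.+1))%:R - (n %/ d.+1)%:R =
  count_excess n i.+1 (@qtl R d.+1 q i.+1) - count_excess n i (@qtl R d.+1 q i) +
  (n%:R / d.+1%:R - (n %/ d.+1)%:R) :> R.
Proof.
move=> qP id; have := cell_count_cnt x n (@qtl_le R d.+1 q isT qP _ id).
move=> /(congr1 (fun t => t%:R : R)); rewrite natrD /count_excess -!natr1.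
have : d%:R + 1 != 0 :> R by rewrite natr1 pnatr_eq0.
move: (d%:R : R) (i%:R : R) (n%:R : R) => D I N D0 H.
have -> : N * ((I + 1) / (D + 1)) = N * (I / (D + 1)) + N / (D + 1) by field.
lra.
Qed.

Lemma count_excess0 n : count_excess n 0 0 = 0.
Proof. by rewrite /count_excess cnt0 ?mul0r ?mulr0 ?subrr// => i; case/andP: (x01 i). Qed.

Lemma count_excess1 n : count_excess n d.+1 1 = 0.
Proof.
rewrite /count_excess divff ?pnatr_eq0// mulr1 cnt_size ?subrr// => i.
by case/andP: (x01 i).
Qed.

(** Excesses are partial sums of the deviations h_i = N_i - a up to rounding, so Cauchy-Schwarz
    gives sum E_j^2 <= 2 k^2 sum h_i^2 + 2 k^3. In the exponent the linear part costs at most 1, as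
    sum |h_i| <= 2n, and the cubic remainder at most 1/2, within the constant exp 2. *)
Lemma cell_ratio_le n (q : d.-tuple R) : path <%R 0 (rcons q 1) -> (d < n)%N ->
  cell_ratio n q <= expR 2 *
    expR (- (\sum_(i < d) count_excess n i.+1 (tnth q i) ^+ 2) / (4 * d.+1%:R ^+ 2 * n%:R)).
Proof.
move=> qP dn; set a := (n %/ d.+1)%N.
have a0 : (0 < a)%N by rewrite divn_gt0.
have n0 : 0 < n%:R :> R by rewrite ltr0n (leq_trans _ dn).
pose N i := cell_count x n (@qtl R d.+1 q i) (@qtl R d.+1 q i.+1).
pose h i : R := (N i)%:R - a%:R.
have sumN : (\sum_(i < d.+1) N i = n)%N.
  rewrite -(@sum_cell_count R x d.+1 q isT x01 qP n) big_add1 /=.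
  by rewrite big_mkord.
have Nn (i : 'I_d.+1) : (N i <= n)%N by rewrite -sumN (bigD1 i)//= leq_addr.
have rE : cell_ratio n q = \prod_(i < d.+1) poisson_ratio a (N i).
  by rewrite /cell_ratio big_add1 /= big_mkord.
have kE i : (i <= d.+1)%N -> \sum_(l < i) h l =
    count_excess n i (@qtl R d.+1 q i) + i%:R * phi n.
  elim: i => [|i IHi] ik; first by rewrite big_ord0 /qtl/= count_excess0 mul0r addr0.
  rewrite big_ord_recr/= IHi ?(ltnW ik)// /h /N cell_count_excess// -/a -/(phi n).
  by rewrite -natr1 mulrDl mul1r; lra.
pose SS := \sum_(i < d.+1) h i ^+ 2.
have K2 (i : 'I_d) : count_excess n i.+1 (tnth q i) ^+ 2 <= 2 * d.+1%:R * SS + 2 * d.+1%:R ^+ 2.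
  have ik : (i.+1 <= d.+1)%N by rewrite ltnS ltnW.
  have qE : @qtl R d.+1 q i.+1 = tnth q i.
    by rewrite /qtl/= nth_rcons size_tuple ltn_ord -tnth_nth.
  have H1 := sqr_sum_le h i.+1; rewrite kE// qE in H1.
  have H2 : i.+1%:R * \sum_(l < i.+1) h l ^+ 2 <= d.+1%:R * SS.
    apply: ler_pM => //; first by apply: sumr_ge0 => l _; exact: sqr_ge0.
      by rewrite ler_nat.
    rewrite /SS -!(big_mkord xpredT (fun l => h l ^+ 2)) (big_cat_nat _ ik)//= lerDl.
    by apply: sumr_ge0 => l _; exact: sqr_ge0.
  have H3 : (i.+1%:R * phi n) ^+ 2 <= d.+1%:R ^+ 2.
    have /andP[p0 p1] := phi01 n.
    rewrite lerXn2r ?nnegrE ?mulr_ge0// -[leRHS]mulr1 ler_pM// ler_nat//.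
  move: (i.+1%:R * phi n) H1 H3 => z H1 H3.
  have := sqr_ge0 (count_excess n i.+1 (tnth q i) + 2 * z).
  move: (count_excess _ _ _) H1 => e; lra.
have K2S : \sum_(i < d) count_excess n i.+1 (tnth q i) ^+ 2 <=
    2 * d.+1%:R ^+ 2 * SS + 2 * d.+1%:R ^+ 3.
  apply: (le_trans (ler_sum _ (fun i _ => K2 i))).
  rewrite sumr_const card_ord -mulr_natl.
  have SS0 : 0 <= SS by apply: sumr_ge0 => l _; exact: sqr_ge0.
  have X0 : 0 <= 2 * d.+1%:R * SS + 2 * d.+1%:R ^+ 2 by rewrite addr_ge0 ?mulr_ge0.
  have dd : d%:R <= d.+1%:R :> R by rewrite ler_nat.
  by have := ler_wpM2r X0 dd; lra.
have habs : \sum_(i < d.+1) `|h i| <= 2 * n%:R.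
  apply: (@le_trans _ _ (\sum_(i < d.+1) ((N i)%:R + a%:R))).
    apply: ler_sum => i _; apply: le_trans (ler_normB _ _) _.
    by rewrite !normr_nat.
  rewrite big_split/= -natr_sum sumN sumr_const card_ord.
  have : a%:R *+ d.+1 <= n%:R :> R by rewrite -[leLHS]mulr_natr -natrM ler_nat leq_divM.
  lra.
rewrite rE.
apply: (@le_trans _ _ (\prod_(i < d.+1) expR (- ((h i ^+ 2 - `|h i|) / (2 * n%:R))))).
  apply: ler_prod => i _; rewrite poisson_ratio_ge0/=; apply: poisson_ratio_le => //.
    by rewrite ler_nat leq_div.
  by rewrite ler_nat.
rewrite -expR_sum -expRD ler_expR sumrN -mulr_suml sumrB -/SS.
have kn : d.+1%:R <= n%:R :> R by rewrite ler_nat.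
have k0 : 0 < d.+1%:R :> R by [].
move: (\sum_(i < d.+1) `|h i|) habs (\sum_(i < d) _) K2S kn k0 n0.
move: (d.+1%:R : R) (n%:R : R) (SS) => k m S Ab HAb E HE km k0 m0.
have D0 : 0 < 4 * k ^+ 2 * m by rewrite mulr_gt0// mulr_gt0// exprn_gt0.
rewrite -subr_ge0.
have -> : 2 + - E / (4 * k ^+ 2 * m) - - ((S - Ab) / (2 * m)) =
  (8 * k ^+ 2 * m - E + 2 * k ^+ 2 * (S - Ab)) / (4 * k ^+ 2 * m).
  by field; rewrite !gt_eqF.
apply: divr_ge0; last exact: ltW.
have k2 : 0 <= 2 * k ^+ 2 by rewrite mulr_ge0// sqr_ge0.
have H1 := ler_wpM2l k2 HAb; have H2 := ler_wpM2l k2 km.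
by nra.
Qed.

Lemma measurable_qtl j : measurable_fun setT (fun q : d.-tuple R => @qtl R d.+1 q j).
Proof.
case: j => [|j]; first by rewrite /qtl/=; exact: measurable_cst.
have [jd|jd] := ltnP j d.
  rewrite (_ : (fun q : d.-tuple R => _) = fun q : d.-tuple R => nth 0 q j).
    exact: measurable_nth_tuple.
  by apply/funext => q; rewrite /qtl/= nth_rcons size_tuple jd.
rewrite (_ : (fun q : d.-tuple R => _) = cst (if j == d then 1 else 0)) //.
by apply/funext => q; rewrite /qtl/= nth_rcons size_tuple ltnNge jd.
Qed.

Lemma measurable_cell_ratio n : measurable_fun setT (cell_ratio n).
Proof.
apply: measurable_prod => j _.
apply: (@measurableT_comp _ _ _ _ _ _ (poisson_ratio (n %/ d.+1) : nat -> R)).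
  by move=> _ Y _.
rewrite /cell_count; elim: (index_enum _) => [|i r IHr].
  by under eq_fun do rewrite big_nil; exact: measurable_cst.
under eq_fun do rewrite big_cons.
apply: measurable_fun_addn IHr.
apply: (@measurableT_comp _ _ _ _ _ _ nat_of_bool); first by move=> _ Y _.
by apply: measurable_and; [apply: measurable_fun_ltr|apply: measurable_fun_ler] => //;
  exact: measurable_qtl.
Qed.

End cell_ratios.

(** The inverse of 1 + sum 1/e_i lies below every e_i and remains positive for an empty family,
    which a minimum would not handle. *)
Lemma fin_pos_lower {R : realType} d (Q : 'I_d -> R -> Prop) :
  (forall i, exists2 e : R, 0 < e & Q i e) ->
  (forall i (a b : R), 0 < a -> a <= b -> Q i b -> Q i a) ->
  exists2 e : R, 0 < e & forall i, Q i e.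
Proof.
move=> H mono.
have /choice[e He] : forall i, exists e : R, 0 < e /\ Q i e.
  by move=> i; have [e e0 Qe] := H i; exists e.
have S0 : 0 <= \sum_(i < d) (e i)^-1.
  by apply: sumr_ge0 => i _; rewrite invr_ge0 ltW//; case: (He i).
exists (1 + \sum_(i < d) (e i)^-1)^-1 => [|i].
  by rewrite invr_gt0 ltr_pwDl.
have [e0 Qe] := He i; apply: mono Qe; first by rewrite invr_gt0 ltr_pwDl.
rewrite -[leRHS]invrK lef_pV2 ?posrE ?invr_gt0 ?ltr_pwDl//.
rewrite (bigD1 i)//= addrCA lerDl addr_ge0// sumr_ge0// => j _.
by rewrite invr_ge0 ltW//; case: (He j).
Qed.

Lemma cvg_inv_sqrt {R : realType} : (Num.sqrt n%:R)^-1 @[n --> \oo] --> (0 : R).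
Proof.
apply/cvgrPdist_le => /= e e0; near=> n.
have n0 : 0 < Num.sqrt n%:R :> R.
  by rewrite sqrtr_gt0 ltr0n; near: n; exact: nbhs_infty_gt.
rewrite sub0r normrN ger0_norm ?invr_ge0 ?(ltW n0)// invf_ple ?posrE//.
rewrite -[leLHS]mul1r ler_pdivrMr// mulrC.
by near: n; exact: near_sqrt_ge.
Unshelve. all: by end_near. Qed.

Lemma cvg_divn_natr {R : realType} k : (0 < k)%N ->
  (n %/ k)%:R / n%:R @[n --> \oo] --> (k%:R^-1 : R).
Proof.
move=> k0; have kR : 0 < k%:R :> R by rewrite ltr0n.
apply/cvgrPdist_le => /= e e0; near=> n.
have n0 : 0 < n%:R :> R by rewrite ltr0n; near: n; exact: nbhs_infty_gt.
have en : 1 <= e * n%:R by near: n; exact: near_natr_ge.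
have lo : (n %/ k)%:R * k%:R <= n%:R :> R by rewrite -natrM ler_nat leq_divM.
have hi : n%:R <= (n %/ k)%:R * k%:R + k%:R :> R.
  by rewrite -natrM -natrD ler_nat addnC -mulSn; apply/ltnW/ltn_ceil.
have k1 : 1 <= k%:R :> R by rewrite ler1n.
move: (n%:R : R) (k%:R : R) ((n %/ k)%:R : R) n0 kR en lo hi k1 => N K A n0 kR en lo hi k1.
have -> : K^-1 - A / N = (N - A * K) / (N * K) by field; rewrite !gt_eqF.
rewrite ger0_norm; last first.
  by apply: divr_ge0; [rewrite subr_ge0|rewrite mulr_ge0// ltW].
rewrite ler_pdivrMr ?mulr_gt0//.
by have := ler_wpM2r (ltW kR) en; lra.
Unshelve. all: by end_near. Qed.

Lemma gauss_scale_prod_lty {R : realType} d (s : R) : 0 < s ->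
  (\int[lebesgue_tuple R d]_t (\prod_(i < d) gauss_fun (s * tnth t i))%:E < +oo)%E.
Proof.
move=> s0; have mg : measurable_fun setT
    (fun v : d.-tuple R => \prod_(i < d) gauss_fun (s * tnth v i)).
  apply: measurable_prod => i _; apply: measurableT_comp; first exact: measurable_gauss_fun.
  by apply: measurable_funM => //; exact: measurable_tnth.
rewrite (@ge0_integral_chain_map R d (fun=> 0) (fun=> s^-1) (fun=> 0) 0).
- under eq_integral => t _.
    rewrite (eq_bigr (fun i => gauss_fun (tnth t i))); last first.
      by move=> i _; rewrite tnth_mktuple add0r mul0r addr0 mulVKf ?gt_eqF.
    over.
  by rewrite integral_gauss_prod -EFinM ltry.
- by move=> i; rewrite invr_neq0 ?gt_eqF.
- exact/measurable_EFinP.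
- by move=> v; rewrite lee_fin gauss_prod_ge0.
Qed.

Lemma cvg_sqrt_exp {R : realType} d (c : R) : 0 < c ->
  Num.sqrt n%:R ^+ d * expR (- (c * n%:R)) @[n --> \oo] --> (0 : R).
Proof.
move=> c0; pose F : R := d.+1`!%:R.
have F0 : 0 < F by rewrite ltr0n fact_gt0.
pose K := F / c ^+ d.+1; have K0 : 0 < K by rewrite divr_gt0 ?exprn_gt0.
have cK : K * (Num.sqrt n%:R)^-1 @[n --> \oo] --> (0 : R).
  by rewrite -[X in _ --> X](mulr0 K); apply: cvgM; [exact: cvg_cst|exact: cvg_inv_sqrt].
apply: (squeeze_cvgr _ (cvg_cst 0) cK).
near=> n; rewrite mulr_ge0 ?exprn_ge0 ?sqrtr_ge0 ?expR_ge0//=.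
  have n1 : 1 <= n%:R :> R by rewrite ler1n; near: n; exact: nbhs_infty_gt.
  have s1 : 1 <= Num.sqrt n%:R :> R by rewrite -[leLHS]sqrtr1 ler_wsqrtr.
  have s0 := lt_le_trans ltr01 s1.
  have sn : Num.sqrt n%:R <= n%:R :> R by rewrite [leRHS]natr_sqrt ler_peMl// ltW.
  have e1 : expR (- (c * n%:R)) <= F / (c * n%:R) ^+ d.+1.
    have cn : 0 < c * n%:R by rewrite mulr_gt0// (lt_le_trans ltr01).
    rewrite expRN -[leRHS]invrK lef_pV2 ?posrE ?expR_gt0 ?invr_gt0 ?divr_gt0 ?exprn_gt0//.
    rewrite invf_div; apply: le_trans (expR_ge1Dxn d (ltW cn)).
    by rewrite -/F lerDr.
  have sd : Num.sqrt n%:R ^+ d <= n%:R ^+ d :> R.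
    by rewrite lerXn2r ?nnegrE ?sqrtr_ge0.
  apply: (@le_trans _ _ (n%:R ^+ d * (F / (c * n%:R) ^+ d.+1))).
    by apply: ler_pM; rewrite ?exprn_ge0 ?sqrtr_ge0 ?expR_ge0.
  have n0 : 0 < n%:R :> R by exact: lt_le_trans n1.
  have -> : n%:R ^+ d * (F / (c * n%:R) ^+ d.+1) = K / n%:R.
    rewrite /K exprMn [n%:R ^+ d.+1]exprSr.
    have Nd0 := exprn_gt0 d n0; have C0 := exprn_gt0 d.+1 c0.
    move: (n%:R ^+ d) Nd0 (c ^+ d.+1) C0 (n%:R : R) n0 => Nd Nd0 C C0 N N0.
    by field; rewrite !gt_eqF ?exprn_gt0.
  by rewrite ler_pM2l// lef_pV2 ?posrE.
Unshelve. all: by end_near. Qed.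

(** Replaces a bounded test function by the nonnegative g + M, the only kind that the asymptotic
    lemmas treat. *)
Lemma integral_pushforward_bounded d1 d2 (X : measurableType d1) (Y : measurableType d2)
    (R : realType) (mu : {measure set X -> \bar R}) (phi : X -> Y) (g : Y -> R) (M : R) :
  mu setT = 1%E -> measurable_fun setT phi -> measurable_fun setT g ->
  (forall y, `|g y| <= M) ->
  (\int[pushforward mu phi]_y (g y)%:E = \int[mu]_x (g (phi x) + M)%:E - M%:E)%E.
Proof.
move=> mu1 mphi mg gM.
have mu_fin : (mu setT < +oo)%E by rewrite mu1 ltry.
have ig : mu.-integrable setT (fun x => (g (phi x))%:E).
  by apply: integrable_bounded mu_fin _ (fun x => gM (phi x)); exact: measurableT_comp.
have iM : mu.-integrable setT (fun=> M%:E).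
  by apply: (@integrable_bounded _ _ _ _ (fun=> M) `|M|).
rewrite integral_pushforward//; last exact/measurable_EFinP.
under [in RHS]eq_integral do rewrite EFinD.
rewrite integralD// integral_cst// mu1 mule1 addeK//.
Qed.

(** * The posterior limit for one fixed regular sample *)

Section posterior_asymptotics.
Context {R : realType}.
Variables (x : nat -> R) (d : nat) (q0 f : nat -> R) (Pi : d.-tuple R -> R).
Hypothesis x01 : forall i, 0 < x i <= 1.
Hypothesis f_gt0 : forall j, (0 < j <= d)%N -> 0 < f j.
Hypothesis lln : forall j, (0 < j <= d)%N ->
  (cnt x n (q0 j))%:R / n%:R @[n --> \oo] --> (j%:R / d.+1%:R : R).
Hypothesis osc : forall j, (0 < j <= d)%N ->
  forall eta, 0 < eta -> exists2 de, 0 < de &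
  \forall n \near \oo, forall a b, q0 j - de <= a -> a <= b -> b <= q0 j + de ->
    `|(cnt x n b)%:R - (cnt x n a)%:R - n%:R * f j * (b - a)| <=
    eta * (Num.sqrt n%:R + n%:R * (b - a)).
Hypothesis mPi : measurable_fun setT Pi.
Hypothesis Pi_ge0 : forall q, 0 <= Pi q.
Hypothesis Pi_path : forall q, 0 < Pi q -> path <%R 0 (rcons q 1).
Hypothesis intPi : (\int[lebesgue_tuple R d]_q (Pi q)%:E <= 1)%E.
Let q0v : d.-tuple R := [tuple q0 i.+1 | i < d].
Hypothesis Pi0 : 0 < Pi q0v.
Hypothesis cPi : {for row_of_tuple q0v, continuous (Pi \o @tuple_of_row R d)}.

Let jP (i : 'I_d) : (0 < i.+1 <= d)%N. Proof. exact: ltn_ord. Qed.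

Definition sample_quantile n i := quantile_fun (ecdf x n) (i.+1%:R / d.+1%:R).
Local Notation qs := sample_quantile.

(** The local parametrisation q = q^* + t / sqrt n, as a diagonal chain map. *)
Definition rescale n (t : d.-tuple R) : d.-tuple R :=
  chain_map (qs n) (fun=> (Num.sqrt n%:R)^-1) (fun=> 0) 0 t.

Lemma tnth_rescale n t i : tnth (rescale n t) i = qs n i + tnth t i / Num.sqrt n%:R.
Proof. by rewrite tnth_mktuple mul0r addr0 mulrC. Qed.

Lemma cvg_sample_quantile (i : 'I_d) : qs n i @[n --> \oo] --> q0 i.+1.
Proof.
exact: (cvg_empirical_quantile (f_gt0 (jP i)) (lln (jP i)) (osc (jP i))).
Qed.

Lemma cvg_rescale t (i : 'I_d) : tnth (rescale n t) i @[n --> \oo] --> tnth q0v i.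
Proof.
under eq_fun do rewrite tnth_rescale.
rewrite tnth_mktuple -[q0 _]addr0 -(mulr0 (tnth t i)).
apply: cvgD; first exact: cvg_sample_quantile.
by apply: cvgM; [exact: cvg_cst|exact: cvg_inv_sqrt].
Qed.

Let cvg_count_excess t (i : 'I_d) :
  count_excess x d n i.+1 (tnth (rescale n t) i) / Num.sqrt n%:R @[n --> \oo] -->
  f i.+1 * tnth t i.
Proof.
apply/cvgrPdist_le => /= e e0.
have T0 : 0 < 1 + `|tnth t i| by rewrite ltr_pwDl.
have [de de0 Hde] := cnt_local (f_gt0 (jP i)) (lln (jP i)) (osc (jP i)) (divr_gt0 e0 T0).
have /cvgrPdist_le/(_ de de0) Hc := @cvg_rescale t i.
near=> n.
have sn : 0 < Num.sqrt n%:R :> R.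
  by rewrite sqrtr_gt0 ltr0n; near: n; exact: nbhs_infty_gt.
have nearq : `|tnth (rescale n t) i - q0 i.+1| <= de.
  have : `|tnth q0v i - tnth (rescale n t) i| <= de by near: n; exact: Hc.
  by rewrite tnth_mktuple distrC.
have : forall q : R, `|q - q0 i.+1| <= de ->
    `|(cnt x n q)%:R - n%:R * (i.+1%:R / d.+1%:R) - n%:R * f i.+1 * (q - qs n i)| <=
    e / (1 + `|tnth t i|) * (Num.sqrt n%:R + n%:R * `|q - qs n i|).
  by near: n; exact: Hde.
move=> /(_ _ nearq); rewrite -/(count_excess _ _ _ _ _).
rewrite tnth_rescale (_ : qs n i + tnth t i / Num.sqrt n%:R - qs n i = tnth t i / Num.sqrt n%:R); last first.
  by rewrite addrAC subrr add0r.
move: (count_excess _ _ _ _ _) => E.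
rewrite normrM normfV (gtr0_norm sn).
move: (Num.sqrt n%:R) (@natr_sqrt R n) sn => s -> s0.
have -> : s * s * f i.+1 * (tnth t i / s) = s * (f i.+1 * tnth t i) by field; rewrite gt_eqF.
have -> : e / (1 + `|tnth t i|) * (s + s * s * (`|tnth t i| / s)) = e * s.
  by field; rewrite !gt_eqF.
move=> H; rewrite distrC -(@ler_pM2r _ s)// -[X in _ * X <= _](gtr0_norm s0) -normrM.
rewrite mulrBl divfK ?gt_eqF//; move: H; congr (`|_| <= _); ring.
Unshelve. all: by end_near. Qed.

Let cvg_prior t : Pi (rescale n t) @[n --> \oo] --> Pi q0v.
Proof. by apply: continuous_tuple_cvg => // i; exact: cvg_rescale. Qed.

(** The prior stays positive near q^0 by continuity, and positivity of the prior forces the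
    order. *)
Let near_path t : \forall n \near \oo, path <%R 0 (rcons (rescale n t) 1).
Proof.
have /cvgrPdist_lt/(_ _ Pi0) := cvg_prior t.
by apply: filterS => n; rewrite ltr_norml => /andP[_ H]; apply: Pi_path; lra.
Qed.

Let excess n t j := count_excess x d n j (@qtl R d.+1 (rescale n t) j) / Num.sqrt n%:R.

(** The endpoints j = 0 and j = d+1 are exact: no data point is at most 0 and all are at most 1. *)
Let cvg_excess t j : (j <= d.+1)%N -> excess n t j @[n --> \oo] --> qcoord f t j.
Proof.
case: j => [_|j].
  rewrite /excess /qcoord/= /qtl/= mulr0.
  by under eq_fun do rewrite count_excess0// mul0r; exact: cvg_cst.
rewrite ltnS leq_eqVlt => /predU1P[->|jd].
  rewrite /excess /qcoord/= nth_default ?size_tuple// mulr0.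
  under eq_fun do rewrite qtl_last// count_excess1// mul0r.
  exact: cvg_cst.
have := @cvg_count_excess t (Ordinal jd); rewrite /qcoord/= (tnth_nth 0)/=.
apply: cvg_trans; apply: near_eq_cvg; apply: nearW => n.
have qE (q : d.-tuple R) : @qtl R d.+1 q j.+1 = nth 0 q j.
  by rewrite /qtl/= nth_rcons size_tuple jd.
by rewrite /excess qE (tnth_nth 0).
Qed.

Lemma cvg_cell_ratio t : cell_ratio x n (rescale n t) @[n --> \oo] --> bridge_density f t.
Proof.
have -> : bridge_density f t = \prod_(i < d.+1)
    expR (- (d.+1%:R / 2 * (qcoord f t i.+1 - qcoord f t i) ^+ 2)).
  by rewrite -expR_sum /bridge_density sumrN mulr_sumr.
have E n : cell_ratio x n (rescale n t) = \prod_(i < d.+1) poisson_ratio (n %/ d.+1)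
    (cell_count x n (@qtl R d.+1 (rescale n t) i) (@qtl R d.+1 (rescale n t) i.+1)).
  by rewrite /cell_ratio big_add1 /= big_mkord.
under eq_fun do rewrite E.
apply: cvg_big => [|i _]; first exact: mul_continuous.
apply: cvg_poisson_ratio => //; first exact: cvg_divn_natr.
have H : (excess n t i.+1 - excess n t i +
    (n%:R / d.+1%:R - (n %/ d.+1)%:R) / Num.sqrt n%:R) @[n --> \oo] -->
    qcoord f t i.+1 - qcoord f t i.
  rewrite -[qcoord f t i.+1 - _]addr0; apply: cvgD.
    by apply: cvgB; apply: cvg_excess => //; exact: ltnW.
  apply: (squeeze_cvgr _ (cvg_cst 0) (@cvg_inv_sqrt R)).
  apply: nearW => n; have /andP[p0 p1] : 0 <= (n%:R / d.+1%:R - (n %/ d.+1)%:R : R) <= 1.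
    have k0 : 0 < d.+1%:R :> R by [].
    rewrite subr_ge0 lerBlDr ler_pdivlMr// ler_pdivrMr// -natrM ler_nat leq_divM/=.
    by rewrite addrC natr1 -natrM ler_nat; apply/ltnW/ltn_ceil.
  by rewrite divr_ge0 ?sqrtr_ge0//= ler_piMl ?invr_ge0 ?sqrtr_ge0.
apply: cvg_trans H; apply: near_eq_cvg; apply: filterS (near_path t) => n pn.
by rewrite cell_count_excess// /excess -mulrBl -mulrDl.
Qed.

Lemma cvg_prior_cell_ratio t :
  Pi (rescale n t) * cell_ratio x n (rescale n t) @[n --> \oo] -->
  Pi q0v * bridge_density f t.
Proof. by apply: cvgM; [exact: cvg_prior|exact: cvg_cell_ratio]. Qed.

Definition near_quantiles (de : R) (q : d.-tuple R) : bool :=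
  [forall i, `|tnth q i - q0 i.+1| < de].

Lemma near_near_quantiles de t : 0 < de ->
  \forall n \near \oo, near_quantiles de (rescale n t).
Proof.
move=> de0.
suff : \forall n \near \oo, forall i : 'I_d, `|tnth (rescale n t) i - q0 i.+1| < de.
  by apply: filterS => n H; apply/forallP.
apply: filter_forall => i; have /cvgrPdist_lt/(_ de de0) := @cvg_rescale t i.
by apply: filterS => n; rewrite tnth_mktuple distrC.
Qed.

(** Near q^0 each excess is at least sqrt n (f/2) (|t_i| - 1) in absolute value, so [cell_ratio_le]
    becomes a Gaussian bound in t, while continuity at q^0 bounds the prior by twice its value
    there. *)
Lemma cell_ratio_near_le : exists de B s : R, [/\ 0 < de, 0 <= B, 0 < s &
  \forall n \near \oo, forall t, near_quantiles de (rescale n t) ->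
    Pi (rescale n t) * cell_ratio x n (rescale n t) <=
    B * \prod_(i < d) gauss_fun (s * tnth t i)].
Proof.
have [fm fm0 Hfm] : exists2 fm : R, 0 < fm & forall i : 'I_d, fm <= f i.+1.
  apply: fin_pos_lower => [i|i a b _ ab]; first by exists (f i.+1) => //; exact: f_gt0.
  exact: le_trans.
have [d1 d10 Hd1] := continuous_tuple_ball cPi Pi0.
have [d2 d20 Hd2] : exists2 de : R, 0 < de & forall i : 'I_d,
    \forall n \near \oo, forall q : R, `|q - q0 i.+1| <= de ->
    `|count_excess x d n i.+1 q - n%:R * f i.+1 * (q - qs n i)| <=
    f i.+1 / 2 * (Num.sqrt n%:R + n%:R * `|q - qs n i|).
  apply: fin_pos_lower => [i|i a b _ ab].
    have e0 : 0 < f i.+1 / 2 by rewrite divr_gt0// f_gt0.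
    exact: (cnt_local (f_gt0 (jP i)) (lln (jP i)) (osc (jP i)) e0).
  by apply: filterS => n H q qa; apply: H; exact: le_trans ab.
pose k : R := d.+1%:R; have k0 : 0 < k by [].
(* From (|t| - 1)^2 >= (t^2 - 2)/2, a squared excess is at least n fm^2 (t^2 - 2)/8; dividing by 4
   k^2 n leaves c t^2 - 2c. The offsets 2c enter the constant through exp(2 c d). *)
have [c c0 cE] : exists2 c : R, 0 < c & c = fm ^+ 2 / (32 * k ^+ 2).
  by exists (fm ^+ 2 / (32 * k ^+ 2)) => //; rewrite divr_gt0 ?mulr_gt0 ?exprn_gt0.
exists (Num.min d1 d2), (2 * Pi q0v * expR 2 * expR (2 * c * d%:R)), (Num.sqrt c); split.
- by rewrite lt_min d10.
- by rewrite !mulr_ge0 ?expR_ge0.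
- by rewrite sqrtr_gt0.
move: Hd2 => /filter_forall; apply: filterS2 (nbhs_infty_gt d) => n dn Hn t /forallP nt.
set q := rescale n t in nt *.
have := Pi_ge0 q; rewrite le_eqVlt => /predU1P[<-|Piq].
  by rewrite mul0r !mulr_ge0 ?expR_ge0//; apply: prodr_ge0 => i _; exact: expR_ge0.
have qP := Pi_path Piq.
have Pi2 : Pi q <= 2 * Pi q0v.
  have : `|Pi q - Pi q0v| < Pi q0v.
    apply: Hd1 => i; rewrite [tnth q0v i]tnth_mktuple.
    by apply: (lt_le_trans (nt i)); rewrite ge_min lexx.
  by rewrite ltr_norml => /andP[]; lra.
rewrite -!mulrA mulrA; apply: ler_pM => //; first exact: cell_ratio_ge0.
apply: (le_trans (cell_ratio_le x01 qP dn)); rewrite ler_wpM2l ?expR_ge0//.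
rewrite /gauss_fun -expR_sum -expRD ler_expR -/k.
have n0 : 0 < n%:R :> R by rewrite ltr0n (leq_trans _ dn).
have sn : 0 < Num.sqrt n%:R :> R by rewrite sqrtr_gt0.
have D0 : 0 < 4 * k ^+ 2 * n%:R by rewrite !mulr_gt0 ?exprn_gt0.
have H (i : 'I_d) : (c * tnth t i ^+ 2 - 2 * c) * (4 * k ^+ 2 * n%:R) <=
    count_excess x d n i.+1 (tnth q i) ^+ 2.
  have := Hn i (tnth q i); have := nt i; rewrite lt_min => /andP[_ /ltW qd] /(_ qd).
  rewrite [in X in _ - _ * X]tnth_rescale [in X in _ * `|X|]tnth_rescale.
  rewrite (_ : qs n i + tnth t i / Num.sqrt n%:R - qs n i = tnth t i / Num.sqrt n%:R); last first.
    by rewrite addrAC subrr add0r.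
  move: (count_excess _ _ _ _ _) => E.
  have -> : (c * tnth t i ^+ 2 - 2 * c) * (4 * k ^+ 2 * n%:R) =
      n%:R * (fm ^+ 2 / 8 * (tnth t i ^+ 2 - 2)).
    by rewrite cE; move: (n%:R : R) => N; field; rewrite gt_eqF.
  rewrite normrM normfV (gtr0_norm sn).
  have := Hfm i; move: (Num.sqrt _) (@natr_sqrt R n) (tnth t i) (f i.+1) sn => s -> u g s0 mg.
  have -> : s * s * g * (u / s) = s * (g * u) by field; rewrite gt_eqF.
  have -> : g / 2 * (s + s * s * (`|u| / s)) = s * (g / 2 * (1 + `|u|)).
    by field; rewrite gt_eqF.
  move=> HE.
  have g0 : 0 < g by exact: lt_le_trans mg.
  have EE : s * (g / 2 * (`|u| - 1)) <= `|E|.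
    have := ler_normB (E - s * (g * u)) E; rewrite addrAC subrr add0r normrN.
    rewrite !normrM (gtr0_norm s0) (gtr0_norm g0); lra.
  have [u1|u1] := leP 1 `|u|; last first.
    apply: (@le_trans _ _ 0); last exact: sqr_ge0.
    apply: mulr_ge0_le0; first by rewrite mulr_ge0 ?(ltW s0).
    apply: mulr_ge0_le0; first by rewrite divr_ge0 ?sqr_ge0.
    rewrite -real_normK ?num_real//.
    have : `|u| ^+ 2 <= 1 by rewrite expr_le1// ltW.
    lra.
  have mE : s * (fm / 2 * (`|u| - 1)) <= `|E|.
    apply: le_trans EE; rewrite ler_pM2l// ler_wpM2r ?subr_ge0//; lra.
  rewrite -(real_normK (num_real E)) -(real_normK (num_real u)).
  have m0 : 0 <= s * (fm / 2 * (`|u| - 1)).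
    by apply: mulr_ge0; [exact: ltW|apply: mulr_ge0; lra].
  apply: (@le_trans _ _ ((s * (fm / 2 * (`|u| - 1))) ^+ 2)); last first.
    by rewrite lerXn2r ?nnegrE.
  rewrite -subr_ge0.
  have -> : (s * (fm / 2 * (`|u| - 1))) ^+ 2 - s * s * (fm ^+ 2 / 8 * (`|u| ^+ 2 - 2)) =
     (s * fm) ^+ 2 / 8 * (`|u| - 2) ^+ 2 by field.
  by rewrite mulr_ge0 ?sqr_ge0// divr_ge0 ?sqr_ge0.
have sE (i : 'I_d) : (Num.sqrt c * tnth t i) ^+ 2 = c * tnth t i ^+ 2.
  by rewrite exprMn sqr_sqrtr ?(ltW c0).
under [in leRHS]eq_bigr do rewrite sE.
have : \sum_(i < d) (c * tnth t i ^+ 2 - 2 * c) <=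
    (\sum_(i < d) count_excess x d n i.+1 (tnth q i) ^+ 2) / (4 * k ^+ 2 * n%:R).
  by rewrite mulr_suml; apply: ler_sum => i _; rewrite ler_pdivlMr.
rewrite sumrB sumr_const card_ord -[2 * c *+ d]mulr_natr mulNr sumrN.
move: ((\sum_(i < d) count_excess _ _ _ _ _ ^+ 2) / _) (\sum_(i < d) c * _) => E S; lra.
Qed.

(** A single coordinate off its quantile has an excess of order n, and its square alone makes
    [cell_ratio_le] exponentially small. The prior is kept as a factor since it is merely
    integrable, not bounded. *)
Lemma cell_ratio_far_le de : 0 < de -> exists2 c : R, 0 < c &
  \forall n \near \oo, forall q, ~~ near_quantiles de q ->
    Pi q * cell_ratio x n q <= Pi q * (expR 2 * expR (- (c * n%:R))).
Proof.
move=> de0.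
have [c c0 Hc] : exists2 c : R, 0 < c & forall i : 'I_d, \forall n \near \oo,
    forall q, de <= `|q - q0 i.+1| -> c * n%:R <= `|count_excess x d n i.+1 q|.
  apply: fin_pos_lower => [i|i a b _ ab].
    exact: (cnt_far (f_gt0 (jP i)) (lln (jP i)) (osc (jP i)) de0).
  apply: filterS => n H q qd; apply: le_trans (H q qd); exact: ler_wpM2r.
pose k : R := d.+1%:R; have k0 : 0 < k by [].
exists (c ^+ 2 / (4 * k ^+ 2)); first by rewrite divr_gt0 ?mulr_gt0 ?exprn_gt0.
move: Hc => /filter_forall; apply: filterS2 (nbhs_infty_gt d) => n dn Hn q.
rewrite negb_forall => /existsP[i]; rewrite -leNgt => qi.
have := Pi_ge0 q; rewrite le_eqVlt => /predU1P[<-|Piq]; first by rewrite !mul0r.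
rewrite ler_wpM2l ?(ltW Piq)//.
apply: (le_trans (cell_ratio_le x01 (Pi_path Piq) dn)); rewrite ler_wpM2l ?expR_ge0//.
rewrite ler_expR mulNr lerN2 -/k.
have n0 : 0 < n%:R :> R by rewrite ltr0n (leq_trans _ dn).
rewrite ler_pdivlMr ?mulr_gt0 ?exprn_gt0//.
apply: (@le_trans _ _ (count_excess x d n i.+1 (tnth q i) ^+ 2)); last first.
  by rewrite (bigD1 i)//= lerDl; apply: sumr_ge0 => j _; exact: sqr_ge0.
have -> : c ^+ 2 / (4 * k ^+ 2) * n%:R * (4 * k ^+ 2 * n%:R) = (c * n%:R) ^+ 2.
  by move: (n%:R : R) => N; field; rewrite gt_eqF.
rewrite -[leRHS]real_normK ?num_real// lerXn2r ?nnegrE ?mulr_ge0 ?(ltW c0)//.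
exact: Hn.
Qed.

Definition posterior_kernel n (q : d.-tuple R) : R := Pi q * cell_ratio x n q.
Local Notation G := posterior_kernel.

Lemma posterior_kernel_ge0 n q : 0 <= G n q.
Proof. by rewrite mulr_ge0// cell_ratio_ge0. Qed.

Lemma measurable_posterior_kernel n : measurable_fun setT (G n).
Proof. by apply: measurable_funM => //; exact: measurable_cell_ratio. Qed.

Definition centered n (q : d.-tuple R) : d.-tuple R :=
  [tuple Num.sqrt n%:R * (tnth q i - qs n i) | i < d].

Lemma measurable_centered n : measurable_fun setT (centered n).
Proof.
apply: measurable_fun_tuple => i; apply: measurable_funM => //.
by apply: measurable_funB => //; exact: measurable_tnth.
Qed.

Lemma centered_rescale n t : (0 < n)%N -> centered n (rescale n t) = t.
Proof.
move=> n0; have sn : Num.sqrt n%:R != 0 :> R by rewrite gt_eqF// sqrtr_gt0 ltr0n.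
apply: eq_from_tnth => i; rewrite tnth_mktuple tnth_rescale.
by rewrite addrAC subrr add0r mulrC divfK.
Qed.

Let measurable_near de : measurable_fun setT (fun q => (near_quantiles de q)%:R : R).
Proof.
apply: (@measurableT_comp _ _ _ _ _ _ (fun b : bool => b%:R : R)); first by move=> _ Y _.
apply: (measurable_fun_bool true); rewrite setTI.
rewrite (_ : _ @^-1` _ = \bigcap_(i in [set: 'I_d])
    [set q | `|tnth q i - q0 i.+1| < de]); last first.
  apply/seteqP; split => q /=; first by move=> /forallP H i _; exact: H.
  by move=> H; apply/forallP => i; exact: H.
apply: fin_bigcap_measurable; first exact: finite_finset.
move=> i _; rewrite (_ : [set q | _] =
    (fun q : d.-tuple R => `|tnth q i - q0 i.+1| < de) @^-1` [set true]); last first.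
  by apply/seteqP; split.
rewrite -[X in measurable X]setTI; apply: measurable_fun_ltr => //.
by apply: measurableT_comp => //; apply: measurable_funB => //; exact: measurable_tnth.
Qed.

Section test_function.
Variables (u : d.-tuple R -> R) (M : R).
Hypothesis cu : continuous (u \o @tuple_of_row R d).
Hypothesis u0M : forall v, 0 <= u v <= M.

Let mu_u : measurable_fun setT u. Proof. exact: measurable_continuous_tuple. Qed.
Let u0 v : 0 <= u v. Proof. by case/andP: (u0M v). Qed.
Let M0 : 0 <= M. Proof. by have /andP[a b] := u0M [tuple 0 | _ < d]; exact: le_trans b. Qed.

Let bG0 (b : bool) n q : 0 <= b%:R * G n q.
Proof. by apply: mulr_ge0; [case: b|exact: posterior_kernel_ge0]. Qed.

Let uG0 v (b : bool) n q : 0 <= u v * (b%:R * G n q).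
Proof. exact: mulr_ge0. Qed.

Let cvg_near : exists2 de : R, 0 < de &
  (\int[lebesgue_tuple R d]_t
     (u t * ((near_quantiles de (rescale n t))%:R * G n (rescale n t)))%:E)%E @[n --> \oo] -->
  (\int[lebesgue_tuple R d]_t (u t * (Pi q0v * bridge_density f t))%:E)%E.
Proof.
have [de [B [s [de0 B0 s0 [N _ HN]]]]] := cell_ratio_near_le.
(* The Gaussian bound holds only from rank N on, while dominated convergence wants it for all
   indices. *)
exists de => //; rewrite -(cvg_shiftn N).
have mf n : measurable_fun setT
    (fun t => u t * ((near_quantiles de (rescale n t))%:R * G n (rescale n t))).
  apply: measurable_funM => //; apply: measurable_funM.
    apply: (@measurableT_comp _ _ _ _ _ _ (fun q => (near_quantiles de q)%:R : R)) => //.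
    exact: measurable_chain_map.
  apply: (@measurableT_comp _ _ _ _ _ _ (G n)); first exact: measurable_posterior_kernel.
  exact: measurable_chain_map.
pose g (t : d.-tuple R) := M * (B * \prod_(i < d) gauss_fun (s * tnth t i)).
have mgp : measurable_fun setT
    (fun v : d.-tuple R => \prod_(i < d) gauss_fun (s * tnth v i)).
  apply: measurable_prod => i _; apply: measurableT_comp; first exact: measurable_gauss_fun.
  by apply: measurable_funM => //; exact: measurable_tnth.
have g0 t : 0 <= g t by rewrite !mulr_ge0// gauss_prod_ge0.
have mg : measurable_fun setT g by do 2!apply: measurable_funM => //.
have cvgt t : u t * ((near_quantiles de (rescale n t))%:R * G n (rescale n t)) @[n --> \oo] -->
    u t * (Pi q0v * bridge_density f t).
  apply: cvgM; first exact: cvg_cst.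
  apply: cvg_trans (@cvg_prior_cell_ratio t); apply: near_eq_cvg.
  by apply: filterS (near_near_quantiles t de0) => n ->; rewrite mul1r.
have mlim : measurable_fun setT (fun t => u t * (Pi q0v * bridge_density f t)).
  apply: (measurable_fun_cvg mf) => t _; exact: cvgt.
have [|||||_ _] := @dominated_convergence _ _ _ (lebesgue_tuple R d) setT measurableT
  (fun n t => (u t * ((near_quantiles de (rescale (n + N) t))%:R * G (n + N) (rescale (n + N) t)))%:E)
  (fun t => (u t * (Pi q0v * bridge_density f t))%:E) (fun t => (g t)%:E); last exact.
- by move=> n; exact/measurable_EFinP.
- exact/measurable_EFinP.
- apply: aeW => t _; apply: cvg_EFin; first exact: nearW.
  have := cvgt t; rewrite -(cvg_shiftn N); exact.
- apply/integrableP; split; first exact/measurable_EFinP.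
  under eq_integral do rewrite gee0_abs ?lee_fin//.
  rewrite /g; under eq_integral do rewrite mulrA EFinM.
  rewrite ge0_integralZl ?lee_fin ?mulr_ge0//.
  + by rewrite lte_mul_pinfty ?lee_fin ?mulr_ge0// gauss_scale_prod_lty.
  + exact/measurable_EFinP.
  + by move=> t _; rewrite lee_fin gauss_prod_ge0.
- apply: aeW => t n _; rewrite lee_fin ger0_norm ?uG0//.
  have /andP[_ uM] := u0M t.
  apply: ler_pM => //.
  have [nt|_] := boolP (near_quantiles _ _); last by rewrite mul0r mulr_ge0// gauss_prod_ge0.
  by rewrite mul1r; apply: HN => //=; rewrite leq_addl.
Qed.

(** The exponential factor leaves the integral, the prior contributes at most 1, and sqrt(n)^d
    exp(-c n) tends to 0. *)
Let cvg_far de : 0 < de ->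
  ((Num.sqrt n%:R ^+ d)%:E * \int[lebesgue_tuple R d]_q
     (u (centered n q) * ((~~ near_quantiles de q)%:R * G n q))%:E)%E @[n --> \oo] --> 0%E.
Proof.
move=> de0; have [c c0 Hc] := cell_ratio_far_le de0.
have mcu n : measurable_fun setT (fun q => u (centered n q)).
  by apply: measurableT_comp => //; exact: measurable_centered.
have mfar n : measurable_fun setT
    (fun q => u (centered n q) * ((~~ near_quantiles de q)%:R * G n q)).
  apply: measurable_funM => //; apply: measurable_funM; last exact: measurable_posterior_kernel.
  rewrite (_ : (fun q => _) = fun q => 1 - (near_quantiles de q)%:R); last first.
    by apply/funext => q; case: (near_quantiles de q); rewrite ?subrr ?subr0.
  exact: measurable_funB.
have cR : (M * expR 2 * (Num.sqrt n%:R ^+ d * expR (- (c * n%:R))))%:E @[n --> \oo] --> (0%E : \bar R).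
  apply: cvg_EFin; first exact: nearW.
  rewrite -[0](mulr0 (M * expR 2)); apply: cvgM; first exact: cvg_cst.
  exact: cvg_sqrt_exp.
apply: (squeeze_cvge _ (cvg_cst 0%E) cR).
apply: filterS Hc => n Hn; apply/andP; split.
  apply: mule_ge0; first by rewrite lee_fin exprn_ge0 ?sqrtr_ge0.
  by apply: integral_ge0 => q _; rewrite lee_fin uG0.
pose b := M * (expR 2 * expR (- (c * n%:R))).
have b0 : 0 <= b by rewrite !mulr_ge0 ?expR_ge0.
have -> : M * expR 2 * (Num.sqrt n%:R ^+ d * expR (- (c * n%:R))) = Num.sqrt n%:R ^+ d * b.
  by rewrite /b; ring.
rewrite EFinM; apply: lee_wpmul2l; first by rewrite lee_fin exprn_ge0 ?sqrtr_ge0.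
apply: (@le_trans _ _ (\int[lebesgue_tuple R d]_q (b%:E * (Pi q)%:E))%E).
  apply: ge0_le_integral => //.
  - by move=> q _; rewrite lee_fin uG0.
  - exact/measurable_EFinP.
  - by apply: measurable_funeM; exact/measurable_EFinP.
  - move=> q _; rewrite -EFinM lee_fin.
    have [nq|nq] := boolP (near_quantiles de q); first by rewrite mul0r mulr0 mulr_ge0.
    rewrite mul1r (_ : b * Pi q = M * (Pi q * (expR 2 * expR (- (c * n%:R))))); last first.
      by rewrite /b; ring.
    have /andP[_ uM] := u0M (centered n q).
    by apply: ler_pM => //; [exact: posterior_kernel_ge0|exact: Hn].
rewrite ge0_integralZl//.
- by rewrite -[leRHS]mule1 lee_wpmul2l.
- exact/measurable_EFinP.
- by move=> q _; rewrite lee_fin.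
Qed.

(** The factor sqrt(n)^d undoes the Jacobian of [rescale]. The integral is split at a fixed distance
    from q^0 into a dominated part and a negligible one. *)
Lemma cvg_integral_posterior_kernel :
  ((Num.sqrt n%:R ^+ d)%:E *
   \int[lebesgue_tuple R d]_q (u (centered n q) * G n q)%:E)%E @[n --> \oo] -->
  ((Pi q0v)%:E * \int[lebesgue_tuple R d]_t (u t * bridge_density f t)%:E)%E.
Proof.
have mc j : measurable_fun setT (fun t : d.-tuple R => qcoord f t j).
  by apply: measurable_funM => //; case: j => [|j] /=; [exact: measurable_cst|exact: measurable_nth_tuple].
have mb : measurable_fun setT (fun t : d.-tuple R => bridge_density f t).
  apply: (measurableT_comp (@measurable_expR R)); apply: measurable_funN; apply: measurable_funM => //.
  by apply: measurable_sum => j; apply: measurable_funX; exact: measurable_funB.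
have [de de0 cn] := cvg_near; have cf := cvg_far de0.
have -> : ((Pi q0v)%:E * \int[lebesgue_tuple R d]_t (u t * bridge_density f t)%:E =
    \int[lebesgue_tuple R d]_t (u t * (Pi q0v * bridge_density f t))%:E + 0)%E.
  rewrite adde0 -ge0_integralZl ?lee_fin ?(ltW Pi0)//.
  - by apply: eq_integral => t _; rewrite -EFinM mulrCA.
  - by apply/measurable_EFinP; exact: measurable_funM.
  - by move=> t _; rewrite lee_fin mulr_ge0 ?expR_ge0.
apply: cvg_trans (cvgeD _ cn cf); last exact: fin_num_adde_defl.
apply: near_eq_cvg; near=> n.
have n0 : (0 < n)%N by near: n; exact: nbhs_infty_gt.
have sn : 0 < Num.sqrt n%:R :> R by rewrite sqrtr_gt0 ltr0n.
have mcu : measurable_fun setT (fun q => u (centered n q)).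
  by apply: measurableT_comp => //; exact: measurable_centered.
have mG := measurable_posterior_kernel n.
have mN := measurable_near de.
have mN' : measurable_fun setT (fun q => (~~ near_quantiles de q)%:R : R).
  rewrite (_ : (fun q => _) = fun q => 1 - (near_quantiles de q)%:R); last first.
    by apply/funext => q; case: (near_quantiles de q); rewrite ?subrr ?subr0.
  exact: measurable_funB.
have m1 : measurable_fun setT (fun q => u (centered n q) * ((near_quantiles de q)%:R * G n q)).
  by do 2!apply: measurable_funM => //.
have m2 : measurable_fun setT (fun q => u (centered n q) * ((~~ near_quantiles de q)%:R * G n q)).
  by do 2!apply: measurable_funM => //.
have E : (\int[lebesgue_tuple R d]_q (u (centered n q) * G n q)%:E =
  \int[lebesgue_tuple R d]_q (u (centered n q) * ((near_quantiles de q)%:R * G n q))%:E +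
  \int[lebesgue_tuple R d]_q (u (centered n q) * ((~~ near_quantiles de q)%:R * G n q))%:E)%E.
  rewrite -ge0_integralD//.
  - apply: eq_integral => q _; rewrite -EFinD; congr EFin.
    by case: (near_quantiles de q) => /=; ring.
  - by move=> q _; rewrite lee_fin uG0.
  - exact/measurable_EFinP.
  - by move=> q _; rewrite lee_fin uG0.
  - exact/measurable_EFinP.
have i0 (b : bool -> bool) : (0 <= \int[lebesgue_tuple R d]_q
    (u (centered n q) * ((b (near_quantiles de q))%:R * G n q))%:E)%E.
  by apply: integral_ge0 => q _; rewrite lee_fin uG0.
rewrite E (ge0_muleDr _ (i0 id) (i0 negb)).
congr (_ + _)%E.
rewrite [in RHS](@ge0_integral_chain_map R d (qs n) (fun=> (Num.sqrt n%:R)^-1) (fun=> 0) 0).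
- rewrite muleA -EFinM prodr_const card_ord gtr0_norm ?invr_gt0// -exprMn divff ?gt_eqF//.
  rewrite expr1n mul1e; apply: eq_integral => t _.
  by rewrite -/(rescale n t) centered_rescale.
- by move=> i; rewrite invr_neq0 ?gt_eqF.
- exact/measurable_EFinP.
- by move=> q; rewrite lee_fin uG0.
Unshelve. all: by end_near. Qed.

End test_function.

(** A ratio of two instances of the previous limit, for u = g + M and for 1: the prior value at q^0
    and the bridge constant c cancel. *)
Lemma cvg_pseudo_posterior d' (T' : measurableType d') (P' : probability T' R)
    (W : R -> {RV P' >-> R}) : brownian_bridge W ->
  let g n (q : d.-tuple R) := Pi q * @multinomial_likelihood R d.+1 x n q in
  cvg_in_distribution
    (fun n => pushforward (fun A => ((fine (\int[lebesgue_tuple R d]_q (g n q)%:E))^-1%:E *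
       \int[lebesgue_tuple R d]_(q in A) (g n q)%:E)%E) (centered n))
    (pushforward P' (fun w => [tuple W (i.+1%:R / d.+1%:R) w / f i.+1 | i < d])).
Proof.
move=> bW L g cg [M gM].
have G_ge0 := posterior_kernel_ge0; have mG := measurable_posterior_kernel.
have M0 : 0 <= M by rewrite (le_trans _ (gM [tuple 0 | _ < d])).
pose Clim w : d.-tuple R := [tuple W (i.+1%:R / d.+1%:R) w / f i.+1 | i < d].
rewrite -/Clim.
have mClim : measurable_fun setT Clim.
  by apply: measurable_fun_tuple => i; exact: measurable_funM.
pose u v := g v + M.
have cu : continuous (u \o @tuple_of_row R d).
  have cgM := @continuousD _ _ 'rV[R]_d (g \o @tuple_of_row R d) (cst M).
  by move=> v; apply: cgM; [exact: cg|exact: cst_continuous].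
have u2M v : 0 <= u v <= M + M.
  by have := gM v; rewrite ler_norml /u => /andP[]; lra.
have u0 v : 0 <= u v by case/andP: (u2M v).
have mg : measurable_fun setT g by exact: measurable_continuous_tuple.
have mu_ : measurable_fun setT u by exact: measurable_continuous_tuple.
have [c c0 Hc] := bridge_limit_density bW f_gt0.
have PT : P' setT = 1%E by exact: probability_setT.
have cinv (I : \bar R) (r : R) : (r%:E = c%:E * I)%E -> I = (c^-1 * r)%:E.
  by move=> E; rewrite EFinM E muleA -EFinM mulVf ?gt_eqF// mul1e.
(* The test function 1 identifies the mass of [bridge_density] as 1/c. *)
have E1 : (\int[lebesgue_tuple R d]_t (cst 1 t * bridge_density f t)%:E = (c^-1 * 1)%:E)%E.
  apply: cinv; rewrite -(Hc (cst 1) 1).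
  - by rewrite /= integral_cst// mul1e; exact/esym/PT.
  - exact: cst_continuous.
  - by move=> v; rewrite /= ler01 lexx.
have [e Ee] : exists e : R, (\int[P']_w (u (Clim w))%:E = e%:E)%E.
  exists (fine (\int[P']_w (u (Clim w))%:E)); rewrite fineK//.
  apply: integrable_fin_num => //.
  apply: (@integrable_bounded _ _ _ _ _ (M + M)); first by apply: le_lt_trans (ltry 1); rewrite -[leRHS]PT.
    exact: measurableT_comp.
  by move=> w; have /andP[a b] := u2M (Clim w); rewrite ger0_norm.
have E2 : (\int[lebesgue_tuple R d]_t (u t * bridge_density f t)%:E = (c^-1 * e)%:E)%E.
  by apply: cinv; rewrite -Ee (Hc u (M + M)).
have cA := @cvg_integral_posterior_kernel u (M + M) cu u2M; rewrite E2 -EFinM in cA.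
have cB : ((Num.sqrt n%:R ^+ d)%:E * \int[lebesgue_tuple R d]_q (G n q)%:E)%E @[n --> \oo] -->
    (Pi q0v * (c^-1 * 1))%:E.
  rewrite EFinM -E1.
  have one01 (v : d.-tuple R) : 0 <= (cst 1 v : R) <= 1 by rewrite ler01 lexx.
  have H := @cvg_integral_posterior_kernel (cst 1) 1 (@cst_continuous _ _ _) one01.
  apply: cvg_trans H; apply: near_eq_cvg; apply: nearW => n.
  by congr (_ * _)%E; apply: eq_integral => q _; rewrite mul1r.
have lim0 : 0 < Pi q0v * (c^-1 * 1) by rewrite mulr1 divr_gt0.
have /fine_cvgP[finA cvA0] := cA; have /fine_cvgP[finB cvB0] := cB.
pose a n : R := fine ((Num.sqrt n%:R ^+ d)%:E *
  \int[lebesgue_tuple R d]_q (u (centered n q) * G n q)%:E)%E.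
pose b n : R := fine ((Num.sqrt n%:R ^+ d)%:E * \int[lebesgue_tuple R d]_q (G n q)%:E)%E.
have cvA : a n @[n --> \oo] --> Pi q0v * (c^-1 * e) by exact: cvA0.
have cvB : b n @[n --> \oo] --> Pi q0v * (c^-1 * 1) by exact: cvB0.
have cab : (a n / b n - M)%:E @[n --> \oo] --> (e - M)%:E.
  apply: cvg_EFin; first exact: nearW.
  apply: cvgB; last exact: cvg_cst.
  have -> : e = Pi q0v * (c^-1 * e) / (Pi q0v * (c^-1 * 1)).
    by field; rewrite !gt_eqF.
  by apply: cvgM => //; apply: cvgV => //; rewrite gt_eqF.
rewrite (integral_pushforward_bounded PT mClim mg gM).
rewrite (_ : (\int[P']_w (g (Clim w) + M)%:E = e%:E)%E) // -EFinB.
apply: cvg_trans cab; apply: near_eq_cvg.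
have /cvgrPdist_lt/(_ _ lim0) nearB := cvB.
near=> n.
have dn : (d < n)%N by near: n; exact: nbhs_infty_gt.
have sn : 0 < Num.sqrt n%:R ^+ d :> R.
  by rewrite exprn_gt0// sqrtr_gt0 ltr0n (leq_trans _ dn).
have fin_of (s : R) (I : \bar R) : 0 < s -> (s%:E * I)%E \is a fin_num -> I \is a fin_num.
  by case: I => [r//||] s0; rewrite ?gt0_muley ?gt0_muleNy ?lte_fin.
have fA : ((Num.sqrt n%:R ^+ d)%:E * \int[lebesgue_tuple R d]_q (u (centered n q) * G n q)%:E)%E
    \is a fin_num by near: n; exact: finA.
have fB : ((Num.sqrt n%:R ^+ d)%:E * \int[lebesgue_tuple R d]_q (G n q)%:E)%E
    \is a fin_num by near: n; exact: finB.
have b0 : 0 < b n.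
  have : `|Pi q0v * (c^-1 * 1) - b n| < Pi q0v * (c^-1 * 1) by near: n; exact: nearB.
  by rewrite ltr_norml => /andP[_]; lra.
have fI := fin_of _ _ sn fA; have fZ := fin_of _ _ sn fB.
have aE : a n = Num.sqrt n%:R ^+ d * fine (\int[lebesgue_tuple R d]_q (u (centered n q) * G n q)%:E)%E.
  by rewrite /a /= fineM.
have bE : b n = Num.sqrt n%:R ^+ d * fine (\int[lebesgue_tuple R d]_q (G n q)%:E)%E.
  by rewrite /b /= fineM.
set I := (\int[lebesgue_tuple R d]_q (u (centered n q) * G n q)%:E)%E in fI aE.
set Z := (\int[lebesgue_tuple R d]_q (G n q)%:E)%E in fZ bE.
have Z0 : 0 < fine Z by move: b0; rewrite bE pmulr_rgt0.
have dn' : (0 < n %/ d.+1)%N by rewrite divn_gt0.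
pose kap : R := likelihood_const d.+1 n (n %/ d.+1).
have kap0 : 0 < kap by exact: likelihood_const_gt0.
(* The factorisation of the likelihood needs increasing q; where the prior vanishes, both sides are
   0 anyway. *)
have LE : L n = fun q => kap * G n q.
  apply/funext => q; rewrite /L /posterior_kernel.
  have := Pi_ge0 q; rewrite le_eqVlt => /predU1P[<-|Piq]; first by rewrite !mul0r mulr0.
  by rewrite (@multinomial_likelihoodE R x d.+1 q isT x01 (Pi_path Piq) n _ dn') mulrCA.
have mL : measurable_fun setT (L n) by rewrite LE; exact: measurable_funM.
have L0 q : 0 <= L n q by rewrite LE mulr_ge0 ?(ltW kap0).
have intL : (\int[lebesgue_tuple R d]_q (L n q)%:E = (kap * fine Z)%:E)%E.
  rewrite EFinM fineK// /Z -ge0_integralZl ?lee_fin ?(ltW kap0)//.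
  - by rewrite LE.
  - exact/measurable_EFinP.
  - by move=> q _; rewrite lee_fin.
have cn0 : 0 <= (fine (\int[lebesgue_tuple R d]_q (L n q)%:E)%E)^-1.
  by rewrite intL /= invr_ge0 mulr_ge0 ?ltW.
(* For large n the normaliser is positive and finite, and the pseudo-posterior is recognised as a
   genuine probability measure. *)
pose nu := mscale (NngNum cn0) (density_measure (lebesgue_tuple R d) mL L0).
rewrite [X in pushforward X _](_ : _ = nu)//.
have nuT : nu setT = 1%E.
  rewrite /nu /mscale /= /density_measure intL /= -EFinM mulVf// gt_eqF// mulr_gt0//.
rewrite (integral_pushforward_bounded nuT (measurable_centered n) mg gM).
rewrite EFinB; congr (_ - _)%E.
change ((a n / b n)%:E = \int[nu]_q (u (centered n q))%:E)%E.
have muc : measurable_fun setT (fun q => (u (centered n q))%:E).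
  by apply/measurable_EFinP; apply: measurableT_comp => //; exact: measurable_centered.
rewrite ge0_integral_mscale//; last by move=> q _; rewrite lee_fin.
rewrite ge0_integral_density_measure//; last by move=> q; rewrite lee_fin.
have -> : (\int[lebesgue_tuple R d]_q ((u (centered n q))%:E * (L n q)%:E) = kap%:E * I)%E.
  rewrite /I -ge0_integralZl//.
  - by apply: eq_integral => q _; rewrite LE -!EFinM mulrCA.
  - apply/measurable_EFinP; apply: measurable_funM => //.
    by apply: measurableT_comp => //; exact: measurable_centered.
  - by move=> q _; rewrite lee_fin mulr_ge0.
  - by rewrite lee_fin ltW.
have cE : (NngNum cn0)%:num = (kap * fine Z)^-1 by rewrite /= intL.
rewrite cE -(fineK fI) -!EFinM aE bE; congr EFin.
move: (kap) kap0 (fine I) (fine Z) Z0 (Num.sqrt n%:R ^+ d) sn => K K0 i z z0 s s0.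
by field; rewrite !gt_eqF.
Unshelve. all: by end_near. Qed.

End posterior_asymptotics.

(** The same result for k instead of [d.+1], so that k = 2^m, which is not syntactically a
    successor, can be substituted. *)
Lemma cvg_pseudo_posterior_cells {R : realType} (x : nat -> R) (k : nat) (q0 f : nat -> R)
    (Pi : k.-1.-tuple R -> R) d' (T' : measurableType d') (P' : probability T' R)
    (W : R -> {RV P' >-> R}) :
  (0 < k)%N ->
  (forall i, 0 < x i <= 1) ->
  (forall j, (1 <= j < k)%N -> 0 < f j) ->
  (forall j, (1 <= j < k)%N ->
    (cnt x n (q0 j))%:R / n%:R @[n --> \oo] --> (j%:R / k%:R : R)) ->
  (forall j, (1 <= j < k)%N -> forall eta, 0 < eta -> exists2 de, 0 < de &
    \forall n \near \oo, forall a b, q0 j - de <= a -> a <= b -> b <= q0 j + de ->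
      `|(cnt x n b)%:R - (cnt x n a)%:R - n%:R * f j * (b - a)| <=
      eta * (Num.sqrt n%:R + n%:R * (b - a))) ->
  measurable_fun setT Pi -> (forall q, 0 <= Pi q) ->
  (forall q, 0 < Pi q -> path <%R 0 (rcons q 1)) ->
  (\int[lebesgue_tuple R k.-1]_q (Pi q)%:E <= 1)%E ->
  0 < Pi [tuple q0 i.+1 | i < k.-1] ->
  {for row_of_tuple [tuple q0 i.+1 | i < k.-1], continuous (Pi \o @tuple_of_row R k.-1)} ->
  brownian_bridge W ->
  let g n (q : k.-1.-tuple R) := Pi q * multinomial_likelihood x n q in
  cvg_in_distribution
    (fun n => pushforward (fun A => ((fine (\int[lebesgue_tuple R k.-1]_q (g n q)%:E))^-1%:E *
       \int[lebesgue_tuple R k.-1]_(q in A) (g n q)%:E)%E)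
       (fun q => [tuple Num.sqrt n%:R *
          (tnth q i - quantile_fun (ecdf x n) (i.+1%:R / k%:R)) | i < k.-1]))
    (pushforward P' (fun w => [tuple W (i.+1%:R / k%:R) w / f i.+1 | i < k.-1])).
Proof.
case: k Pi => // k Pi _ x01 f0 lln osc mPi Pi0 Pip iPi Piq0 cPi bW.
exact: (cvg_pseudo_posterior x01 f0 lln osc mPi Pi0 Pip iPi Piq0 cPi bW).
Qed.

Theorem proposition8p1 (R : realType)
  (d : measure_display) (T : measurableType d) (P : probability T R)
  (X : nat -> {RV P >-> R}) (f0 : R -> R)
  (m : nat) (dens : nat -> nat -> R -> R -> R -> R)
  (d' : measure_display) (T' : measurableType d') (P' : probability T' R)
  (W : R -> {RV P' >-> R}) :
  let k := (2 ^ m)%N in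
  let q0 (j : nat) : R :=
    quantile_fun (cdf_of_density f0) (j%:R / k%:R) in
  let q0vec : k.-1.-tuple R := [tuple q0 i.+1 | i < k.-1] in
  let qstar (x : nat -> R) (n j : nat) : R :=
    quantile_fun (ecdf x n) (j%:R / k%:R) in
  let C (x : nat -> R) (n : nat) (q : k.-1.-tuple R) : k.-1.-tuple R :=
    [tuple Num.sqrt n%:R * (tnth q i - qstar x n i.+1) | i < k.-1] in
  let Clim (w : T') : k.-1.-tuple R :=
    [tuple W (i.+1%:R / k%:R) w / f0 (q0 i.+1) | i < k.-1] in
  (1 <= m)%N ->
  is_density 0 1 f0 ->
  mutually_independent X ->
  (forall i, has_density (X i) f0) ->
  (forall j, (1 <= j < k)%N ->
    0 < f0 (q0 j) /\ {for q0 j, continuous f0}) ->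
  quantile_pyramid m dens ->
  0 < pyramid_prior dens q0vec ->
  {for row_of_tuple q0vec,
    continuous (fun v => pyramid_prior dens (tuple_of_row v))} ->
  brownian_bridge W ->
  {ae P, forall w, cvg_in_distribution
    (fun n => pushforward
       (@pseudo_posterior R m dens (fun i => X i w) n) (C (fun i => X i w) n))
    (pushforward P' Clim)}.
Proof.
move=> k q0 q0vec qstar C Clim m1 df0 indX Xf0 f0q0 qp Pi0 cPi bW.
have k0 : (0 < k)%N by rewrite expn_gt0.
have kR : 0 < k%:R :> R by rewrite ltr0n.
have ae_lln0 : {ae P, forall w, forall j, (1 <= j < k)%N ->
    (cnt (X ^~ w) n (q0 j))%:R / n%:R @[n --> \oo] --> (j%:R / k%:R : R)}.
  (* The property is vacuous outside 1 <= j < k, so a countable intersection over all j is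
     available. *)
  apply: ae_foralln => j; have [jk|jk] := boolP (1 <= j < k)%N; last first.
    by apply: aeW => w.
  have := ae_lln indX Xf0 (q0 j); apply: filterS => w H _.
  have /andP[j0 j1] := jk; have [_ cf] := f0q0 j jk.
  (* The law of large numbers converges to F0(q0 j), which equals j/k because the density is
     continuous there. *)
  rewrite -(cdf_quantile df0 Xf0 _ _ cf) ?divr_gt0 ?ltr0n//.
  by rewrite ltr_pdivrMr// mul1r ltr_nat.
have ae_osc0 : {ae P, forall w, forall j, (1 <= j < k)%N ->
    forall eta : R, 0 < eta -> exists2 de : R, 0 < de &
    \forall n \near \oo, forall a b, q0 j - de <= a -> a <= b -> b <= q0 j + de ->
      `|(cnt (X ^~ w) n b)%:R - (cnt (X ^~ w) n a)%:R - n%:R * f0 (q0 j) * (b - a)| <=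
      eta * (Num.sqrt n%:R + n%:R * (b - a))}.
  apply: ae_foralln => j; have [jk|jk] := boolP (1 <= j < k)%N; last first.
    by apply: aeW => w.
  have [fj cf] := f0q0 j jk.
  by have := ae_osc indX df0 Xf0 fj cf; apply: filterS => w H _.
have := ae_sample_itv df0 Xf0.
move: ae_osc0; apply: filterS3 ae_lln0 => w lln osc x01.
have PiE : @pyramid_prior R m dens = fun q => prior_seq dens m m q.
  by apply/funext => q; exact: pyramid_priorE.
apply: (@cvg_pseudo_posterior_cells R (X ^~ w) k q0 (f0 \o q0)
  (@pyramid_prior R m dens) _ T' P' W) => //.
- by move=> j jk; case: (f0q0 j jk).
- by rewrite PiE; exact: (measurable_prior_seq qp).
- by move=> q; rewrite PiE (prior_seq_ge0 qp)// size_tuple.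
- by move=> q; rewrite /pyramid_prior; case: ifP => //; rewrite ltxx.
- by rewrite PiE; exact: (integral_prior_seq_le1 qp).
Qed.
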